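(* Let $e$ be a positive integer with $e\le\delta$ and let $m\in\{0,1,\ldots,n\}$ be such that $E_e^{r,s}=0$ for all $r,s$ with $r+s=m$. Then for every rational number $b$ with $$\frac{\delta}{(p-1)(\delta-e+1)}<b<\frac{p\delta}{(p-1)\delta+e-1}$$ we have $$H^m(\Omega^{\bullet}_{C(b)},D)=0.$$ If $E_e^{r,s}=0$ for all $r,s$ with $r+s\neq n$, then, in addition, for every rational $b$ in the same range we have $$\dim_{\tilde{\Omega}_0}H^n(\Omega^{\bullet}_{C(b)},D)=M_f.$$
   Context: Let $p$ be a prime, $q=p^a$, $n\ge 1$, and let $f\in\mathbf{F}_q[x_1,\ldots,x_n]$ be a polynomial of degree $\delta\ge 1$, written $f=f^{(\delta)}+f^{(\delta-1)}+\cdots+f^{(0)}$ with $f^{(j)}$ homogeneous of degree $j$. Put $M_f=\dim_{\mathbf{F}_q}\mathbf{F}_q[x_1,\ldots,x_n]/(\partial f/\partial x_1,\ldots,\partial f/\partial x_n)$ (when finite this is the sum of the Milnor numbers of the critical points of $f$). The spectral sequence $E$. Let $\Omega^k_{\mathbf{F}_q[x]/\mathbf{F}_q}$ be the module of differential $k$-forms of $\mathbf{F}_q[x_1,\ldots,x_n]$ over $\mathbf{F}_q$, and let $\phi_f(\omega)=df\wedge\omega$, giving a complex $(\Omega^{\bullet}_{\mathbf{F}_q[x]/\mathbf{F}_q},\phi_f)$. A $k$-form $\omega=\sum\omega(i_1,\ldots,i_k)\,dx_{i_1}\wedge\cdots\wedge dx_{i_k}$ is called homogeneous if all coefficients $\omega(i_1,\ldots,i_k)$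 are homogeneous polynomials of the same degree $l$; then $\deg_{\rm coeff}\omega=l$ and $\deg\omega=l+(n-k)(\delta-1)$. Let $F_l\Omega^k_{\mathbf{F}_q[x]/\mathbf{F}_q}$ be the $\mathbf{F}_q$-span of the homogeneous $k$-forms of $\deg\le l$. This is an increasing filtration making $(\Omega^{\bullet}_{\mathbf{F}_q[x]/\mathbf{F}_q},\phi_f)$ a filtered complex; $E_t^{r,s}$ denotes the associated spectral sequence $$E_1^{r,s}=H^{r+s}(F_r/F_{r-1}(\Omega^{\bullet}_{\mathbf{F}_q[x]/\mathbf{F}_q},\phi_f))\Rightarrow H^{r+s}(\Omega^{\bullet}_{\mathbf{F}_q[x]/\mathbf{F}_q},\phi_f).$$ Explicitly, with $W_t^{r,s}=\{\omega\in F_r\Omega^{r+s}: df\wedge\omega\in F_{r-t}\Omega^{r+s+1}\}$, one has $E_t^{r,s}=(W_t^{r,s}+F_{r-1}\Omega^{r+s})/(\phi_f(W_{t-1}^{r+t-1,s-t})+F_{r-1}\Omega^{r+s})$. The $p$-adic complex. Let $K$ be the unramified extension of $\mathbf{Q}_p$ of degree $a$, $\Omega_1=\mathbf{Q}_p(\zeta_p)$ with $\zeta_p$ a primitive $p$-th root of unity, $\Omega_0=K(\zeta_p)$, and let $\tau$ be the generator of ${\rm Gal}(\Omega_0/\Omega_1)\simeq{\rm Gal}(K/\mathbf{Q}_p)$ lifting the Frobenius $x\mapsto x^p$ of $\mathbf{F}_q$. Let ${\rm ord}$ be the $p$-adic valuation with ${\rm ord}\,p=1$. Let $\gamma\in\Omega_1$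 satisfy $\sum_{i\ge0}\gamma^{p^i}/p^i=0$ and ${\rm ord}\,\gamma=1/(p-1)$, and put $\gamma_l=\sum_{i=0}^l\gamma^{p^i}/p^i$. Let $b$ be a rational number, $0<b<p/(p-1)$; choose a positive integer $M$ such that $Mb/p$ and $M\delta/(p(p-1))$ are integers, let $\pi$ satisfy $\pi^{M\delta}=p$, and put $\tilde\Omega_0=\Omega_0(\pi)$. For $u\in\mathbf{N}^n$ put $|u|=u_1+\cdots+u_n$, and set $$C(b)=\Bigl\{\sum_{u\in\mathbf{N}^n}A_u\pi^{Mb|u|}x^u : A_u\in\tilde\Omega_0,\ A_u\to0\text{ as }u\to\infty\Bigr\}.$$ Let $\hat f\in K[x_1,\ldots,x_n]$ be the Teichmüller lifting of $f$ (each coefficient $\hat a_u$ satisfies $\hat a_u^q=\hat a_u$ and reduces to the coefficient $a_u$ of $f$), and $\hat f_i=\partial\hat f/\partial x_i$. For $i=1,\ldots,n$ define $$H_i=\sum_{l=0}^{\infty}\gamma_lp^lx_i^{p^l-1}\hat f_i^{\tau^l}(x^{p^l}),\qquad D_i=\pi^{\epsilon}\frac{\partial}{\partial x_i}+\pi^{\epsilon}H_i,\qquad \epsilon=Mb(\delta-1)-\frac{M\delta}{p-1},$$ where $\hat f_i^{\tau^l}$ is obtained by applying $\tau^l$ to the coefficients and $x^{p^l}=(x_1^{p^l},\ldots,x_n^{p^l})$; the $D_i$ act on $C(b)$. Let $\Omega^k_{C(b)}=\bigoplus_{i_1<\cdots<i_k}C(b)\,dx_{i_1}\wedge\cdots\wedge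 dx_{i_k}$ with differential $$D(\xi\,dx_{i_1}\wedge\cdots\wedge dx_{i_k})=\Bigl(\sum_{i=1}^nD_i(\xi)\,dx_i\Bigr)\wedge dx_{i_1}\wedge\cdots\wedge dx_{i_k}.$$ *)

(* Defs.v *)
From HB Require Import structures.
From mathcomp Require Import all_boot all_order all_algebra all_field.
From mathcomp Require Import mathcomp_extra boolp classical_sets functions.
From mathcomp Require Import mpoly.

Set Implicit Arguments.
Unset Strict Implicit.
Unset Printing Implicit Defensive.

Import Order.TTheory GRing.Theory Num.Theory.

Local Open Scope classical_set_scope.
Local Open Scope ring_scope.

Section Quotients.
Variables (F : fieldType) (V : lmodType F).
Implicit Types (S Z B : set V).

Definition lin_span S : set V :=
  [set v | exists (m : nat) (c : 'I_m -> F) (w : 'I_m -> V),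
     (forall i, S (w i)) /\ v = \sum_i c i *: w i].

Definition sum_set S Z : set V := [set x + y | x in S & y in Z].

(* In the next two definitions Z and B are subspaces with B contained in Z. *)
Definition quot_eq0 Z B : Prop := Z `<=` B.

(* The classes of some z_0, ..., z_(d-1) in Z form a basis of Z / B. *)
Definition quot_dim Z B (d : nat) : Prop :=
  exists z : 'I_d -> V,
    [/\ forall i, Z (z i),
        forall v, Z v -> exists c : 'I_d -> F, B (v - \sum_i c i *: z i)
      & forall c : 'I_d -> F, B (\sum_i c i *: z i) -> forall i, c i = 0].

End Quotients.

(* The value of a form at I = {i_1 < ... < i_k} is its coefficient on         *)
(* dx_{i_1} /\ ... /\ dx_{i_k}.                                               *)
Notation forms n A := {ffun {set 'I_n} -> A}.

Section Forms.
Variables (F : fieldType) (n : nat) (A : lmodType F).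

(* Degrees are integers: there is only the zero k-form when k < 0 or n < k.   *)
Definition is_form (C : set A) (k : int) : set (forms n A) :=
  [set w : forms n A | forall I : {set 'I_n}, C (w I) /\ (#|I|%:Z != k -> w I = 0)].

(* The map  xi dx_I |-> (\sum_i theta_i(xi) dx_i) /\ dx_I :  moving dx_i to   *)
(* its place in dx_J, J = I + i, costs a sign for each j < i in J.            *)
Definition koszul (theta : 'I_n -> A -> A) (w : forms n A) : forms n A :=
  [ffun J : {set 'I_n} =>
     \sum_(i in J) (-1) ^+ #|[set j in J | (j < i)%N]%SET| *:
       theta i (w (J :\ i)%SET)].

End Forms.

Section SpectralSequence.
Variables (F : fieldType) (n : nat) (f : {mpoly F[n]}).

Local Notation delta := (msize f).-1.
Local Notation Omega := (forms n {mpoly F[n]}).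

Definition phi : Omega -> Omega := koszul (fun i g => f^`M(i) * g).

Definition homog_form (k : int) (l : nat) : set Omega :=
  [set w : Omega | is_form setT k w /\ forall I, w I \is l.-homog].

Definition filt (r k : int) : set Omega :=
  lin_span [set w : Omega | exists l : nat,
    homog_form k l w /\ l%:Z + (n%:Z - k) * (delta%:Z - 1) <= r].

Definition Wss (t r s : int) : set Omega :=
  [set w : Omega | filt r (r + s) w /\ filt (r - t) (r + s + 1) (phi w)].

Definition Ess_num (t r s : int) : set Omega :=
  sum_set (Wss t r s) (filt (r - 1) (r + s)).

Definition Ess_den (t r s : int) : set Omega :=
  sum_set (phi @` Wss (t - 1) (r + t - 1) (s - t)) (filt (r - 1) (r + s)).

Definition Ess_eq0 (t r s : int) : Prop :=
  quot_eq0 (Ess_num t r s) (Ess_den t r s).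

Definition jacobian_ideal : set {mpoly F[n]} :=
  [set g | exists h : 'I_n -> {mpoly F[n]}, g = \sum_i h i * f^`M(i)].

Definition Mf_is (d : nat) : Prop := quot_dim setT jacobian_ideal d.

End SpectralSequence.

Section Padic.

(* A rational-valued valuation; the value of [ord] at 0 is irrelevant.        *)
Definition is_valuation (F : fieldType) (ord : F -> rat) : Prop :=
  (forall x y : F, x != 0 -> y != 0 -> ord (x * y) = ord x + ord y) /\
  (forall x y : F, x != 0 -> y != 0 -> x + y != 0 ->
     Num.min (ord x) (ord y) <= ord (x + y)).

(* ord x >= r, with ord 0 = +oo.                                              *)
Definition ord_ge (F : fieldType) (ord : F -> rat) (r : rat) (x : F) : bool :=
  (x == 0) || (r <= ord x).

Definition tends_to (F : fieldType) (ord : F -> rat) (u : nat -> F) (x : F) :=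
  forall r, exists N, forall m, (N <= m)%N -> ord_ge ord r (u m - x).

Definition is_cauchy (F : fieldType) (ord : F -> rat) (u : nat -> F) :=
  forall r, exists N, forall l m,
    (N <= l)%N -> (N <= m)%N -> ord_ge ord r (u l - u m).

(* Q_p, as the completion of Q for the valuation normalized by ord p = 1.     *)
Record is_Qp (p : nat) (Q : fieldType) (ord : Q -> rat) : Prop := {
  Qp_valuation : is_valuation ord;
  Qp_p_neq0 : (p%:R : Q) != 0;
  Qp_ord_p : ord p%:R = 1;
  Qp_dense : forall (x : Q) (r : rat), exists z : rat, ord_ge ord r (x - ratr z);
  Qp_complete : forall u : nat -> Q, is_cauchy ord u -> exists x, tends_to ord u x
}.

(* K is unramified of degree a over Q_p (same value group), and red induces   *)
(* an isomorphism of its residue field with F_q; the values of red outside of *)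
(* the valuation ring of K are irrelevant.                                    *)
Record is_unramified (a : nat) (Fq : finFieldType) (Qp : fieldType)
    (L : fieldExtType Qp) (ord : L -> rat) (K : {subfield L}) (red : L -> Fq)
    : Prop := {
  unr_dim : \dim K = a;
  unr_value_group : forall x, x \in K -> x != 0 ->
    exists y : Qp, y != 0 /\ ord x = ord y%:A;
  unr_red1 : red 1 = 1;
  unr_redD : forall x y, x \in K -> y \in K -> ord_ge ord 0 x ->
    ord_ge ord 0 y -> red (x + y) = red x + red y;
  unr_redM : forall x y, x \in K -> y \in K -> ord_ge ord 0 x ->
    ord_ge ord 0 y -> red (x * y) = red x * red y;
  unr_red_eq0 : forall x, x \in K -> ord_ge ord 0 x ->
    (red x == 0) = (x == 0) || (0 < ord x);
  unr_red_surj : forall c : Fq, exists x, [/\ x \in K, ord_ge ord 0 x & red x = c]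
}.

Definition gamma_ (Qp : fieldType) (L : fieldExtType Qp) (p : nat) (gamma : L)
    (l : nat) : L :=
  \sum_(i < l.+1) gamma ^+ (p ^ i) / p%:R ^+ i.

(* L stands for K(zeta_p, pi), a finite extension of Q_p, and ord for the     *)
(* p-adic valuation of L.                                                     *)
Record dwork_setting (p a delta : nat) (Fq : finFieldType) (b : rat)
    (Qp : fieldType) (L : fieldExtType Qp) (ord : L -> rat) (K : {subfield L})
    (red : L -> Fq) (zeta : L) (tau : 'End(L)) (gamma : L) (M : nat) (pi : L)
    : Prop := {
  ds_valuation : is_valuation ord;
  ds_Qp : is_Qp p (fun x : Qp => ord x%:A);
  ds_K : is_unramified a ord K red;
  ds_zeta : p.-primitive_root zeta;
  (* tau need not be multiplicative, nor an automorphism, outside of K(zeta)  *)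
  ds_tau_aut : kAut <<1; zeta>>%VS <<K; zeta>>%VS tau;
  ds_tau_frob : forall x, x \in K -> ord_ge ord 0 x -> red (tau x) = red x ^+ p;
  ds_gamma_in : gamma \in <<1; zeta>>%VS;
  ds_gamma_root : tends_to ord (gamma_ p gamma) 0;
  ds_gamma_neq0 : gamma != 0;
  ds_gamma_ord : ord gamma = 1 / (p%:R - 1);
  ds_M_gt0 : (0 < M)%N;
  ds_M_b : M%:R * b / p%:R \is a Num.int;
  ds_M_delta : M%:R * delta%:R / (p%:R * (p%:R - 1)) \is a @Num.int rat;
  ds_pi : pi ^+ (M * delta) = p%:R;
  ds_L : << <<K; zeta>>; pi>>%VS = fullv
}.

Definition is_teichmuller_lift (n : nat) (Fq : finFieldType) (Qp : fieldType)
    (L : fieldExtType Qp) (K : {subfield L}) (red : L -> Fq)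
    (f : {mpoly Fq[n]}) (fhat : {mpoly L[n]}) : Prop :=
  forall u, [/\ fhat@_u \in K, fhat@_u ^+ #|Fq| = fhat@_u & red fhat@_u = f@_u].

End Padic.

(* A formal power series, given by its coefficients.                          *)
Notation pseries n R := ('X_{1..n} -> R^o).

Section PowerSeries.
Variables (n : nat) (R : fieldType).

Definition ps_mul (g h : pseries n R) : pseries n R := fun u =>
  \sum_(v : 'X_{1..n < (mdeg u).+1} | (v <= u)%MM) g v * h (u - v)%MM.

Definition ps_deriv (i : 'I_n) (g : pseries n R) : pseries n R := fun u =>
  (u i).+1%:R * g (u + U_(i))%MM.

End PowerSeries.

Section DworkComplex.
Variables (n p delta : nat) (b : rat).
Variables (Qp : fieldType) (L : fieldExtType Qp) (ord : L -> rat).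
Variables (tau : 'End(L)) (gamma : L) (M : nat) (pi : L) (fhat : {mpoly L[n]}).

(* M b |u| is an integer in a [dwork_setting].                                *)
Definition Cb : set (pseries n L) :=
  [set g | exists A : 'X_{1..n} -> L,
     (forall r, exists N, forall u, (N <= mdeg u)%N -> ord_ge ord r (A u)) /\
     forall u, g u = A u * pi ^ Num.floor (M%:R * b * (mdeg u)%:R)].

Definition H_term (i : 'I_n) (l : nat) : {mpoly L[n]} :=
  (gamma_ p gamma l * p%:R ^+ l) *:
    ('X_i ^+ (p ^ l).-1 *
     (map_mpoly (iter l tau) fhat^`M(i) \mPo [tuple 'X_j ^+ (p ^ l) | j < n])).

(* All monomials of [H_term i l] have degree at least p ^ l - 1 >= l, so that *)
(* the terms with l > |u| do not contribute to the coefficient of x^u.        *)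
Definition H_ (i : 'I_n) : pseries n L := fun u =>
  \sum_(l < (mdeg u).+1) (H_term i l)@_u.

(* An integer in a [dwork_setting], possibly negative.                        *)
Definition epsilon : int :=
  Num.floor (M%:R * b * (delta%:R - 1) - M%:R * delta%:R / (p%:R - 1)).

Definition D_ (i : 'I_n) (xi : pseries n L) : pseries n L :=
  pi ^ epsilon *: (ps_deriv i xi + ps_mul (H_ i) xi).

Definition Dd : forms n (pseries n L) -> forms n (pseries n L) := koszul D_.

Definition HD_cocycles (m : int) : set (forms n (pseries n L)) :=
  [set w : forms n (pseries n L) | is_form Cb m w /\ Dd w = 0].

Definition HD_coboundaries (m : int) : set (forms n (pseries n L)) :=
  Dd @` is_form Cb (m - 1).

Definition HD_eq0 (m : int) : Prop :=
  quot_eq0 (HD_cocycles m) (HD_coboundaries m).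

Definition HD_dim (m : int) (d : nat) : Prop :=
  quot_dim (HD_cocycles m) (HD_coboundaries m) d.

End DworkComplex.

(* Main.v *)
Require Import Defs.
From HB Require Import structures.
From mathcomp Require Import all_boot all_order all_algebra all_field.
From mathcomp Require Import mathcomp_extra boolp classical_sets functions.
From mathcomp Require Import mpoly.
From mathcomp Require Import ring lra zify.

Set Implicit Arguments.
Unset Strict Implicit.
Unset Printing Implicit Defensive.

Import Order.TTheory GRing.Theory Num.Theory.

Local Open Scope ring_scope.

(** The idea is to compare sizes. Give the monomial form x^u dx_I the weight
    |u| + (n - |I|)(delta - 1), its degree for the filtration F, and say that
    a form w over L has size at least c when its coefficients satisfy
    ord w_x >= c + (b / delta) weight(x). Up to a nonzero scalar, D is then
    phi + err: here phi, the exterior product with the differential of the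
    lifting of f, does not decrease sizes, and err increases them by
    min(b - 1 / (p - 1), p - (p - 1) b) at least. The first term comes from
    the derivations d/dx_i, the second from the terms l >= 1 of H_i
    ([Err_oge]). An operator that raises weights by less than e loses at most
    (b / delta)(e - 1). The two inequalities on b say that err gains more than
    that ([loss_lt_gain]); it follows that (b / delta)(e - 1) < 1 = ord p
    ([loss_lt1]).

    Over F_q, the spectral sequence only involves finitely many monomials in
    each weight. Linear algebra produces matrices S, P, Q, G whose entries
    are zero unless the weights of the row and of the column differ by less
    than e, and such that, up to lower weight, 1 = phi S + P, where P is the
    projection to the span of a set U of monomials, along the boundaries of
    E_e in the given weight; moreover P = G phi when E_e vanishes in the
    degree considered ([exists_kernels]). Their entries are lifted to the
    integers of K, where p generates the maximal ideal, so that this creates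
    only errors that p divides. Since p and err both gain more than S and G lose,
      w - D S w - P w  and  w - D S w - G D w
    are larger in size than w by a constant ([nge_homotopy],
    [nge_homotopy_exact]). As L is complete, summing the resulting series
    shows that cocycles are coboundaries where E_e vanishes ([vanishing]), and
    that the monomials in U span the top cohomology ([spanning]). They are
    independent ([independence]): by exactness in degree n - 1, a primitive of
    a combination of elements of U may be taken to lose at most
    (b / delta)(e - 1), and the functionals P detect the combination modulo
    what is small.

    Over F_q the same set U is a basis modulo the Jacobian ideal
    ([standard_free], [standard_span]). It is finite because exactness in
    degree n - 1 says that the partial derivatives f_1, ..., f_n have only
    trivial syzygies, hence form a quasi-regular sequence ([quasi_regular]):
    all the f_1^a_1 ... f_n^a_n x^u with u in U are independent, and there
    are too few polynomials of bounded degree for U to be infinite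
    ([U_bound]). *)

(** * Linear algebra over a field *)

Lemma mulmx_factor (F : fieldType) m n p (A : 'M[F]_(m, n)) (B : 'M_(m, p)) :
  (forall v : 'rV_m, v *m A = 0 -> v *m B = 0) -> exists G, B = A *m G.
Proof.
move=> AB; exists (pinvmx A *m B); rewrite mulmxA.
suff: (1%:M - A *m pinvmx A) *m B = 0.
  by rewrite mulmxBl mul1mx => /eqP; rewrite subr_eq0 => /eqP.
apply/row_matrixP => i; rewrite row_mul AB ?row0 // -row_mul.
by rewrite mulmxBl mul1mx mulmxKpV // subrr row0.
Qed.

(** With rows as vectors, B = beta(ker C) is the space to be split off: S is
    a section of beta over B with values in ker C, and P is the projection
    along B to the span of coordinate vectors that form a basis of a
    complement, found as a maximal set of independent rows of the quotient
    map. Q exists because P kills beta(ker C), and G because P kills the image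
    by Pi of ker Phi as soon as that image lies in B. *)
Lemma relative_splitting_mx (F : fieldType) N (C beta : 'M[F]_N) :
  exists (U : pred 'I_N) (S P Q : 'M[F]_N),
    [/\ S *m C = 0,
        1%:M = S *m beta + P,
        beta *m P = C *m Q,
        (forall x z, ~~ U z -> P x z = 0) /\
        (forall x z, U x -> P x z = (x == z)%:R)
      & forall Phi Pi : 'M[F]_N,
          (forall v : 'rV_N, v *m Phi = 0 ->
             exists2 w : 'rV_N, w *m C = 0 & v *m Pi = w *m beta) ->
          exists G, Pi *m P = Phi *m G].
Proof.
(* The rows of K span the quotient by B; g selects a basis among them. *)
pose B := kermx C *m beta; pose K := cokermx B.
pose g := maxrankfun K; pose R := rowsub g K.
pose P := K *m pinvmx R *m rowsub g 1%:M.
have PK : P *m K = K.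
  have -> : P *m K = K *m pinvmx R *m R.
    by rewrite /P -[LHS]mulmxA -rowsubE.
  by rewrite mulmxKpV // eq_maxrowsub.
have BP : B *m P = 0 by rewrite /P /K 2!mulmxA mulmx_coker !mul0mx.
have sub : (1%:M - P <= B)%MS.
  by rewrite submxE mulmxBl mul1mx PK subrr.
pose S := (1%:M - P) *m pinvmx B *m kermx C.
have kerP (w : 'rV_N) : w *m C = 0 -> w *m beta *m P = 0.
  move=> /eqP; rewrite -sub_kermx => /submxP[D ->].
  by rewrite -[D *m _ *m _]mulmxA -mulmxA -/B BP mulmx0.
have [Q QE] : exists Q, beta *m P = C *m Q.
  by apply: mulmx_factor => v /kerP; rewrite mulmxA.
exists (fun z => z \in codom g), S, P, Q; split => //.
- by rewrite -mulmxA mulmx_ker mulmx0.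
- by rewrite -mulmxA mulmxKpV // subrK.
- split=> [x z Uz|x z /codomP[i ->]].
    rewrite mxE big1 // => i _; rewrite !mxE.
    suff /negbTE->: g i != z by rewrite mulr0.
    by apply/eqP => e; case/negP: Uz; rewrite -e codom_f.
  have -> : P (g i) z = row i (rowsub g P) 0 z by rewrite !mxE.
  have -> : rowsub g P = R *m pinvmx R *m rowsub g 1%:M.
    by rewrite /P rowsubE 2!mulmxA -rowsubE.
  by rewrite mulmxVp ?maxrowsub_free // mul1mx !mxE.
move=> Phi Pi ker; apply: mulmx_factor => v /ker[w wC e].
by rewrite mulmxA e kerP.
Qed.

Section FinLinAlg.
Variables (F : fieldType) (T : finType).
Implicit Types (A B : T -> T -> F).

Let N := #|T|.
Let mx A : 'M[F]_N := \matrix_(i, j) A (enum_val i) (enum_val j).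
Let fn (M : 'M[F]_N) : T -> T -> F := fun x y => M (enum_rank x) (enum_rank y).

Let sumE (g : T -> F) : \sum_x g x = \sum_(i < N) g (enum_val i).
Proof. by rewrite [LHS](reindex _ (onW_bij _ (@enum_val_bij T))). Qed.

(** Matrices are indexed by a finite type here, which lets the monomials serve
    as indices. *)
Lemma relative_splitting C beta :
  exists (U : pred T) (S P Q : T -> T -> F),
    [/\ forall x z, \sum_y S x y * C y z = 0,
        forall x z, (x == z)%:R = \sum_y S x y * beta y z + P x z,
        forall y z, \sum_x beta y x * P x z = \sum_x C y x * Q x z,
        (forall x z, ~~ U z -> P x z = 0) /\
        (forall x z, U x -> P x z = (x == z)%:R)
      & forall Phi Pi : T -> T -> F,
          (forall v : T -> F, (forall z, \sum_x v x * Phi x z = 0) ->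
             exists2 w : T -> F, (forall z, \sum_x w x * C x z = 0)
               & forall z, \sum_x v x * Pi x z = \sum_x w x * beta x z) ->
          exists G, forall x z,
            \sum_y Pi x y * P y z = \sum_y Phi x y * G y z].
Proof.
have [U [S [P [Q [SC SP PQ [P0 P1] PG]]]]] := relative_splitting_mx (mx C) (mx beta).
have fnE M x y : fn M x (enum_val y) = M (enum_rank x) y.
  by rewrite /fn enum_valK.
have fnE' M x y : fn M (enum_val x) y = M x (enum_rank y).
  by rewrite /fn enum_valK.
exists (fun x => U (enum_rank x)), (fn S), (fn P), (fn Q); split.
- move=> x z; have /matrixP/(_ (enum_rank x) (enum_rank z)) := SC.
  rewrite !mxE => {2}<-; rewrite sumE; apply: eq_bigr => i _.
  by rewrite fnE mxE enum_rankK.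
- move=> x z; have /matrixP/(_ (enum_rank x) (enum_rank z)) := SP.
  rewrite !mxE (inj_eq (@enum_rank_inj T)) => ->; rewrite sumE; congr (_ + _).
  by apply: eq_bigr => i _; rewrite fnE mxE enum_rankK.
- move=> y z; have /matrixP/(_ (enum_rank y) (enum_rank z)) := PQ.
  rewrite !mxE !sumE => e.
  transitivity (\sum_j mx beta (enum_rank y) j * P j (enum_rank z)).
    by apply: eq_bigr => i _; rewrite !mxE fnE' enum_rankK.
  by rewrite e; apply: eq_bigr => i _; rewrite !mxE fnE' enum_rankK.
- split=> x z h; first exact: P0.
  by rewrite /fn P1 // (inj_eq (@enum_rank_inj T)).
move=> Phi Pi H.
have [|G GE] := PG (mx Phi) (mx Pi).
  move=> v vPhi; have [|w wC e] := H (fun x => v 0 (enum_rank x)).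
    move=> z; have /rowP/(_ (enum_rank z)) := vPhi.
    rewrite !mxE => {2}<-; rewrite sumE; apply: eq_bigr => i _.
    by rewrite enum_valK mxE enum_rankK.
  exists (\row_i w (enum_val i)).
    apply/rowP => j; rewrite !mxE -[RHS](wC (enum_val j)) sumE.
    by apply: eq_bigr => i _; rewrite !mxE.
  apply/rowP => j; rewrite !mxE.
  under [RHS]eq_bigr do rewrite !mxE.
  rewrite -(sumE (fun x => w x * beta x _)) -e sumE.
  by apply: eq_bigr => i _; rewrite enum_valK mxE.
exists (fn G) => x z.
have /matrixP/(_ (enum_rank x) (enum_rank z)) := GE.
rewrite !mxE !sumE => e.
transitivity (\sum_j mx Pi (enum_rank x) j * P j (enum_rank z)).
  by apply: eq_bigr => i _; rewrite !mxE fnE' enum_rankK.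
by rewrite e; apply: eq_bigr => i _; rewrite !mxE fnE' enum_rankK.
Qed.

End FinLinAlg.


(** * Coefficients of forms and Koszul operators as matrices *)

Lemma mnm_le_mdeg n (u : 'X_{1..n}) i : (u i <= mdeg u)%N.
Proof. by rewrite mdegE (bigD1 i) //= leq_addr. Qed.

Section Indices.
Variables (n d : nat).

(** The pair (I, u) stands for the monomial form x^u dx_I. *)
Definition idx := ({set 'I_n} * 'X_{1..n})%type.

(** With d = delta - 1, this is the degree of x^u dx_I for the filtration F: it
    is normalized so that phi does not raise it. *)
Definition weight (x : idx) : nat := (mdeg x.2 + (n - #|x.1|) * d)%N.

Definition box (N : nat) : seq idx :=
  [seq (t.1, bmnm t.2) | t : {set 'I_n} * 'X_{1..n < N}].

Lemma box_inj N : injective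
  (fun t : {set 'I_n} * 'X_{1..n < N} => (t.1, bmnm t.2) : idx).
Proof. by move=> [I u] [J v] /= [-> /val_inj ->]. Qed.

Lemma box_uniq N : uniq (box N).
Proof. by rewrite map_inj_uniq ?enum_uniq //; apply: box_inj. Qed.

Lemma mem_box N (x : idx) : (x \in box N) = (mdeg x.2 < N)%N.
Proof.
apply/mapP/idP => [[t _ ->]|h]; first exact: bmdeg.
by exists (x.1, BMultinom h); rewrite ?mem_enum //; case: x h.
Qed.

Lemma sum_box (V : nmodType) N (F : idx -> V) :
  \sum_(x <- box N) F x =
  \sum_(t : {set 'I_n} * 'X_{1..n < N}) F (t.1, bmnm t.2).
Proof. by rewrite big_map big_enum. Qed.

Lemma sum_box_widen (V : nmodType) N N' (F : idx -> V) : (N <= N')%N ->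
  (forall x, (N <= mdeg x.2)%N -> F x = 0) ->
  \sum_(x <- box N') F x = \sum_(x <- box N) F x.
Proof.
move=> NN' F0; rewrite (bigID (fun x : idx => mdeg x.2 < N)%N) /=.
rewrite [X in _ + X]big1 ?addr0 => [|x]; last by rewrite -leqNgt => /F0.
rewrite -big_filter; apply: perm_big; apply: uniq_perm.
- by rewrite filter_uniq // box_uniq.
- exact: box_uniq.
by move=> x; rewrite mem_filter !mem_box; apply: andb_idr => h; apply: leq_trans NN'.
Qed.

Lemma sum_box1 (V : nmodType) N (F : idx -> V) x : (mdeg x.2 < N)%N ->
  (forall y, y != x -> F y = 0) -> \sum_(y <- box N) F y = F x.
Proof.
move=> xN F0; rewrite (bigD1_seq x) /= ?box_uniq ?mem_box //.
by rewrite big1 ?addr0.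
Qed.

End Indices.

Section PowerSeries.
Variables (n : nat) (R : fieldType).
Implicit Types (g h : pseries n R).

Definition trunc N (g : pseries n R) : {mpoly R[n]} :=
  \sum_(m : 'X_{1..n < N}) (g m : R) *: 'X_[m].

Lemma mcoeff_trunc N g u : (mdeg u < N)%N -> (trunc N g)@_u = g u.
Proof. exact: mcoeff_mpoly. Qed.

Lemma mcoeffM_ps (p q : {mpoly R[n]}) u :
  (p * q)@_u = ps_mul (fun v => p@_v) (fun v => q@_v) u.
Proof. by rewrite -[p * q]/(mpoly_mul p q) (mcoeff_poly_mul_lin _ _ (ltnSn _)). Qed.

Lemma lem_mdeg (u v : 'X_{1..n}) : (u <= v)%MM -> (mdeg u <= mdeg v)%N.
Proof. by move=> h; rewrite -(submK h) mdegD leq_addl. Qed.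

Lemma ps_mul_agree g h g' h' u :
  (forall v, (mdeg v <= mdeg u)%N -> g v = g' v) ->
  (forall v, (mdeg v <= mdeg u)%N -> h v = h' v) ->
  ps_mul g h u = ps_mul g' h' u.
Proof.
move=> gE hE; apply: eq_bigr => v vu.
by rewrite gE ?hE ?mdegB ?lem_mdeg.
Qed.

Lemma ps_mul_trunc N g h u : (mdeg u < N)%N ->
  ps_mul g h u = (trunc N g * trunc N h)@_u.
Proof.
move=> uN; rewrite mcoeffM_ps; apply: ps_mul_agree => v vu;
  by rewrite mcoeff_trunc // (leq_ltn_trans vu).
Qed.

Lemma ps_mulC g h : ps_mul g h = ps_mul h g.
Proof. by apply/funext => u; rewrite !(ps_mul_trunc _ _ (ltnSn _)) mulrC. Qed.

Lemma ps_mul_wide N g h u : (mdeg u < N)%N ->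
  ps_mul g h u = \sum_(v : 'X_{1..n < N} | (v <= u)%MM) g v * h (u - v)%MM.
Proof.
move=> uN; rewrite (ps_mul_trunc _ _ uN).
rewrite -[_ * _]/(mpoly_mul _ _) (mcoeff_poly_mul_lin _ _ uN).
apply: eq_bigr => v vu; rewrite !mcoeff_trunc //.
  exact: leq_ltn_trans (mdegB _ _) uN.
by apply: leq_ltn_trans uN; apply: lem_mdeg.
Qed.

End PowerSeries.

Section Kernel.
Variables (n : nat) (R : fieldType).
Local Notation idx := (idx n).
Implicit Types (c : 'I_n -> pseries n R) (x y z : idx).

Definition ksign (i : 'I_n) (J : {set 'I_n}) : R :=
  (-1) ^+ #|[set j in J | (j < i)%N]%SET|.

(** Entry of the matrix of the Koszul operator of multiplication by the series
    c_i: the coefficient at z of the image of the monomial form y. *)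
Definition kos c y z : R :=
  \sum_(i in z.1 | (z.1 :\ i)%SET == y.1)
     ksign i z.1 * (if (y.2 <= z.2)%MM then c i (z.2 - y.2)%MM else 0).

Lemma kos_neq0 c y z : kos c y z != 0 ->
  exists i, [/\ i \in z.1, (z.1 :\ i)%SET = y.1, (y.2 <= z.2)%MM
              & c i (z.2 - y.2)%MM != 0].
Proof.
move=> nz.
have [i /andP[iz /eqP e] h] : exists2 i, (i \in z.1) && (z.1 :\ i == y.1)%SET
    & (if (y.2 <= z.2)%MM then c i (z.2 - y.2)%MM else 0) != 0.
  apply: contrapT => hn; case/eqP: nz; apply: big1 => i hi.
  have [->|h] := eqVneq (if (y.2 <= z.2)%MM then c i (z.2 - y.2)%MM else 0) 0.
    by rewrite mulr0.
  by case: hn; exists i.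
by exists i; move: h; case: ifP => [_ h|_]; [split|rewrite eqxx].
Qed.

Lemma kos_card c y z : kos c y z != 0 -> #|z.1| = #|y.1|.+1.
Proof. by move=> /kos_neq0[i [iz <- _ _]]; rewrite (cardsD1 i z.1) iz. Qed.

Lemma kos_mdeg c y z : kos c y z != 0 -> (mdeg y.2 <= mdeg z.2)%N.
Proof. by move=> /kos_neq0[i [_ _ /lem_mdeg]]. Qed.

Lemma koszul_kos c (w : forms n (pseries n R)) J v N : (mdeg v < N)%N ->
  koszul (fun i => ps_mul (c i)) w J v =
  \sum_(y <- box n N) w y.1 y.2 * kos c y (J, v).
Proof.
move=> vN; rewrite ffunE fct_sumE sum_box.
transitivity (\sum_(i in J) \sum_(u : 'X_{1..n < N})
   w (J :\ i)%SET u * (ksign i J * (if (u <= v)%MM then c i (v - u)%MM else 0))).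
  apply: eq_bigr => i iJ.
  rewrite /GRing.scale /= /GRing.scale /= ps_mulC (ps_mul_wide _ _ vN) big_mkcond mulr_sumr.
  apply: eq_bigr => u _; rewrite mulrCA; case: ifP => _; rewrite ?mulr0 //.
rewrite -(pair_bigA _ (fun I u => w I (bmnm u) * kos c (I, bmnm u) (J, v))) /=.
under [RHS]eq_bigr => I _ do under eq_bigr => u _ do rewrite /kos mulr_sumr /=.
under [RHS]eq_bigr => I _ do rewrite exchange_big /=.
under [RHS]eq_bigr => I _ do rewrite big_mkcondr /=.
rewrite [RHS]exchange_big; apply: eq_bigr => i iJ /=.
rewrite (bigD1 (J :\ i)%SET) //= eqxx [X in _ + X]big1 ?addr0 // => I.
by rewrite eq_sym => /negbTE ->.
Qed.

End Kernel.


(** * Squares of Koszul operators *)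

Section KoszulSquare.
Variables (F : fieldType) (n : nat).
Implicit Types (i j : 'I_n) (J : {set 'I_n}).

Lemma sum_antisym (V : zmodType) J (g : 'I_n -> 'I_n -> V) :
  (forall i j, i \in J -> j \in J -> i != j -> g i j = - g j i) ->
  \sum_(i in J) \sum_(j in J :\ i) g i j = 0.
Proof.
move=> gN.
have split_sum i : \sum_(j in J :\ i) g i j =
    \sum_(j in J | (i < j)%N) g i j + \sum_(j in J | (j < i)%N) g i j.
  rewrite (bigID (fun j : 'I_n => i < j)%N) /=; congr (_ + _);
    apply: eq_bigl => j; rewrite !inE -?leqNgt.
    by case: eqVneq => //= ->; rewrite ltnn andbF.
  by rewrite ltn_neqAle -val_eqE /=; case: (j \in J); rewrite ?andbF ?andbT.
under eq_bigr do rewrite split_sum.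
rewrite big_split /= (exchange_big_dep (mem J)) /=; last by move=> i j _ /andP[].
rewrite -big_split big1 //= => i iJ.
under eq_bigl => j do rewrite iJ /=.
rewrite -big_split big1 //= => j /andP[jJ ij].
by rewrite gN ?addNr // -val_eqE /= neq_ltn ij.
Qed.

Lemma ksignM_lt i j J : i \in J -> (i < j)%N ->
  ksign F i J * ksign F j (J :\ i) = - (ksign F j J * ksign F i (J :\ j)).
Proof.
move=> iJ ij; rewrite /ksign.
have -> : #|[set k in J | (k < j)%N]| = #|[set k in J :\ i | (k < j)%N]|.+1.
  rewrite (cardsD1 i) inE iJ ij; congr _.+1; apply: eq_card => k.
  by rewrite !inE andbA.
have -> : #|[set k in J :\ j | (k < i)%N]| = #|[set k in J | (k < i)%N]|.
  apply: eq_card => k; rewrite !inE; case: eqVneq => //= ->.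
  by rewrite ltnNge ltnW ?andbF.
by rewrite exprS mulN1r mulNr opprK mulrC.
Qed.

(** Removing i first shifts the position of j by one exactly when i < j. *)
Lemma ksignM i j J : i \in J -> j \in J -> i != j ->
  ksign F i J * ksign F j (J :\ i) = - (ksign F j J * ksign F i (J :\ j)).
Proof.
move=> iJ jJ; rewrite -val_eqE /= neq_ltn => /orP[] lt; first exact: ksignM_lt.
by rewrite (ksignM_lt jJ lt) opprK.
Qed.

Variables (A : lmodType F) (theta : 'I_n -> A -> A).
Hypothesis theta_linear : forall i, linear (theta i).

Lemma thetaB i : additive (theta i).
Proof.
by move=> x y; rewrite -[x - y]addrC -[- y]scaleN1r theta_linear scaleN1r addrC.
Qed.

Lemma theta0 i : theta i 0 = 0.
Proof. by have := thetaB i 0 0; rewrite !subrr. Qed.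

Lemma thetaD i x y : theta i (x + y) = theta i x + theta i y.
Proof. by rewrite -[x]scale1r theta_linear !scale1r. Qed.

Lemma thetaZ i k x : theta i (k *: x) = k *: theta i x.
Proof. by rewrite -[k *: x]addr0 theta_linear theta0 addr0. Qed.

Lemma theta_sum i (I : Type) (r : seq I) P (G : I -> A) :
  theta i (\sum_(k <- r | P k) G k) = \sum_(k <- r | P k) theta i (G k).
Proof. by apply: (big_morph (theta i)); [exact: thetaD|exact: theta0]. Qed.

Lemma koszul_linear : linear (koszul theta).
Proof.
move=> k u w; apply/ffunP => J; rewrite !ffunE scaler_sumr -big_split /=.
apply: eq_bigr => i _; rewrite !ffunE theta_linear scalerDr !scalerA.
by rewrite [_ * k]mulrC.
Qed.

(** The terms for (i, j) and (j, i) cancel by [ksignM]. *)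
Lemma koszul_sq0 :
  (forall i j x, theta i (theta j x) = theta j (theta i x)) ->
  forall w, koszul theta (koszul theta w) = 0.
Proof.
move=> thetaC w; apply/ffunP => J; rewrite !ffunE.
rewrite (eq_bigr (fun i => \sum_(j in J :\ i)
   (ksign F i J * ksign F j (J :\ i)) *:
     theta i (theta j (w (J :\ i :\ j)%SET)))) => [|i iJ]; last first.
  rewrite ffunE theta_sum scaler_sumr; apply: eq_bigr => j jJ.
  by rewrite thetaZ scalerA.
apply: sum_antisym => i j iJ jJ ij.
by rewrite ksignM // scaleNr thetaC !finset.setDDl finset.setUC.
Qed.

Lemma koszul_supp (w : forms n A) J :
  (forall i, i \in J -> w (J :\ i)%SET = 0) -> koszul theta w J = 0.
Proof.
move=> w0; rewrite ffunE big1 // => i iJ.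
by rewrite w0 // theta0 scaler0.
Qed.

End KoszulSquare.

Section Phi.
Variables (F : fieldType) (n : nat) (f : {mpoly F[n]}).
Local Notation Omega := (forms n {mpoly F[n]}).

Definition pcoef (i : 'I_n) : pseries n F := fun u => f^`M(i)@_u.

Definition cf (w : Omega) (x : idx n) : F := (w x.1)@_x.2.

Lemma cfP (w w' : Omega) : cf w =1 cf w' -> w = w'.
Proof.
move=> e; apply/ffunP => I; apply/mpolyP => u; exact: (e (I, u)).
Qed.

Lemma cfB w w' x : cf (w - w') x = cf w x - cf w' x.
Proof. by rewrite /cf !ffunE mcoeffB. Qed.

Lemma cf0 x : cf 0 x = 0.
Proof. by rewrite /cf !ffunE mcoeff0. Qed.

Lemma phi_kos (w : Omega) z N : (mdeg z.2 < N)%N ->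
  cf (phi f w) z = \sum_(y <- box n N) cf w y * kos pcoef y z.
Proof.
case: z => J v vN; pose w' : forms n (pseries n F) := [ffun I => fun u => (w I)@_u].
rewrite (eq_bigr (fun y => w' y.1 y.2 * kos pcoef y (J, v))) => [|y _]; last by rewrite ffunE.
rewrite -koszul_kos // /cf /phi !ffunE fct_sumE raddf_sum /=; apply: eq_bigr => i _.
by rewrite mcoeffZ mcoeffM_ps ffunE.
Qed.

Lemma phi_linear : linear (phi f).
Proof.
by apply: koszul_linear => i k x y; rewrite mulrDr -scalerAr.
Qed.

Lemma phiB w w' : phi f (w - w') = phi f w - phi f w'.
Proof. by rewrite -[w - w']addrC -[- w']scaleN1r phi_linear scaleN1r addrC. Qed.

Lemma phi_sq0 w : phi f (phi f w) = 0.
Proof.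
apply: koszul_sq0 => [i k x y|i j x]; first by rewrite mulrDr -scalerAr.
by rewrite mulrCA.
Qed.

Definition mkform N (k : idx n -> F) : Omega :=
  [ffun I => trunc N (fun u => k (I, u))].

Lemma cf_mkform N k x : (mdeg x.2 < N)%N -> cf (mkform N k) x = k x.
Proof. by case: x => I u h; rewrite /cf ffunE mcoeff_trunc. Qed.

Lemma mkform_ge N k x : (N <= mdeg x.2)%N -> cf (mkform N k) x = 0.
Proof.
case: x => I u /= h; rewrite /cf ffunE /trunc raddf_sum /= big1 // => m _.
rewrite mcoeffZ mcoeffX.
case: eqVneq => [e|_]; last by rewrite mulr0.
by move: (bmdeg m); rewrite e ltnNge h.
Qed.

End Phi.

Definition ev n (L : fieldType) (w : forms n (pseries n L)) (x : idx n) : L := w x.1 x.2.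

Definition phic n (L : fieldType) (c : 'I_n -> pseries n L) (w : forms n (pseries n L))
  : forms n (pseries n L) := koszul (fun i => ps_mul (c i)) w.



(** * The spectral sequence as an exactness property *)

Lemma sum_neq0 (V : nmodType) (I : eqType) (s : seq I) (g : I -> V) :
  \sum_(i <- s) g i != 0 -> exists2 i, i \in s & g i != 0.
Proof.
move=> nz; apply: contrapT => hn; case/eqP: nz; rewrite big_seq big1 // => i si.
by apply/eqP; apply: contrapT => /negP gi; apply: hn; exists i.
Qed.

Lemma leq_wt n d (x : idx n) : (mdeg x.2 <= weight d x)%N.
Proof. exact: leq_addr. Qed.

Lemma kos_wt n d (R : fieldType) (c : 'I_n -> pseries n R) :
  (forall i u, c i u != 0 -> (mdeg u <= d)%N) ->
  forall y z, kos c y z != 0 -> (weight d z <= weight d y)%N.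
Proof.
move=> cd y z nz; have cz := kos_card nz; move: (kos_neq0 nz).
case=> i [_ _ yz /cd ud]; rewrite /weight cz.
have := max_card (mem z.1); rewrite card_ord cz => /subnSK <-.
by rewrite mulSn addnA leq_add2r -(submK yz) mdegD addnC leq_add2l.
Qed.

Section Exactness.
Variables (F : fieldType) (n : nat) (f : {mpoly F[n]}).
Local Notation delta := (msize f).-1.
Local Notation Omega := (forms n {mpoly F[n]}).
Local Notation wt := (weight delta.-1).
Hypothesis delta_gt0 : (0 < delta)%N.

Lemma pcoef_mdeg i u : pcoef f i u != 0 -> (mdeg u <= delta.-1)%N.
Proof.
rewrite /pcoef mcoeff_deriv => nz.
have : (u + U_(i))%MM \in msupp f.
  by rewrite mcoeff_msupp; apply: contra_neq nz => ->; rewrite mul0rn.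
move=> /msize_mdeg_lt; rewrite mdegD mdeg1; lia.
Qed.

Lemma phi_wt y z : kos (pcoef f) y z != 0 -> (wt z <= wt y)%N.
Proof. by apply: kos_wt; apply: pcoef_mdeg. Qed.

Lemma phi_neq0 (w : Omega) z : cf (phi f w) z != 0 ->
  exists y, cf w y != 0 /\ kos (pcoef f) y z != 0.
Proof.
rewrite (phi_kos _ _ (ltnSn _)) => /sum_neq0[y _].
by rewrite mulf_eq0 negb_or => /andP[]; exists y.
Qed.

Lemma wtZ (x : idx n) (k : int) : #|x.1|%:Z = k ->
  (mdeg x.2)%:Z + (n%:Z - k) * (delta%:Z - 1) = (wt x)%:Z.
Proof.
move=> <-; have := max_card (mem x.1); rewrite card_ord => h.
have e1 : delta.-1%:Z = delta%:Z - 1 by move: delta_gt0; lia.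
by rewrite /weight PoszD PoszM e1 subzn.
Qed.

Lemma cf_bound (w : Omega) : exists N, forall x, cf w x != 0 -> (mdeg x.2 < N)%N.
Proof.
exists (\max_(I : {set 'I_n}) msize (w I)) => x.
rewrite /cf -mcoeff_msupp => /msize_mdeg_lt h.
exact: leq_trans h (leq_bigmax _).
Qed.

Lemma weight_bound (w : Omega) : exists R, forall x, cf w x != 0 -> (wt x < R)%N.
Proof.
have [N wN] := cf_bound w; exists (N + n * delta.-1)%N => x /wN xN.
by rewrite /weight -addSn leq_add // leq_mul2r leq_subr orbT.
Qed.

Definition mono (x : idx n) : Omega :=
  [ffun I => if I == x.1 then 'X_[x.2] else 0].

Lemma cf_mono x y : cf (mono x) y = (x == y)%:R.
Proof.
rewrite /cf ffunE; case: x y => [I u] [J v] /=.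
by rewrite -pair_eqE /= [J == I]eq_sym; case: eqP; rewrite ?mcoeffX ?mcoeff0.
Qed.

Lemma cfZ k (w : Omega) x : cf (k *: w) x = k * cf w x.
Proof. by rewrite /cf ffunE mcoeffZ. Qed.

Lemma cf_sum (I : Type) (s : seq I) (w : I -> Omega) x :
  cf (\sum_(i <- s) w i) x = \sum_(i <- s) cf (w i) x.
Proof. by rewrite /cf sum_ffunE raddf_sum. Qed.

(** The filtration only depends on the weights of the monomials that occur. *)
Lemma filtP (r k : int) (w : Omega) : filt f r k w <->
  (forall x, cf w x != 0 -> #|x.1|%:Z = k /\ (wt x)%:Z <= r).
Proof.
split=> [[m [c [v [hv ->]]]] x|h].
  rewrite cf_sum => /sum_neq0[i _]; rewrite cfZ mulf_eq0 negb_or => /andP[_ nz].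
  have [l [[hform hom] lr]] := hv i.
  have xk : #|x.1|%:Z = k.
    apply/eqP; apply: contraNT nz => xk.
    by have [_ h] := hform x.1; rewrite /cf h // mcoeff0.
  split=> //; rewrite -(wtZ xk).
  have /dhomogP/(_ x.2) -> // := hom x.1.
  by rewrite mcoeff_msupp.
have [N wN] := cf_bound w.
pose dflt : idx n := (finset.set0, 0%MM).
pose s := [seq x <- box n N | cf w x != 0].
exists (size s), (fun i => cf w (nth dflt s i)), (fun i => mono (nth dflt s i)).
split=> [i|].
  set x := nth _ _ _; have : x \in s by apply: mem_nth.
  rewrite mem_filter => /andP[/h[xk xr] _].
  exists (mdeg x.2); split; last by rewrite wtZ.
  split=> [I|I].
    split=> // Ik; rewrite ffunE; case: eqVneq => // Ix.
    by move: Ik; rewrite Ix xk eqxx.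
  rewrite ffunE; case: eqVneq => _; last exact: rpred0.
  by rewrite dhomogX.
apply: cfP => x; rewrite cf_sum.
rewrite -(big_mkord xpredT (fun i => cf (cf w (nth dflt s i) *: mono (nth dflt s i)) x)).
rewrite -(big_nth dflt xpredT (fun y => cf (cf w y *: mono y) x)).
rewrite big_filter big_mkcond /=.
have [x0|x0] := eqVneq (cf w x) 0.
  rewrite x0 big1 // => y _; rewrite cfZ cf_mono.
  by have [->|_] := eqVneq y x; rewrite ?x0 ?mul0r ?mulr0 if_same.
rewrite (bigD1_seq x) ?box_uniq ?mem_box ?wN //= x0 cfZ cf_mono eqxx mulr1.
rewrite big1 ?addr0 // => y yx.
by rewrite cfZ cf_mono (negbTE yx) mulr0 if_same.
Qed.

(** The vanishing of E_e in total degree m, restricted to what matters: if w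
    has weight at most r and phi w drops by e, the top weight part of w is
    the top part of a boundary, of a form of weight less than r + e. *)
Definition exact_at (e m : nat) := forall (r : nat) (w : Omega),
  (forall x, cf w x != 0 -> #|x.1| = m /\ (wt x <= r)%N) ->
  (forall z, cf (phi f w) z != 0 -> (wt z + e <= r)%N) ->
  exists xi : Omega,
    (forall y, cf xi y != 0 -> #|y.1|.+1 = m /\ (wt y < r + e)%N) /\
    (forall z, (r <= wt z)%N -> cf w z = cf (phi f xi) z).

Lemma Ess_exact (e m : nat) : (0 < e)%N ->
  (forall r s : int, r + s = m%:Z -> Ess_eq0 f e%:Z r s) -> exact_at e m.
Proof.
move=> e0 E r w wm phiw; have [||xi] := E r (m%:Z - r%:Z) _ w.
- by rewrite addrC subrK.
- exists w; last first.
    exists 0; last by rewrite addr0.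
    by apply/filtP => x; rewrite cf0 eqxx.
  rewrite /Wss /= [_ + (_ - _)]addrC subrK; split; apply/filtP => x.
    by move=> /wm[-> h]; rewrite lez_nat.
  move=> nz; have h := phiw _ nz.
  have [y [/wm[ym _] /kos_card]] := phi_neq0 nz.
  by rewrite ym => ->; split; lia.
case=> xi' []; rewrite /Wss /=.
rewrite (_ : r%:Z + e%:Z - 1 + (m%:Z - r%:Z - e%:Z) = m%:Z - 1); last by ring.
move=> /filtP xi1 _ <- [y /filtP y1 <-].
exists xi'; split=> [x /xi1[]|z rz]; first
  by move: (weight _ _) #|_| => W k h1 h2; split; [move: h1|move: h2]; clear; lia.
have y0 : cf y z = 0 by apply/eqP; apply: contraT => /y1[_]; lia.
by rewrite /cf ffunE mcoeffD [X in _ + X]y0 addr0.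
Qed.

End Exactness.


(** * Splittings of the Koszul complex over a field *)

Section Kernels.
Variables (F : fieldType) (n : nat) (f : {mpoly F[n]}).
Local Notation delta := (msize f).-1.
Local Notation Omega := (forms n {mpoly F[n]}).
Local Notation wt := (weight delta.-1).
Local Notation idx := (idx n).
Local Notation kf := (kos (pcoef f)).
Hypothesis delta_gt0 : (0 < delta)%N.
Variables (e m : nat).
Hypothesis e_gt0 : (0 < e)%N.

(** Data attached to the forms of degree m and weight r. Here B is the space of
    the weight r parts of those phi xi, with xi of weights r, ..., r + e - 1,
    that have no part of weight more than r. Then S is a section of phi over
    B, P a projection with kernel B to the span of the monomials in U, P phi xi
    = Q phi xi for such weights of xi, where Q only uses the part of phi xi of
    weight more than r, and P = G phi if E_e vanishes. *)
(* kaI1 says in one formula that phi S = 1 - P in weight r and that phi S has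
   no part of weight more than r: P x z and x == z vanish unless x and z have
   the same weight. *)
Record kernels_at (r : nat) (U : pred idx) (S P Q G : idx -> idx -> F) : Prop := {
  kaS : forall x y, S x y != 0 ->
    #|x.1| = m /\ wt x = r /\ #|y.1|.+1 = m /\ (r <= wt y < r + e)%N;
  kaP : forall x z, P x z != 0 ->
    #|x.1| = m /\ #|z.1| = m /\ wt x = r /\ wt z = r /\ U z;
  kaQ : forall x z, Q x z != 0 ->
    #|x.1| = m /\ #|z.1| = m /\ wt z = r /\ (r < wt x < r + e)%N;
  kaG : forall y z, G y z != 0 ->
    #|y.1| = m.+1 /\ #|z.1| = m /\ wt z = r /\ (wt y <= r < wt y + e)%N;
  kaU : forall x, U x -> #|x.1| = m /\ wt x = r;
  kaI1 : forall N (x z : idx), (r + e < N)%N -> #|x.1| = m -> #|z.1| = m ->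
    wt x = r -> (r <= wt z)%N ->
    \sum_(y <- box n N) S x y * kf y z = (x == z)%:R - P x z;
  kaI2 : forall N (y z : idx), (r + e < N)%N -> #|y.1|.+1 = m -> #|z.1| = m ->
    wt z = r -> (r <= wt y < r + e)%N ->
    \sum_(x <- box n N) kf y x * P x z = \sum_(x <- box n N) kf y x * Q x z;
  kaI3 : exact_at f e m -> forall N (x z : idx), (r + e < N)%N ->
    #|x.1| = m -> #|z.1| = m -> wt z = r -> (wt x <= r < wt x + e)%N ->
    P x z = \sum_(y <- box n N) kf x y * G y z;
  kaI4 : forall (x z : idx), U x -> #|z.1| = m -> wt z = r -> P x z = (x == z)%:R
}.

Section Local.
Variable r : nat.
Let N0 := (r + e).+1.
Let T : finType := ({set 'I_n} * 'X_{1..n < N0})%type.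
Let inj (t : T) : idx := (t.1, bmnm t.2).
Let toT (x : idx) : T := (x.1, insubd (@bm0 n (r + e)) x.2).

Let toTK (x : idx) : (mdeg x.2 < N0)%N -> inj (toT x) = x.
Proof. by case: x => I u h; rewrite /inj /toT /= insubdK. Qed.

Let injK t : toT (inj t) = t.
Proof. by case: t => I u; rewrite /inj /toT /= valKd. Qed.

Let wtN (x : idx) : (wt x <= r + e)%N -> (mdeg x.2 < N0)%N.
Proof. by move=> h; rewrite ltnS (leq_trans _ h) // leq_wt. Qed.

Let okY (y : idx) := (#|y.1|.+1 == m) && (r <= wt y < r + e)%N.
Let okC (z : idx) := (#|z.1| == m) && (r < wt z < r + e)%N.
Let okB (z : idx) := (#|z.1| == m) && (wt z == r).
Let okX (x : idx) := (#|x.1| == m) && (wt x <= r < wt x + e)%N.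
Let okG (y : idx) := (#|y.1| == m.+1) && (wt y <= r < wt y + e)%N.

Let cut (A B : pred idx) (k : idx -> idx -> F) (x y : idx) : F :=
  if A x && B y then k x y else 0.
Let onT (k : idx -> idx -> F) (x y : T) := k (inj x) (inj y).
Let ext (k : T -> T -> F) (x y : idx) := k (toT x) (toT y).

Let sumT (g : idx -> F) N : (N0 <= N)%N ->
  (forall y, (N0 <= mdeg y.2)%N -> g y = 0) ->
  \sum_(y <- box n N) g y = \sum_(t : T) g (inj t).
Proof. by move=> NN g0; rewrite (sum_box_widen NN g0) sum_box. Qed.

Let okYN y : okY y -> (mdeg y.2 < N0)%N.
Proof. by move=> /andP[_ h]; apply: wtN; lia. Qed.
Let okCN y : okC y -> (mdeg y.2 < N0)%N.
Proof. by move=> /andP[_ h]; apply: wtN; lia. Qed.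
Let okBN y : okB y -> (mdeg y.2 < N0)%N.
Proof. by move=> /andP[_ /eqP h]; apply: wtN; rewrite h; clear; lia. Qed.
Let okXN y : okX y -> (mdeg y.2 < N0)%N.
Proof. by move=> /andP[_ h]; apply: wtN; lia. Qed.
Let okGN y : okG y -> (mdeg y.2 < N0)%N.
Proof. by move=> /andP[_ h]; apply: wtN; lia. Qed.

Let cut_neq0 A B k x y : cut A B k x y != 0 -> A x /\ B y.
Proof. by rewrite /cut; case: andP => // _; rewrite eqxx. Qed.

Let C := onT (cut okY okC kf).
Let beta := onT (cut okY okB kf).
Let Phi := onT (cut okX okG kf).
Let Pi := onT (cut okB okB (fun x y => (x == y)%:R)).

(** The condition on the spectral sequence, read on row vectors: those on which
    phi vanishes in weights r - e + 1, ..., r have their top part in B. *)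
Let exact_vectors : exact_at f e m ->
  forall v : T -> F, (forall z, \sum_x v x * Phi x z = 0) ->
    exists2 w : T -> F, (forall z, \sum_x w x * C x z = 0)
      & forall z, \sum_x v x * Pi x z = \sum_x w x * beta x z.
Proof.
move=> E v vPhi.
pose w := mkform N0 (fun x => if okX x then v (toT x) else 0).
have wE x : cf w x = if okX x then v (toT x) else 0.
  have [xN|xN] := ltnP (mdeg x.2) N0; first exact: cf_mkform.
  rewrite mkform_ge //; case: ifP => // /okXN; lia.
have phiE z N : (mdeg z.2 < N)%N -> (N0 <= N)%N ->
    cf (phi f w) z = \sum_(t : T) (if okX (inj t) then v t * kf (inj t) z else 0).
  move=> zN NN; rewrite (phi_kos _ _ zN) (sumT NN) => [|y yN].
    by apply: eq_bigr => t _; rewrite wE injK; case: ifP; rewrite ?mul0r.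
  by rewrite wE; case: ifP => [/okXN|_]; [lia|rewrite mul0r].
have [||xi [xim xiE]] := E r w.
- by move=> x; rewrite wE; case: ifP => [/andP[/eqP xm /andP[]]|]; rewrite ?eqxx.
- move=> z nz; rewrite leqNgt; apply/negP => h; case/eqP: nz.
  have [//|nz] := eqVneq (cf (phi f w) z) 0.
  have [y []] := phi_neq0 nz; rewrite wE; case: ifP => [|_ /eqP//].
  move=> /andP[/eqP ym /andP[yr _]] _ kyz.
  have zr : (wt z <= r)%N by apply: leq_trans (phi_wt _ kyz) yr.
  have zG : okG z by rewrite /okG (kos_card kyz) ym eqxx zr.
  rewrite (phiE z N0) // ?okGN // -[RHS](vPhi (toT z)).
  apply: eq_bigr => t _; rewrite /Phi /onT /cut toTK ?okGN // zG andbT.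
  by case: ifP; rewrite ?mulr0.
exists (fun t => if okY (inj t) then cf xi (inj t) else 0) => z.
  rewrite (eq_bigr (fun t => if okC (inj z) then cf xi (inj t) * kf (inj t) (inj z) else 0)).
    case zC: (okC (inj z)); last by rewrite big1.
    have zr : (r < wt (inj z))%N by case/andP: zC => _ /andP[].
    rewrite -(sumT (g := fun y => cf xi y * kf y (inj z)) (leqnn N0)).
      have zN := okCN zC.
      rewrite -(phi_kos f xi zN).
      rewrite -(xiE _ (ltnW zr)) wE /okX.
      by move/ltn_geF: zr => ->; rewrite andbF.
    move=> y yN; have [->|/xim[_ h]] := eqVneq (cf xi y) 0; first by rewrite mul0r.
    have := @wtN y; lia.
  move=> t _; rewrite /C /onT /cut.
  case: ifP => /= yY; case: ifP => zC; rewrite ?mul0r ?mulr0 //.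
  have [->|/xim[ym h]] := eqVneq (cf xi (inj t)) 0; first by rewrite mul0r.
  have [->|/(phi_wt delta_gt0) k] := eqVneq (kf (inj t) (inj z)) 0; first by rewrite mulr0.
  by move: yY; rewrite /okY ym eqxx h /=; case/andP: zC; lia.
transitivity (if okB (inj z) then v z else 0).
  rewrite (bigD1 z) //= big1 => [|t tz]; rewrite /Pi /onT /cut.
    by rewrite andbb eqxx addr0; case: ifP; rewrite ?mulr1 ?mulr0.
  have -> : (inj t == inj z) = false.
    by apply/eqP => /(congr1 toT); rewrite !injK => /eqP; rewrite (negbTE tz).
  by rewrite if_same mulr0.
rewrite (eq_bigr (fun t => if okB (inj z) then cf xi (inj t) * kf (inj t) (inj z) else 0)).
  case zB: (okB (inj z)); last by rewrite big1.
  have /andP[/eqP zm /eqP zr] := zB.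
  rewrite -(sumT (g := fun y => cf xi y * kf y (inj z)) (leqnn N0)).
    have zN := okBN zB.
    rewrite -(phi_kos f xi zN) -xiE ?zr // wE /okX zm eqxx zr leqnn injK /=.
    by rewrite -[X in (X < _)%N]addn0 ltn_add2l e_gt0.
  move=> y yN; have [->|/xim[_ h]] := eqVneq (cf xi y) 0; first by rewrite mul0r.
  have := @wtN y; lia.
move=> t _; rewrite /beta /onT /cut.
case: ifP => /= yY; case: ifP => zB; rewrite ?mul0r ?mulr0 //.
have [->|/xim[ym h]] := eqVneq (cf xi (inj t)) 0; first by rewrite mul0r.
have [->|/(phi_wt delta_gt0) k] := eqVneq (kf (inj t) (inj z)) 0; first by rewrite mulr0.
by move: yY; rewrite /okY ym eqxx h /=; case/andP: zB => _ /eqP; lia.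
Qed.

Lemma exists_kernels_at : exists U S P Q G, kernels_at r U S P Q G.
Proof.
have [U [S [P [Q [SC SP PQ [P0 P1] PG]]]]] := relative_splitting C beta.
have [G GE] : exists G, exact_at f e m -> forall x z,
    \sum_y Pi x y * P y z = \sum_y Phi x y * G y z.
  have [E|nE] := pselect (exact_at f e m); last by exists (fun _ _ => 0).
  by have [G GE] := PG Phi Pi (exact_vectors E); exists G.
exists (fun x => okB x && U (toT x)), (cut okB okY (ext S)), (cut okB okB (ext P)),
  (cut okC okB (ext Q)), (cut okG okB (ext G)); split.
- move=> x y /cut_neq0[/andP[/eqP xm /eqP xr] /andP[/eqP ym yr]]; by [].
- move=> x z nz; have [xB zB] := cut_neq0 nz.
  case/andP: (xB) => [/eqP -> /eqP ->]; case/andP: (zB) => [/eqP -> /eqP ->].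
  rewrite zB; do 4![split => //].
  apply: contraT => nU; case/eqP: nz.
  by rewrite /cut xB zB /ext P0.
- by move=> x z /cut_neq0[/andP[/eqP xm xr] /andP[/eqP zm /eqP zr]].
- by move=> x z /cut_neq0[/andP[/eqP xm xr] /andP[/eqP zm /eqP zr]].
- by move=> x /andP[/andP[/eqP -> /eqP ->]].
- move=> N x z NN xm zm xr zr.
  have xB : okB x by rewrite /okB xm xr !eqxx.
  rewrite (sumT NN) => [|y yN]; last first.
    by rewrite /cut; case: ifP => [/andP[_ /okYN]|]; [lia|rewrite mul0r].
  have [zr'|zr'] := eqVneq (wt z) r.
    have zB : okB z by rewrite /okB zm zr' !eqxx.
    rewrite [cut okB okB _ x z]/cut xB zB /=.
    have -> : (x == z) = (toT x == toT z).
      apply/eqP/eqP => [->//|/(congr1 inj)]; rewrite !toTK ?okBN //.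
    rewrite SP addrK; apply: eq_bigr => t _.
    rewrite /beta /onT /cut /ext injK (toTK (okBN zB)) xB zB andbT /=.
    by case: ifP; rewrite ?mul0r ?mulr0.
  have -> : (x == z) = false.
    by apply/eqP => xz; move: zr'; rewrite -xz xr eqxx.
  have -> : cut okB okB (ext P) x z = 0 by rewrite /cut /okB (negbTE zr') !andbF.
  rewrite subr0.
  have [zr2|zr2] := ltnP (wt z) (r + e).
    have zC : okC z by rewrite /okC zm eqxx zr2 /=; lia.
    rewrite -[RHS](SC (toT x) (toT z)); apply: eq_bigr => t _.
    rewrite /C /onT /cut /ext injK (toTK (okCN zC)) xB zC andbT /=.
    by case: ifP; rewrite ?mul0r ?mulr0.
  apply: big1 => t _; rewrite /cut; case: ifP => [/andP[_ /andP[_ h]]|]; last by rewrite mul0r.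
  have [->|/(phi_wt delta_gt0) k] := eqVneq (kf (inj t) z) 0; first by rewrite mulr0.
  lia.
- move=> N y z NN ym zm zr yr.
  have zB : okB z by rewrite /okB zm zr !eqxx.
  have yY : okY y by rewrite /okY ym yr eqxx.
  rewrite (sumT NN) => [|x xN]; last first.
    by rewrite /cut; case: ifP => [/andP[/okBN]|]; [lia|rewrite mulr0].
  rewrite (sumT NN) => [|x xN]; last first.
    by rewrite /cut; case: ifP => [/andP[/okCN]|]; [lia|rewrite mulr0].
  have := PQ (toT y) (toT z); rewrite /beta /C /onT /cut /ext (toTK (okYN yY)) yY => h.
  transitivity (\sum_x (if okB (inj x) then kf y (inj x) else 0) * P x (toT z)).
    by apply: eq_bigr => t _; rewrite injK zB andbT; case: ifP; rewrite ?mul0r ?mulr0.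
  rewrite h; apply: eq_bigr => t _; rewrite injK zB andbT /=.
  by case: ifP; rewrite ?mul0r ?mulr0.
- move=> E N x z NN xm zm zr xr.
  have zB : okB z by rewrite /okB zm zr !eqxx.
  have xX : okX x by rewrite /okX xm xr eqxx.
  rewrite (sumT NN) => [|y yN]; last first.
    by rewrite /cut; case: ifP => [/andP[/okGN]|]; [lia|rewrite mulr0].
  transitivity (\sum_y Pi (toT x) y * P y (toT z)).
    rewrite (bigD1 (toT x)) //= big1 => [|t tx]; rewrite /Pi /onT.
      by rewrite /cut (toTK (okXN xX)) zB andbb andbT eqxx addr0 /ext;
        case: ifP; rewrite ?mul1r ?mul0r.
    rewrite /cut; case: ifP => _; last by rewrite mul0r.
    have -> : (inj (toT x) == inj t) = false.
      by apply/eqP => /(congr1 toT); rewrite !injK => /eqP; rewrite eq_sym (negbTE tx).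
    by rewrite mul0r.
  rewrite GE //; apply: eq_bigr => t _.
  rewrite /Phi /onT /cut /ext injK zB (toTK (okXN xX)) xX andbT /=.
  by case: ifP; rewrite ?mul0r ?mulr0.
- move=> x z /andP[xB xU] zm zr.
  have zB : okB z by rewrite /okB zm zr !eqxx.
  rewrite /cut xB zB /ext P1 //; congr (_%:R); congr nat_of_bool.
  by apply/eqP/eqP => [/(congr1 inj)|->//]; rewrite !toTK ?okBN.
Qed.

End Local.

(** The data for all weights at once; the weight r is that of x for S x y, and
    that of z for P x z, Q x z and G x z. *)
Record kernels (U : pred idx) (S P Q G : idx -> idx -> F) : Prop := {
  kS : forall x y, S x y != 0 ->
    #|x.1| = m /\ #|y.1|.+1 = m /\ (wt x <= wt y < wt x + e)%N;
  kP : forall x z, P x z != 0 -> #|x.1| = m /\ #|z.1| = m /\ wt x = wt z /\ U z;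
  kQ : forall x z, Q x z != 0 ->
    #|x.1| = m /\ #|z.1| = m /\ (wt z < wt x < wt z + e)%N;
  kG : forall y z, G y z != 0 ->
    #|y.1| = m.+1 /\ #|z.1| = m /\ (wt y <= wt z < wt y + e)%N;
  kU : forall x, U x -> #|x.1| = m;
  kI1 : forall N (x z : idx), (wt x + e < N)%N -> #|x.1| = m -> #|z.1| = m ->
    (wt x <= wt z)%N ->
    \sum_(y <- box n N) S x y * kf y z = (x == z)%:R - P x z;
  kI2 : forall N (y z : idx), (wt z + e < N)%N -> #|y.1|.+1 = m -> #|z.1| = m ->
    (wt z <= wt y < wt z + e)%N ->
    \sum_(x <- box n N) kf y x * P x z = \sum_(x <- box n N) kf y x * Q x z;
  kI3 : exact_at f e m -> forall N (x z : idx), (wt z + e < N)%N ->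
    #|x.1| = m -> #|z.1| = m -> (wt x <= wt z < wt x + e)%N ->
    P x z = \sum_(y <- box n N) kf x y * G y z;
  kI4 : forall (x z : idx), U x -> #|z.1| = m -> P x z = (x == z)%:R
}.

Lemma exists_kernels : exists U S P Q G, kernels U S P Q G.
Proof.
have /choice[U /choice[S /choice[P /choice[Q /choice[G H]]]]] := exists_kernels_at.
exists (fun x => U (wt x) x), (fun x => S (wt x) x), (fun x => P (wt x) x).
exists (fun x z => Q (wt z) x z), (fun y z => G (wt z) y z); split.
- by move=> x y /(kaS (H _))[xm [_ [ym yr]]].
- by move=> x z /(kaP (H _))[xm [zm [_ [zr Uz]]]]; rewrite zr.
- by move=> x z /(kaQ (H _))[xm [zm [_ xr]]].
- by move=> y z /(kaG (H _))[ym [zm [_ yr]]].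
- by move=> x /(kaU (H _))[].
- by move=> N x z xN xm zm xz; apply: (kaI1 (H _)).
- move=> N y z zN ym zm yz; rewrite -(kaI2 (H (wt z))) //.
  apply: eq_bigr => x _; congr (_ * _); have [->//|xz] := eqVneq (wt x) (wt z).
  rewrite [LHS](_ : _ = 0) ?[RHS](_ : _ = 0) //; apply/eqP; apply: contraTT isT.
    by move=> /(kaP (H _))[_ [_ [h _]]]; rewrite h eqxx in xz.
  by move=> /(kaP (H _))[_ [_ [_ [h _]]]]; rewrite h eqxx in xz.
- move=> E N x z zN xm zm xz; rewrite -(kaI3 (H (wt z))) //.
  have [->//|xz'] := eqVneq (wt x) (wt z).
  rewrite [LHS](_ : _ = 0) ?[RHS](_ : _ = 0) //; apply/eqP; apply: contraTT isT.
    by move=> /(kaP (H _))[_ [_ [h _]]]; rewrite h eqxx in xz'.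
  by move=> /(kaP (H _))[_ [_ [_ [h _]]]]; rewrite h eqxx in xz'.
move=> x z Ux zm; have [xz|xz] := eqVneq (wt x) (wt z).
  by rewrite (kaI4 (H _)) // xz.
rewrite [LHS](_ : _ = 0); last first.
  apply/eqP; apply: contraTT isT => /(kaP (H _))[_ [_ [_ [h _]]]].
  by rewrite h eqxx in xz.
by case: eqP => // h; rewrite h eqxx in xz.
Qed.

End Kernels.


(** * Standard monomials modulo the Jacobian ideal *)

Section Milnor.
Variables (F : fieldType) (n : nat) (f : {mpoly F[n]}).
Local Notation delta := (msize f).-1.
Local Notation Omega := (forms n {mpoly F[n]}).
Local Notation wt := (weight delta.-1).
Local Notation idx := (idx n).
Local Notation kf := (kos (pcoef f)).
Local Notation J := (jacobian_ideal f).
Hypothesis delta_gt0 : (0 < delta)%N.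

Lemma phi_pair (w : Omega) (K : idx -> idx -> F) N z :
  \sum_(x <- box n N) cf (phi f w) x * K x z =
  \sum_(y <- box n N) cf w y * \sum_(x <- box n N) kf y x * K x z.
Proof.
under [RHS]eq_bigr do rewrite mulr_sumr.
rewrite exchange_big /= !big_seq; apply: eq_bigr => x; rewrite mem_box => xN.
rewrite (phi_kos _ _ xN) mulr_suml; apply: eq_bigr => y _.
by rewrite mulrA.
Qed.

(** A primitive of weight R >= r + e is, in its top part, a boundary, which may
    be subtracted without changing phi w as phi is of square zero. *)
Lemma boundary_primitive_weight e m r (w : Omega) : (0 < e)%N -> exact_at f e m ->
  (forall x, cf w x != 0 -> #|x.1| = m) ->
  (forall z, cf (phi f w) z != 0 -> (wt z <= r)%N) ->
  exists w' : Omega, [/\ phi f w' = phi f w,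
     forall x, cf w' x != 0 -> #|x.1| = m
   & forall x, cf w' x != 0 -> (wt x < r + e)%N].
Proof.
move=> e0 E wm phir.
have [R wR] := weight_bound f w.
elim: R w wm phir wR => [|R IH] w wm phir wR.
  by exists w; split=> // x /wR.
have [Rr|Rr] := ltnP R (r + e)%N.
  by exists w; split=> // x /wR; rewrite ltnS => h; apply: leq_ltn_trans Rr.
have [||eta [eta1 eta2]] := E R w.
- by move=> x nz; split; [apply: wm|apply: wR].
- by move=> z /phir h; apply: leq_trans Rr; rewrite leq_add2r.
have phiE : phi f (w - phi f eta) = phi f w by rewrite phiB phi_sq0 subr0.
have [|||w' [w1 w2 w3]] := IH (w - phi f eta).
- move=> x; rewrite cfB => nz.
  have [w0|/wm//] := eqVneq (cf w x) 0.
  move: nz; rewrite w0 sub0r oppr_eq0 => /phi_neq0[y [/eta1[<- _]]].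
  exact: kos_card.
- by rewrite phiE.
- move=> x; rewrite cfB ltnNge; apply: contraNN => Rx.
  by rewrite eta2 ?subrr.
by exists w'; split=> //; rewrite w1.
Qed.

Local Notation setTn := [set: 'I_n]%SET.

(** The (n-1)-form whose image by phi is the sum of the h_i f_i. *)
Definition top_form (h : 'I_n -> {mpoly F[n]}) : Omega :=
  [ffun I => \sum_(i | I == (setTn :\ i)%SET) ksign F i setTn *: h i].

Lemma setTD1_inj (i j : 'I_n) : (setTn :\ i == setTn :\ j)%SET = (i == j).
Proof.
apply/eqP/eqP => [/setP/(_ i)|->//].
by rewrite !inE eqxx andbT /=; case: eqVneq.
Qed.

Lemma ksign_sqr i (I : {set 'I_n}) : ksign F i I * ksign F i I = 1.
Proof. by rewrite /ksign -expr2 sqrr_sign. Qed.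

Lemma top_formE h i : top_form h (setTn :\ i)%SET = ksign F i setTn *: h i.
Proof.
rewrite ffunE (bigD1 i) //= big1 ?addr0 // => j /andP[].
by rewrite setTD1_inj eq_sym => ->.
Qed.

Lemma card_setTD1 (i : 'I_n) : #|(setTn :\ i)%SET|.+1 = n.
Proof. by have := cardsD1 i setTn; rewrite inE cardsT card_ord add1n. Qed.

Lemma top_form_card h x : cf (top_form h) x != 0 -> #|x.1|.+1 = n.
Proof.
rewrite /cf ffunE => nz; apply/eqP; apply: contraNT nz => xn.
rewrite big1 ?mcoeff0 // => i /eqP xi.
by move: xn; rewrite xi card_setTD1 eqxx.
Qed.

Lemma phi_top_form h : phi f (top_form h) setTn = \sum_i h i * f^`M(i).
Proof.
rewrite /phi ffunE; apply: eq_big => [i|i _]; first by rewrite inE.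
by rewrite top_formE -scalerAr scalerA ksign_sqr scale1r mulrC.
Qed.

Lemma phi_in_jacobian (w : Omega) : J (phi f w setTn).
Proof.
exists (fun i => ksign F i setTn *: w (setTn :\ i)%SET).
rewrite /phi ffunE; apply: eq_big => [i|i _]; first by rewrite inE.
by rewrite -scalerAl mulrC.
Qed.

Lemma card_eqT (I : {set 'I_n}) : #|I| = n -> I = setTn.
Proof.
by move=> h; apply/eqP; rewrite eqEcard finset.subsetT cardsT card_ord h leqnn.
Qed.

Lemma wt_top u : wt (setTn, u) = mdeg u.
Proof. by rewrite /weight cardsT card_ord subnn addn0. Qed.

Variables (e : nat) (U : pred idx) (S P Q G : idx -> idx -> F).
Hypothesis e_gt0 : (0 < e)%N.
Hypothesis kern : kernels f e n U S P Q G.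

Lemma U_top x : U x -> x = (setTn, x.2).
Proof. by move=> /(kU kern)/card_eqT; case: x => I u /= ->. Qed.

Definition comb (s : seq idx) (c : idx -> F) : {mpoly F[n]} :=
  \sum_(x <- s) c x *: 'X_[x.2].

(** Take z of largest weight r in the combination. After
    [boundary_primitive_weight], P and Q agree on the boundary at z. P gives the
    coefficient of z, whereas Q only involves weights larger than r, where the
    boundary vanishes. *)
Lemma standard_free (s : seq idx) (c : idx -> F) :
  exact_at f e n.-1 -> (0 < n)%N -> uniq s -> (forall x, x \in s -> U x) ->
  J (comb s c) -> forall x, x \in s -> c x = 0.
Proof.
move=> E n0 us sU [h hE] x xs; apply/eqP; apply: contraT => cx.
pose A k := has (fun y => (c y != 0) && (k == wt y)) s.
have exA : exists k, A k by exists (wt x); apply/hasP; exists x; rewrite // cx eqxx.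
have Abound k : A k -> (k <= \max_(y <- s) wt y)%N.
  by case/hasP => y ys /andP[_ /eqP->]; rewrite leq_bigmax_seq.
case: (ex_maxnP exA Abound) => r /hasP[z zs /andP[cz /eqP rz]] rmax.
have cmax y : y \in s -> c y != 0 -> (wt y <= r)%N.
  by move=> ys cy; apply: rmax; apply/hasP; exists y; rewrite // cy eqxx.
have phiE y : cf (phi f (top_form h)) y = \sum_(x' <- s) c x' * (x' == y)%:R.
  have [yn|yn] := eqVneq #|y.1| n; last first.
    rewrite [LHS](_ : _ = 0).
      rewrite big_seq big1 // => x' /sU x'U; have [x'y|_] := eqVneq x' y; last by rewrite mulr0.
      by move: yn; rewrite -x'y (kU kern x'U) eqxx.
    apply/eqP; apply: contraNT yn => /(phi_neq0)[x' [/top_form_card x'n]].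
    by move=> /kos_card ->; rewrite x'n.
  have yT := card_eqT yn; case: y yT {yn} => I v /= ->.
  rewrite /cf /= phi_top_form -hE /comb raddf_sum /= !big_seq; apply: eq_bigr => x' /sU x'U.
  rewrite mcoeffZ mcoeffX (U_top x'U) /= -pair_eqE /= eqxx /=.
  by [].
have [||w [wE w1 w2]] := @boundary_primitive_weight e n.-1 r (top_form h) e_gt0 E.
- by move=> y /top_form_card yn; apply: succn_inj; rewrite prednK.
- move=> y; rewrite phiE => /sum_neq0[x' x's]; rewrite mulf_eq0 negb_or.
  by move=> /andP[cx']; have [<- _|_] := eqVneq x' y; [apply: cmax|rewrite eqxx].
pose N := (\max_(y <- s) (mdeg y.2) + r + e).+2.
have zn : #|z.1| = n by apply: (kU kern); apply: sU.
have := phi_pair w P N z.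
have -> : \sum_(y <- box n N) cf w y * \sum_(x0 <- box n N) kf y x0 * P x0 z =
          \sum_(y <- box n N) cf w y * \sum_(x0 <- box n N) kf y x0 * Q x0 z.
  apply: eq_bigr => y _; have [->|nz] := eqVneq (cf w y) 0; first by rewrite !mul0r.
  congr (_ * _); have [zy|zy] := leqP (wt z) (wt y).
    apply: (kI2 kern) => //; first by rewrite -rz /N; lia.
      by rewrite (w1 _ nz) prednK.
    by rewrite zy -rz w2.
  rewrite !big1 // => x0 _.
    have [->|/(phi_wt delta_gt0) k1] := eqVneq (kf y x0) 0; first by rewrite mul0r.
    have [->|/(kQ kern)] := eqVneq (Q x0 z) 0; first by rewrite mulr0.
    by lia.
  have [->|/(phi_wt delta_gt0) k1] := eqVneq (kf y x0) 0; first by rewrite mul0r.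
  have [->|/(kP kern)] := eqVneq (P x0 z) 0; first by rewrite mulr0.
  by lia.
rewrite -phi_pair [RHS]big1 => [|x0 _]; last first.
  have [->|/(kQ kern)[_ [_ k1]]] := eqVneq (Q x0 z) 0; first by rewrite mulr0.
  rewrite wE phiE big_seq big1 ?mul0r // => x' x's.
  have [->|cx'] := eqVneq (c x') 0; first by rewrite mul0r.
  have := cmax _ x's cx'; have [->|_ _] := eqVneq x' x0; last by rewrite mulr0.
  lia.
rewrite wE; under eq_bigr do rewrite phiE mulr_suml.
rewrite exchange_big /= (bigD1_seq z) //= [X in _ + X]big_seq_cond.
rewrite [X in _ + X]big1 => [|x' /andP[x's x'z]].
  rewrite addr0 (sum_box1 (x := z)) => [|| y yz].
  - rewrite eqxx mulr1 (kI4 kern) ?sU // eqxx mulr1 => c0.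
    by rewrite c0 eqxx in cz.
  - move: (@leq_wt n delta.-1 z); rewrite -rz /N; move: (mdeg _) (\max_(_ <- _) _).
    by clear; lia.
  by rewrite eq_sym (negbTE yz) mulr0 mul0r.
rewrite (sum_box1 (x := x')) => [||y yx'].
- by rewrite eqxx mulr1 (kI4 kern) ?sU // (negbTE x'z) mulr0.
- have h' : (mdeg x'.2 <= \max_(y <- s) mdeg y.2)%N.
    by apply: (@leq_bigmax_seq _ s xpredT (fun y : idx => mdeg y.2)).
  by rewrite /N -addnA !ltnS (leq_trans h') // leqW // leq_addr.
by rewrite eq_sym (negbTE yx') mulr0 mul0r.
Qed.

Lemma jacobian0 : J 0.
Proof. by exists (fun=> 0); rewrite big1 // => i _; rewrite mul0r. Qed.

Lemma jacobianD g h : J g -> J h -> J (g + h).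
Proof.
move=> [a ->] [b ->]; exists (fun i => a i + b i).
by rewrite -big_split /=; apply: eq_bigr => i _; rewrite mulrDl.
Qed.

Lemma jacobianZ k g : J g -> J (k *: g).
Proof.
move=> [a ->]; exists (fun i => k *: a i).
by rewrite scaler_sumr; apply: eq_bigr => i _; rewrite scalerAl.
Qed.

(** By induction on the degree: phi S + P differs from the identity by terms of
    lower weight. *)
Lemma standard_span (s : seq idx) : uniq s -> (forall x, U x -> x \in s) ->
  forall g, exists c, J (g - comb s c).
Proof.
move=> us Us.
pose good g := exists c, J (g - comb s c).
have good0 g : J g -> good g.
  move=> Jg; exists (fun=> 0); rewrite [comb _ _](_ : _ = 0) ?subr0 //.
  by rewrite /comb big1 // => x _; rewrite scale0r.
have goodD g h : good g -> good h -> good (g + h).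
  move=> [c Jc] [c' Jc']; exists (fun x => c x + c' x).
  rewrite [X in J X](_ : _ = (g - comb s c) + (h - comb s c')); first exact: jacobianD.
  rewrite [comb s (fun _ => _)](_ : _ = comb s c + comb s c'); last first.
    by rewrite /comb -big_split; apply: eq_bigr => x _; rewrite scalerDl.
  by rewrite opprD addrACA.
have goodZ k g : good g -> good (k *: g).
  move=> [c Jc]; exists (fun x => k * c x).
  rewrite [X in J X](_ : _ = k *: (g - comb s c)); first exact: jacobianZ.
  rewrite scalerBr; congr (_ - _); rewrite /comb scaler_sumr.
  by apply: eq_bigr => x _; rewrite scalerA.
have good_sum (I : eqType) (t : seq I) (h : I -> {mpoly F[n]}) (c : I -> F) :
    (forall i, i \in t -> c i != 0 -> good (h i)) -> good (\sum_(i <- t) c i *: h i).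
  elim: t => [|i t IH] ht; first by rewrite big_nil; apply: good0 jacobian0.
  rewrite big_cons; apply: (goodD); last by apply: IH => j jt; apply: ht; rewrite inE jt orbT.
  have [->|ci] := eqVneq (c i) 0; last by apply: goodZ; apply: ht; rewrite ?mem_head.
  by rewrite scale0r; apply: good0 jacobian0.
have goodU x : U x -> good 'X_[x.2].
  move=> /Us xs; exists (fun y => (y == x)%:R); rewrite /comb (bigD1_seq x) //=.
  rewrite big1 => [|y /negbTE ->]; last by rewrite scale0r.
  by rewrite eqxx scale1r addr0 subrr; apply: jacobian0.
suff goodX r u : (mdeg u < r)%N -> good 'X_[u].
  by move=> g; rewrite [g]mpolyE; apply: good_sum => u _ _; apply: (goodX (mdeg u).+1).
elim: r u => // r IH u ur; rewrite ltnS in ur.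
pose x : idx := (setTn, u); pose N := (wt x + e).+1.
pose g1 := phi f (mkform N (S x)) setTn.
pose g2 := \sum_(z <- box n N) P x z *: 'X_[F, z.2].
have -> : 'X_[u] = g1 + g2 + ('X_[u] - g1 - g2).
  by rewrite [RHS]addrC -['X_[u] - g1 - g2]addrA -opprD subrK.
apply: (goodD); first apply: (goodD).
- by apply: good0; apply: phi_in_jacobian.
- by apply: good_sum => z _ /(kP kern)[_ [_ [_ /goodU]]].
rewrite [_ - g2]mpolyE; apply: good_sum => v _ nz; apply: IH.
apply: leq_trans ur; rewrite ltnNge; apply: contraNN nz => uv.
pose z : idx := (setTn, v).
have xz : (wt x <= wt z)%N by rewrite !wt_top.
have xn : #|x.1| = n by rewrite cardsT card_ord.
have zn : #|z.1| = n by rewrite cardsT card_ord.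
have := (kI1 kern) (maxn N (mdeg v).+1) x z; rewrite leq_max leqnn => /(_ isT xn zn xz) I1.
have g1E : g1@_v = \sum_(y <- box n (maxn N (mdeg v).+1)) S x y * kf y z.
  rewrite -[LHS]/(cf (phi f (mkform N (S x))) z).
  rewrite (phi_kos _ _ (N := maxn N (mdeg v).+1)) ?leq_max ?leqnn ?orbT //.
  apply: eq_bigr => y _; congr (_ * _); have [yN|yN] := ltnP (mdeg y.2) N.
    by rewrite cf_mkform.
  rewrite mkform_ge //; apply/esym/eqP; apply: contraTT yN => /(kS kern)[_ [_ h]].
  have := @leq_wt n delta.-1 y; rewrite /N; lia.
have g2E : g2@_v = P x z.
  rewrite /g2 raddf_sum /=.
  under eq_bigr do rewrite mcoeffZ mcoeffX.
  have [zN|zN] := ltnP (mdeg z.2) N.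
    rewrite (sum_box1 (x := z)) ?eqxx ?mulr1 // => y yz.
    have [->|/(kP kern)[_ [yn _]]] := eqVneq (P x y) 0; first by rewrite mul0r.
    case: eqP => [yv|]; rewrite ?mulr0 //; case/eqP: yz.
    by case: y yn yv => I w /= /card_eqT -> ->.
  rewrite big_seq big1 => [|y]; last first.
    rewrite mem_box => yN; case: eqP => [yv|]; rewrite ?mulr0 //.
    by move: yN; rewrite yv ltnNge zN.
  apply/esym/eqP; apply: contraTT zN => /(kP kern)[_ [_ [h _]]].
  have := @leq_wt n delta.-1 z; rewrite /N; lia.
rewrite !mcoeffB mcoeffX g1E g2E I1 -pair_eqE /= eqxx /=.
by rewrite opprB [_ + (P x z - _)]addrC subrK subrr.
Qed.

End Milnor.


(** * Sequences with trivial syzygies are quasi-regular *)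

Section QuasiRegular.
Variables (A : idomainType) (n : nat) (f : 'I_n -> A).

Definition alternating (R : zmodType) (a : 'I_n -> 'I_n -> R) :=
  (forall i j, a i j = - a j i) /\ (forall i, a i i = 0).

Definition trivial_syzygies (R : comNzRingType) (g : 'I_n -> R) :=
  forall q : 'I_n -> R, \sum_i q i * g i = 0 ->
    exists2 a, alternating a & forall i, q i = \sum_j a i j * g j.

Lemma alternating_sum (R : comNzRingType) a (g : 'I_n -> R) : alternating a ->
  \sum_i (\sum_j a i j * g j) * g i = 0.
Proof.
case=> aN a0; rewrite -[RHS](@sum_antisym n R [set: 'I_n]%SET (fun i j => a i j * g j * g i)).
  apply: eq_big => [i|i _]; first by rewrite inE.
  rewrite mulr_suml (bigD1 i) //= a0 !mul0r add0r; apply: eq_bigl => j.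
  by rewrite !inE andbT.
by move=> i j _ _ _; rewrite aN mulNr mulNr mulrAC.
Qed.

Local Notation B := {mpoly A[n]}.

(** Syzygies over the polynomial ring A[T] are found coefficient by
    coefficient. *)
Lemma mpoly_syzygies : trivial_syzygies f ->
  trivial_syzygies (fun i => (f i)%:MP : B).
Proof.
move=> tf q q0.
have /choice[a aP] (u : 'X_{1..n}) : exists a, alternating a /\
    forall i, (q i)@_u = \sum_j a i j * f j.
  have [|a a1 a2] := tf (fun i => (q i)@_u); last by exists a.
  have /(congr1 (mcoeff u)) := q0; rewrite mcoeff0 raddf_sum => {2}<- /=.
  by apply: eq_bigr => i _; rewrite mulrC [q i * _]mulrC mcoeffCM.
pose N := \max_i msize (q i).
exists (fun i j => \sum_(u : 'X_{1..n < N}) a u i j *: 'X_[u]).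
  split=> [i j|i]; last by rewrite big1 // => u _; case: (aP u) => -[_ ->]; rewrite scale0r.
  rewrite -sumrN; apply: eq_bigr => u _; case: (aP u) => -[-> _] _.
  by rewrite scaleNr.
move=> i; rewrite [LHS](@mpolywE _ _ N) ?leq_bigmax //.
under [RHS]eq_bigr do rewrite mulr_suml.
rewrite exchange_big; apply: eq_bigr => u _ /=.
rewrite (aP u).2 scaler_suml; apply: eq_bigr => j _.
by rewrite [RHS]mulrC mul_mpolyC scalerA mulrC.
Qed.

(** The ideal of A[T, s] spanned by the f_i - s T_i defines the extended Rees
    algebra of the ideal (f_1, ..., f_n). *)
Definition rees_gen (i : 'I_n) : {poly B} := ((f i)%:MP)%:P - 'X * ('X_i)%:P.

Definition in_rees (p : {poly B}) := exists Q : 'I_n -> {poly B}, p = \sum_i Q i * rees_gen i.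

Lemma in_reesD p q : in_rees p -> in_rees q -> in_rees (p + q).
Proof.
move=> [P ->] [Q ->]; exists (fun i => P i + Q i).
by rewrite -big_split; apply: eq_bigr => i _; rewrite mulrDl.
Qed.

Lemma in_reesM p q : in_rees p -> in_rees (q * p).
Proof.
move=> [P ->]; exists (fun i => q * P i).
by rewrite mulr_sumr; apply: eq_bigr => i _; rewrite mulrA.
Qed.

Lemma in_rees0 : in_rees 0.
Proof. by exists (fun=> 0); rewrite big1 // => i _; rewrite mul0r. Qed.

Lemma in_rees_gen i : in_rees (rees_gen i).
Proof.
exists (fun j => (i == j)%:R); rewrite (bigD1 i) //= eqxx mul1r big1 ?addr0 //.
by move=> j ji; rewrite eq_sym (negbTE ji) mul0r.
Qed.

Lemma coef0_rees_gen i : (rees_gen i)`_0 = (f i)%:MP.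
Proof. by rewrite coefB coefC eqxx coefXM eqxx subr0. Qed.

Lemma coef0_eq0 (R : nzRingType) (p : {poly R}) : p`_0 = 0 -> exists q, p = q * 'X.
Proof.
move=> p0; exists (\poly_(i < (size p).-1) p`_i.+1); apply/polyP => -[|i].
  by rewrite coefMX p0.
rewrite coefMX coef_poly /=; case: ifP => // /negbT; rewrite -leqNgt => h.
by rewrite nth_default //; case: (size p) h.
Qed.

(** The variable s is not a zero divisor modulo the f_i - s T_i. If s p is the
    sum of the Q_i (f_i - s T_i), setting s = 0 gives a syzygy of the f_i. It is
    trivial, and subtracting the corresponding trivial syzygy of the f_i - s T_i
    makes all the Q_i divisible by s. *)
Lemma in_rees_cancel p : trivial_syzygies f -> in_rees (p * 'X) -> in_rees p.
Proof.
move=> tf [Q QE].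
have [|a a1 a2] := mpoly_syzygies tf (q := fun i => (Q i)`_0).
  transitivity ((p * 'X)`_0); last by rewrite coefMX.
  by rewrite QE coef_sum; apply: eq_bigr => i _; rewrite coef0M coef0_rees_gen.
have /choice[Q' Q'E] i : exists q, Q i - \sum_j (a i j)%:P * rees_gen j = q * 'X.
  apply: coef0_eq0; rewrite coefB coef_sum a2 -sumrB big1 // => j _.
  by rewrite coef0M coef0_rees_gen coefC eqxx subrr.
exists Q'; apply: (@mulIf _ 'X); first by rewrite polyX_eq0.
rewrite QE mulr_suml.
under [RHS]eq_bigr do rewrite mulrAC -Q'E mulrBl.
rewrite sumrB alternating_sum ?subr0 //.
by split=> [i j|i]; [rewrite a1.1 polyCN|rewrite a1.2].
Qed.

Lemma in_rees_prod (m : 'X_{1..n}) :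
  in_rees ((\prod_i f i ^+ m i)%:MP%:P - 'X^(mdeg m) * ('X_[m])%:P).
Proof.
pose cong x y := in_rees (x - y).
have congM x x' y y' : cong x x' -> cong y y' -> cong (x * y) (x' * y').
  move=> xx yy; rewrite /cong; have -> : x * y - x' * y' = y * (x - x') + x' * (y - y').
    by rewrite !mulrBr addrA [x' * y]mulrC subrK [y * x]mulrC.
  by apply: in_reesD; apply: in_reesM.
have cong1 x : cong x x by rewrite /cong subrr; apply: in_rees0.
rewrite mpolyXE_id mdegE; pose h i : {poly B} := ((f i)%:MP%:P) ^+ m i.
pose h' i : {poly B} := ('X * ('X_i)%:P) ^+ m i.
rewrite (_ : (\prod_i f i ^+ m i)%:MP%:P = \prod_i h i); last first.
  rewrite !rmorph_prod; apply: eq_bigr => i _.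
  by rewrite /= !rmorphXn.
rewrite (_ : 'X^_ * _ = \prod_i h' i); last first.
  rewrite rmorph_prod /= expr_sum -big_split; apply: eq_bigr => i _ /=.
  by rewrite /h' exprMn rmorphXn.
apply: (big_ind2 cong) => [|x x' y y'|i _]; [exact: cong1|exact: congM|].
rewrite /h /h'; elim: (m i) => [|k IH]; first by rewrite !expr0; apply: cong1.
by rewrite !exprS; apply: congM => //; apply: in_rees_gen.
Qed.

(** Modulo the f_i - s T_i, the polynomial p(s T) is equal to p(f) = 0. It is
    divisible by s^k, so that the quotient is again zero by [in_rees_cancel];
    at s = 0 this says that the part of degree k of p has its coefficients in
    (f_1, ..., f_n). *)
Lemma quasi_regular (p : B) k : trivial_syzygies f ->
  \sum_(u <- msupp p) p@_u * \prod_i f i ^+ u i = 0 ->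
  (forall u, (mdeg u < k)%N -> p@_u = 0) ->
  forall u, mdeg u = k -> exists h : 'I_n -> A, p@_u = \sum_i h i * f i.
Proof.
move=> tf pf p0 u uk.
(* The quotient of p(s T) by s^k. *)
pose P : {poly B} := \sum_(v <- msupp p) (p@_v *: 'X_[v])%:P * 'X^(mdeg v - k).
have [Q QE] : in_rees P.
  suff : in_rees (P * 'X^k).
    elim: k {p0 uk} P => [P|j IH P]; first by rewrite expr0 mulr1.
    by rewrite exprS mulrA => /IH; apply: in_rees_cancel.
  have -> : P * 'X^k = \sum_(v <- msupp p)
      - ((p@_v)%:MP%:P * ((\prod_i f i ^+ v i)%:MP%:P - 'X^(mdeg v) * ('X_[v])%:P)).
    under [RHS]eq_bigr do rewrite mulrBr opprB.
    rewrite sumrB -[X in _ - X](_ : (\sum_(u <- msupp p) p@_u * \prod_i f i ^+ u i)%:MP%:P = _).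
      rewrite pf !rmorph0 subr0 /P mulr_suml !big_seq; apply: eq_bigr => v vp.
      have kv : (k <= mdeg v)%N.
        by rewrite leqNgt; apply/negP => /p0 /eqP; rewrite mcoeff_eq0 vp.
      rewrite -mulrA -exprD subnK // -mul_mpolyC rmorphM /= -mulrA; congr (_ * _).
      by rewrite mulrC.
    by rewrite !rmorph_sum; apply: eq_bigr => v _; rewrite /= !rmorphM.
  apply: big_ind => [||v _]; [exact: in_rees0|exact: in_reesD|].
  by rewrite -mulNr; apply: in_reesM; apply: in_rees_prod.
exists (fun i => ((Q i)`_0)@_u).
have /(congr1 (fun r : {poly B} => (r`_0)@_u)) := QE.
rewrite !coef_sum !raddf_sum /=.
under [in X in _ = X -> _]eq_bigr do rewrite coef0M coef0_rees_gen mulrC mcoeffCM mulrC.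
move=> <-; have [up|up] := boolP (u \in msupp p); last first.
  rewrite big_seq big1 ?memN_msupp_eq0 // => v vp.
  rewrite coefCM coefXn; case: eqP; rewrite ?mulr0 ?mcoeff0 // mulr1 mcoeffZ mcoeffX.
  by case: eqP vp up => [->->|]; rewrite ?mulr0.
rewrite (bigD1_seq u) ?msupp_uniq //= big1 => [|v vu].
  by rewrite coefCM coefXn uk subnn eqxx mulr1 addr0 mcoeffZ mcoeffX eqxx mulr1.
rewrite coefCM coefXn; case: eqP; rewrite ?mulr0 ?mcoeff0 // mulr1 mcoeffZ mcoeffX.
by rewrite (negbTE vu) mulr0.
Qed.

End QuasiRegular.


(** * Finiteness of the set of standard monomials *)

Lemma bounded_pred_enum (T : eqType) (U : pred T) B :
  (forall s, uniq s -> (forall x, x \in s -> U x) -> (size s <= B)%N) ->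
  exists s, uniq s /\ forall x, U x = (x \in s).
Proof.
move=> bound; apply: contrapT => hn.
suff big k : exists s, [/\ uniq s, forall x, x \in s -> U x & size s = k].
  by have [s [us sU sB]] := big B.+1; have := bound s us sU; rewrite sB ltnn.
elim: k => [|k [s [us sU sk]]]; first by exists [::].
have [x Ux xs] : exists2 x, U x & x \notin s.
  apply: contrapT => hx; apply: hn; exists s; split=> // x.
  apply/idP/idP => [Ux|]; last exact: sU.
  by apply: contrapT => /negP xs; apply: hx; exists x.
exists (x :: s); rewrite /= us xs sk; split=> // y; rewrite inE.
by case/orP => [/eqP ->//|]; apply: sU.
Qed.

Lemma msizeM_pred_le (R : idomainType) n (g h : {mpoly R[n]}) a b :
  (msize g <= a.+1)%N -> (msize h <= b.+1)%N -> (msize (g * h) <= (a + b).+1)%N.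
Proof.
move=> ga hb; have [->|g0] := eqVneq g 0; first by rewrite mul0r msize0.
have [->|h0] := eqVneq h 0; first by rewrite mulr0 msize0.
by rewrite msizeM // -subn1 leq_subLR add1n -addSn -addnS leq_add.
Qed.

Lemma msize_prod_le (R : idomainType) n (I : Type) (s : seq I)
    (g : I -> {mpoly R[n]}) (D : I -> nat) :
  (forall i, (msize (g i) <= (D i).+1)%N) ->
  (msize (\prod_(i <- s) g i) <= (\sum_(i <- s) D i).+1)%N.
Proof.
move=> gD; elim: s => [|i s IH]; first by rewrite !big_nil msize1.
by rewrite !big_cons; apply: msizeM_pred_le.
Qed.

Section Finiteness.
Variables (F : fieldType) (n : nat) (f : {mpoly F[n]}).
Local Notation delta := (msize f).-1.
Local Notation Omega := (forms n {mpoly F[n]}).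
Local Notation wt := (weight delta.-1).
Local Notation idx := (idx n).
Local Notation J := (jacobian_ideal f).
Local Notation setTn := [set: 'I_n]%SET.
Hypothesis delta_gt0 : (0 < delta)%N.

Lemma phi0 : phi f 0 = 0.
Proof. by have := phiB f 0 0; rewrite !subrr. Qed.

Lemma exact_cycle e m (w : Omega) : exact_at f e m ->
  (forall x, cf w x != 0 -> #|x.1| = m) -> phi f w = 0 ->
  exists xi : Omega, phi f xi = w.
Proof.
move=> E wm w0.
have [R wR] := weight_bound f w.
elim: R w wm w0 wR => [|R IH] w wm w0 wR.
  exists 0; have -> : w = 0.
    apply: cfP => x; rewrite cf0; apply/eqP; apply: contraT => /wR; by rewrite ltn0.
  exact: phi0.
have [||xi [xi1 xi2]] := E R w.
- by move=> x nz; split; [apply: wm|apply: wR].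
- by move=> z; rewrite w0 cf0 eqxx.
have [|||eta etaE] := IH (w - phi f xi).
- move=> x; rewrite cfB => nz.
  have [c0|/wm//] := eqVneq (cf w x) 0.
  move: nz; rewrite c0 sub0r oppr_eq0 => /phi_neq0[y [/xi1[<- _]]].
  exact: kos_card.
- by rewrite phiB phi_sq0 w0 subr0.
- move=> x; rewrite cfB ltnNge; apply: contraNN => Rx.
  by rewrite xi2 ?subrr.
by exists (eta - (0 - xi)); rewrite !phiB phi0 sub0r opprK etaE subrK.
Qed.

(** Koszul relations are the images of the (n-2)-forms. *)
Lemma exact_syzygies e : exact_at f e n.-1 -> (0 < n)%N ->
  trivial_syzygies (fun i => f^`M(i)).
Proof.
move=> E n0 q q0.
have [||xi xiE] := @exact_cycle e n.-1 (top_form q) E.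
- by move=> x /top_form_card h; apply: succn_inj; rewrite prednK.
- apply: cfP => x; rewrite cf0; have [xn|xn] := eqVneq #|x.1| n.
    have xT := card_eqT xn; case: x xT {xn} => I v /= ->.
    by rewrite /cf /= phi_top_form q0 mcoeff0.
  apply/eqP; apply: contraNT xn => /(phi_neq0)[y [/top_form_card yn]].
  by move=> /kos_card ->; rewrite yn.
pose a i j := if i == j then 0 else
  (ksign F i setTn * ksign F j (setTn :\ i)) *: xi (setTn :\ i :\ j)%SET.
exists a.
  split=> [i j|i]; last by rewrite /a eqxx.
  rewrite /a eq_sym; case: eqVneq => [_|ij]; first by rewrite oppr0.
  rewrite ksignM ?inE // 1?eq_sym // scaleNr.
  by rewrite !finset.setDDl finset.setUC.
move=> i; have := top_formE q i; rewrite -xiE /phi ffunE.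
move=> /(congr1 (fun g => ksign F i setTn *: g)).
rewrite scalerA ksign_sqr scale1r => <-; rewrite scaler_sumr.
rewrite [RHS](bigD1 i) //= {1}/a eqxx mul0r add0r.
apply: eq_big => [j|j ji]; first by rewrite !inE andbT.
have /negbTE ij : i != j by move: ji; rewrite !inE andbT eq_sym.
by rewrite /a ij scalerA -[RHS]scalerAl; congr (_ *: _); rewrite mulrC.
Qed.

Variables (e : nat) (U : pred idx) (S P Q G : idx -> idx -> F).
Hypothesis e_gt0 : (0 < e)%N.
Hypothesis kern : kernels f e n U S P Q G.
Hypothesis n_gt0 : (0 < n)%N.
Hypothesis exact : exact_at f e n.-1.

Lemma msize_deriv i : (msize f^`M(i) <= delta.-1.+1)%N.
Proof.
rewrite msizeE big_seq; elim/big_ind: _ => [//|x y hx hy|u].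
  by rewrite geq_max hx hy.
by rewrite mcoeff_msupp ltnS => /(pcoef_mdeg delta_gt0).
Qed.

Let mon t (al : {ffun 'I_n -> 'I_t.+1}) : 'X_{1..n} := [multinom (al i : nat) | i < n].

(** By induction on the degree: by [quasi_regular], the lowest coefficients of a
    relation between the powers of the f_i are in the Jacobian ideal, hence
    zero. *)
Lemma U_powers_free (s : seq idx) t (c : {ffun 'I_n -> 'I_t.+1} -> idx -> F) :
  uniq s -> (forall x, x \in s -> U x) ->
  \sum_al comb s (c al) * \prod_i f^`M(i) ^+ (al i) = 0 ->
  forall al x, x \in s -> c al x = 0.
Proof.
move=> us sU c0.
have monE al i : mon al i = al i by rewrite mnmE.
have mon_inj : injective (@mon t).
  move=> al be /mnmP h; apply/ffunP => i; apply: val_inj.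
  by have := h i; rewrite !monE.
pose p : {mpoly {mpoly F[n]}[n]} := \sum_al comb s (c al) *: 'X_[mon al].
have pE al : p@_(mon al) = comb s (c al).
  rewrite /p raddf_sum (bigD1 al) //= mcoeffZ mcoeffX eqxx mulr1 big1 ?addr0 //.
  by move=> be ba; rewrite mcoeffZ mcoeffX (inj_eq mon_inj) (negbTE ba) mulr0.
have pf : \sum_(u <- msupp p) p@_u * \prod_i f^`M(i) ^+ u i = 0.
  rewrite -(mevalE (fun i => f^`M(i))) /p raddf_sum /= -[RHS]c0.
  apply: eq_bigr => al _; rewrite mevalZ mevalX.
  by congr (_ * _); apply: eq_bigr => i _; rewrite monE.
suff key k : forall al, (mdeg (mon al) < k)%N -> forall x, x \in s -> c al x = 0.
  by move=> al; apply: (key (mdeg (mon al)).+1).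
elim: k => // k IH al; rewrite ltnS leq_eqVlt => /orP[/eqP alk|]; last exact: IH.
apply: (standard_free delta_gt0 e_gt0 kern exact n_gt0 us sU); rewrite -pE.
apply: (quasi_regular (k := k) (exact_syzygies exact n_gt0) pf) alk => u uk.
rewrite /p raddf_sum big1 //= => be _; rewrite mcoeffZ mcoeffX.
have [bu|_] := eqVneq (mon be) u; last by rewrite mulr0.
rewrite mulr1 /comb big_seq big1 // => x xs.
by rewrite (IH be) ?scale0r // bu.
Qed.

(** With t the largest degree of a monomial in s, the (t + 1)^n * size s
    products of these monomials with the f_1^a_1 ... f_n^a_n, a_i <= t, are
    independent polynomials of degree at most t + n t (delta - 1), a space of
    dimension at most (1 + t (1 + n (delta - 1)))^n. *)
Lemma U_bound (s : seq idx) : uniq s -> (forall x, x \in s -> U x) ->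
  (size s <= (1 + n * delta.-1) ^ n)%N.
Proof.
move=> us sU; pose t := \max_(x <- s) mdeg x.2.
pose N := (t + n * (t * delta.-1)).+1.
pose dflt : idx := (finset.set0, 0%MM).
(* R indexes the products, and N bounds their degrees. *)
pose R := ({ffun 'I_n -> 'I_t.+1} * 'I_(size s))%type.
pose g (r : R) := 'X_[(nth dflt s r.2).2] * \prod_i f^`M(i) ^+ (r.1 i).
have gN (r : R) u : (g r)@_u != 0 -> (mdeg u < N)%N.
  rewrite -mcoeff_msupp => /msize_mdeg_lt h; apply: leq_trans h _.
  apply: msizeM_pred_le.
    rewrite msizeX ltnS.
    exact: (@leq_bigmax_seq _ s xpredT (fun x : idx => mdeg x.2)) (mem_nth _ _) isT.
  have h (i : 'I_n) : (msize (f^`M(i) ^+ (r.1 i)) <= (t * delta.-1).+1)%N.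
    have -> : f^`M(i) ^+ (r.1 i) = \prod_(j < r.1 i) f^`M(i).
      by rewrite prodr_const card_ord.
    apply: leq_trans (msize_prod_le _ (fun=> msize_deriv i)) _.
    by rewrite sum_nat_const card_ord ltnS leq_mul2r -ltnS ltn_ord orbT.
  apply: leq_trans (msize_prod_le _ h) _.
  by rewrite sum_nat_const card_ord.
pose M : 'M[F]_(#|{: R}|, #|{: 'X_{1..n < N}}|) :=
  \matrix_(a, b) (g (enum_val a))@_(enum_val b : 'X_{1..n < N}).
have Mfree : row_free M.
  apply: inj_row_free => v vM.
  have v1 : \sum_(r : R) v 0 (enum_rank r) *: g r = 0.
    apply/mpolyP => u; rewrite mcoeff0 raddf_sum /=.
    have [uN|uN] := ltnP (mdeg u) N; last first.
      rewrite big1 // => r _; rewrite mcoeffZ [X in _ * X](_ : _ = 0) ?mulr0 //.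
      by apply/eqP; apply: contraTT uN => /gN; rewrite -ltnNge.
    have /rowP/(_ (enum_rank (BMultinom uN))) := vM; rewrite !mxE => {2}<-.
    rewrite (reindex _ (onW_bij _ (@enum_val_bij R))) /=.
    by apply: eq_bigr => a _; rewrite mcoeffZ mxE enum_valK enum_rankK.
  have v0 : \sum_al \sum_k v 0 (enum_rank ((al, k) : R)) *: g (al, k) = 0.
    by rewrite pair_big -[RHS]v1; apply: eq_bigr => -[al k].
  pose c (al : {ffun 'I_n -> 'I_t.+1}) (x : idx) :=
    \sum_(k < size s | nth dflt s k == x) v 0 (enum_rank ((al, k) : R)).
  have cE al (k : 'I_(size s)) : c al (nth dflt s k) = v 0 (enum_rank ((al, k) : R)).
    rewrite /c (big_pred1 k) // => j /=.
    by rewrite nth_uniq.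
  have c0 := @U_powers_free s t c us sU.
  apply/rowP => a; rewrite mxE -[a]enum_valK; case: (enum_val a) => al k.
  rewrite -cE; apply: c0; last exact: mem_nth.
  rewrite -[RHS]v0; apply: eq_bigr => be _.
  rewrite /comb (big_nth dflt) big_mkord mulr_suml; apply: eq_bigr => j _.
  by rewrite cE -scalerAl.
have := rank_leq_col M; rewrite (eqP Mfree) => h.
have {}h : (t.+1 ^ n * size s <= N ^ n)%N.
  move: h; rewrite card_prod card_ffun !card_ord => /leq_trans; apply.
  pose fn (u : 'X_{1..n < N}) : {ffun 'I_n -> 'I_N} :=
    [ffun i => Ordinal (leq_ltn_trans (mnm_le_mdeg u i) (bmdeg u))].
  have /leq_card : injective fn.
    move=> u v uv; apply: val_inj; apply/mnmP => i.
    by have /ffunP/(_ i) := uv; rewrite !ffunE => -[].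
  by rewrite card_ffun !card_ord.
rewrite -(@leq_pmul2l (t.+1 ^ n)) ?expn_gt0 //; apply: leq_trans h _.
rewrite -expnMn leq_exp2r // /N mulnDr muln1 addSn ltnS leq_add2l.
by rewrite mulnCA leq_mul2r leqnSn orbT.
Qed.

Lemma exists_milnor_basis : exists s : seq idx, uniq s /\ (forall x, U x = (x \in s)).
Proof. by apply: bounded_pred_enum => s; apply: U_bound. Qed.

End Finiteness.


(** * Valuations and completeness *)

Section Valuation.
Variables (L : fieldType) (ord : L -> rat).
Hypothesis ord_val : is_valuation ord.
Local Notation oge := (ord_ge ord).
Implicit Types (x y : L) (r s : rat).

Lemma ordM x y : x != 0 -> y != 0 -> ord (x * y) = ord x + ord y.
Proof. exact: ord_val.1. Qed.

Lemma ord1 : ord 1 = 0.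
Proof.
have := ordM (oner_neq0 L) (oner_neq0 L); rewrite mulr1 => /eqP.
by rewrite addrC -subr_eq subrr => /eqP.
Qed.

Lemma ordX x k : x != 0 -> ord (x ^+ k) = k%:R * ord x.
Proof.
move=> x0; elim: k => [|k IH]; first by rewrite expr0 ord1 mul0r.
by rewrite exprS ordM ?expf_neq0 // IH -[k.+1]add1n natrD mulrDl mul1r.
Qed.

Lemma ordV x : x != 0 -> ord x^-1 = - ord x.
Proof.
move=> x0; apply/eqP; rewrite -addr_eq0 -ordM ?invr_eq0 //.
by rewrite mulVf // ord1.
Qed.

Lemma ordN x : ord (- x) = ord x.
Proof.
have [->|x0] := eqVneq x 0; first by rewrite oppr0.
have N0 : (-1 : L) != 0 by rewrite oppr_eq0 oner_eq0.
have h : ord (-1) + ord (-1) = 0 by rewrite -ordM // mulrNN mulr1 ord1.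
by rewrite -mulN1r ordM //; lra.
Qed.

Lemma oge0 r : oge r 0. Proof. by rewrite /ord_ge eqxx. Qed.

Lemma oge_neq0 r x : x != 0 -> oge r x = (r <= ord x).
Proof. by rewrite /ord_ge => /negbTE ->. Qed.

Lemma oge_ord r x : r <= ord x -> oge r x.
Proof. by rewrite /ord_ge => ->; rewrite orbT. Qed.

Lemma oge_le r s x : s <= r -> oge r x -> oge s x.
Proof. by rewrite /ord_ge; case: eqP => //= _; apply: le_trans. Qed.

Lemma ogeN r x : oge r (- x) = oge r x.
Proof. by rewrite /ord_ge oppr_eq0 ordN. Qed.

Lemma ogeD r x y : oge r x -> oge r y -> oge r (x + y).
Proof.
have [->|x0] := eqVneq x 0; first by rewrite add0r.
have [->|y0] := eqVneq y 0; first by rewrite addr0.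
have [->|xy0] := eqVneq (x + y) 0; first by rewrite oge0.
rewrite !oge_neq0 // => rx ry; apply: le_trans (ord_val.2 x y x0 y0 xy0).
by rewrite le_min rx.
Qed.

Lemma ogeB r x y : oge r x -> oge r y -> oge r (x - y).
Proof. by move=> h k; rewrite ogeD ?ogeN. Qed.

Lemma ogeM r s x y : oge r x -> oge s y -> oge (r + s) (x * y).
Proof.
have [->|x0] := eqVneq x 0; first by move=> _ _; rewrite mul0r oge0.
have [->|y0] := eqVneq y 0; first by move=> _ _; rewrite mulr0 oge0.
by rewrite !oge_neq0 ?mulf_neq0 // ordM // => rx ry; rewrite lerD.
Qed.

Lemma oge_sum (I : Type) (t : seq I) (P : pred I) (g : I -> L) r :
  (forall i, P i -> oge r (g i)) -> oge r (\sum_(i <- t | P i) g i).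
Proof.
move=> h; apply: (big_ind (oge r)) => //; first exact: oge0.
by move=> x y hx hy; apply: ogeD.
Qed.

Lemma oge_sum_seq (I : eqType) (t : seq I) (g : I -> L) r :
  (forall i, i \in t -> oge r (g i)) -> oge r (\sum_(i <- t) g i).
Proof. by move=> h; rewrite big_seq; apply: oge_sum. Qed.

Lemma oge_nat k : oge 0 k%:R.
Proof.
elim: k => [|k IH]; first exact: oge0.
by rewrite -addn1 natrD ogeD // oge_ord // ord1.
Qed.

Lemma oge_sign k : oge 0 ((-1) ^+ k).
Proof.
have h1 : oge 0 1 by apply: oge_ord; rewrite ord1.
by rewrite -signr_odd; case: (odd k); rewrite ?expr0 ?expr1 ?ogeN.
Qed.

Lemma oge_eq0 x : (forall r, oge r x) -> x = 0.
Proof.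
move=> h; apply/eqP; have := h (ord x + 1); rewrite /ord_ge.
by case: eqP => //= _; rewrite gerDl ler10.
Qed.

Lemma oge_signM r k x : oge r x -> oge r ((-1) ^+ k * x).
Proof. by move=> h; rewrite -[r]add0r ogeM ?oge_sign. Qed.

Lemma oge_natM r k x : oge r x -> oge r (k%:R * x).
Proof. by move=> h; rewrite -[r]add0r ogeM ?oge_nat. Qed.

(** The roots of x^k = x are integral, being zero or of order zero. *)
Lemma oge_unit x (k : nat) : (1 < k)%N -> x ^+ k = x -> oge 0 x.
Proof.
have [->|x0] := eqVneq x 0; first by rewrite oge0.
move=> k1 e; rewrite oge_neq0 //; have := ordX k x0; rewrite e.
have : 1 < k%:R :> rat by rewrite ltr1n.
move=> k1' h; have : ord x * (k%:R - 1) = 0 by lra.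
by move/eqP; rewrite mulf_eq0 => /orP[/eqP->//|]; lra.
Qed.

End Valuation.

Section Completeness.
Variables (Q : fieldType) (L : fieldExtType Q) (ord : L -> rat).
Hypothesis ord_val : is_valuation ord.
Hypothesis Q_complete : forall u : nat -> Q,
  is_cauchy (fun x : Q => ord x%:A) u -> exists x, tends_to (fun x : Q => ord x%:A) u x.
Local Notation oge := (ord_ge ord).

Lemma oge_alg r (x : Q) : ord_ge (fun x : Q => ord x%:A) r x = oge r x%:A.
Proof. by rewrite /ord_ge scaler_eq0 oner_eq0 orbF. Qed.

Definition complete_in (V : {vspace L}) := forall u : nat -> L,
  (forall k, u k \in V) -> is_cauchy ord u -> exists2 x, x \in V & tends_to ord u x.

Lemma tends_unique (u : nat -> L) x y : tends_to ord u x -> tends_to ord u y -> x = y.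
Proof.
move=> ux uy; apply/eqP; rewrite -subr_eq0; apply/eqP; apply: (oge_eq0 (ord := ord)) => r.
have [N hN] := ux r; have [N' hN'] := uy r.
have -> : x - y = (u (maxn N N') - y) - (u (maxn N N') - x).
  by rewrite opprB [u _ - y]addrC addrACA [- y + x]addrC subrr addr0.
by apply: ogeB => //; [apply: hN'|apply: hN]; rewrite leq_max leqnn ?orbT.
Qed.

Lemma tendsB (u v : nat -> L) x y :
  tends_to ord u x -> tends_to ord v y -> tends_to ord (fun k => u k - v k) (x - y).
Proof.
move=> ux vy r; have [N hN] := ux r; have [N' hN'] := vy r.
exists (maxn N N') => k; rewrite geq_max => /andP[kN kN'].
by rewrite opprD addrACA -opprD; apply: ogeB => //; [apply: hN|apply: hN'].
Qed.

Lemma cauchyB (u v : nat -> L) :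
  is_cauchy ord u -> is_cauchy ord v -> is_cauchy ord (fun k => u k - v k).
Proof.
move=> ux vy r; have [N hN] := ux r; have [N' hN'] := vy r.
exists (maxn N N') => l k; rewrite !geq_max => /andP[lN lN'] /andP[kN kN'].
by rewrite opprD addrACA -opprD; apply: ogeB => //; [apply: hN|apply: hN'].
Qed.

Lemma tends_cauchy (u : nat -> L) x : tends_to ord u x -> is_cauchy ord u.
Proof.
move=> ux r; have [N hN] := ux r; exists N => l k lN kN.
have -> : u l - u k = (u l - x) - (u k - x).
  by rewrite opprB addrA subrK.
by apply: ogeB => //; apply: hN.
Qed.

Lemma tends_scale (a : nat -> Q) c v :
  tends_to (fun x : Q => ord x%:A) a c -> tends_to ord (fun k => a k *: v) (c *: v).
Proof.
move=> ac r; have [N hN] := ac (r - ord v); exists N => k /hN.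
rewrite oge_alg -scalerBl => h.
rewrite -[X in _ *: X]mul1r scalerAl -(subrK (ord v) r) ogeM //.
exact: oge_ord.
Qed.

(** The coefficients a_k of v in a Cauchy sequence form a Cauchy sequence:
    otherwise, dividing differences of terms of the sequence by the
    corresponding differences of the a_k would exhibit v as a limit of elements
    of V, hence as an element of V. *)
Lemma complete_add (V : {vspace L}) v : complete_in V -> complete_in (<[v]> + V)%VS.
Proof.
move=> cV; have [vV|vV] := boolP (v \in V).
  suff -> : (<[v]> + V)%VS = V by [].
  by apply/addv_idPr; rewrite -memvE.
move=> u uV cu.
have /choice[a /choice[w uE]] k : exists a w, w \in V /\ u k = a *: v + w.
  by have /memv_addP[_ /vlineP[a ->] [w wV e]] := uV k; exists a, w.
have ca : is_cauchy (fun x : Q => ord x%:A) a.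
  apply: contrapT => /existsNP[R] /forallNP nR.
  (* If the a_k were not Cauchy, arbitrarily far terms would stay at distance R. *)
have far N : exists lm : nat * nat, [/\ (N <= lm.1)%N, (N <= lm.2)%N &
      ~~ oge R (a lm.1 - a lm.2)%:A].
    apply: contrapT => hn; apply: (nR N) => l m Nl Nm.
    rewrite oge_alg; apply: contrapT => /negP h; apply: hn; exists (l, m); split=> //.
  have /choice[lm lmE] := far.
  pose t N := (a (lm N).1 - a (lm N).2)^-1 *: (u (lm N).1 - u (lm N).2).
  pose z N := (a (lm N).1 - a (lm N).2)^-1 *: (w (lm N).1 - w (lm N).2).
  have tz N : t N - z N = v.
    have [_ _ hR] := lmE N.
    have d0 : a (lm N).1 - a (lm N).2 != 0.
      by apply: contra hR => /eqP->; rewrite scale0r oge0.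
    rewrite /t /z -scalerBr !(uE _).2 opprD [_ + (- _ - _)]addrACA addrK -scalerBl.
    by rewrite scalerA mulVf // scale1r.
  have t0 : tends_to ord t 0.
    move=> r; have [N hN] := cu (r + R); exists N => k Nk; rewrite subr0.
    have [k1 k2 hR] := lmE k.
    have d0 : (a (lm k).1 - a (lm k).2)%:A != 0 :> L.
      by apply: contra hR => /eqP->; rewrite oge0.
    rewrite oge_neq0 // -ltNge in hR.
    rewrite /t -[_ *: (_ - _)]mul1r -scalerAr scalerAl.
    have -> : (a (lm k).1 - a (lm k).2)^-1 *: 1 = ((a (lm k).1 - a (lm k).2)%:A : L)^-1.
      apply: (mulIf d0); rewrite mulVf // -scalerAl mul1r scalerA mulVf ?scale1r //.
      by move: d0; rewrite scaler_eq0 oner_eq0 orbF.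
    have := hN _ _ (leq_trans Nk k1) (leq_trans Nk k2) => h.
    have -> : r = - R + (r + R) by rewrite addrC addrK.
    by apply: ogeM => //; rewrite oge_neq0 ?invr_eq0 // ordV // lerN2 ltW.
  have zv : tends_to ord z (0 - v).
    suff -> : z = fun k => t k - v by apply: tendsB => // r; exists 0%N => k _; rewrite subrr oge0.
    by apply/funext => k; rewrite -(tz k) opprB addrC subrK.
  have [|x xV zx] := cV z _ (tends_cauchy zv).
    by move=> k; rewrite memvZ // memvB // (uE _).1.
  case/negP: vV; rewrite -[v]opprK memvN -sub0r (tends_unique zv zx) //.
have [c ac] := Q_complete ca.
have wc : is_cauchy ord w.
  suff -> : w = fun k => u k - a k *: v.
    by apply: cauchyB => //; apply: tends_cauchy (tends_scale v ac).
  by apply/funext => k; rewrite (uE k).2 addrC addKr.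
have [y yV wy] := cV w (fun k => (uE k).1) wc.
exists (c *: v + y); first by rewrite memv_add ?memvZ ?memv_line.
rewrite -[y]opprK; suff -> : u = fun k => a k *: v - - w k.
  apply: tendsB; first exact: tends_scale.
  by move=> r; have [N hN] := wy r; exists N => k /hN; rewrite -opprD ogeN.
by apply/funext => k; rewrite opprK (uE k).2.
Qed.

Lemma complete_L (u : nat -> L) : is_cauchy ord u -> exists x, tends_to ord u x.
Proof.
have : complete_in {:L}.
  rewrite -(span_basis (vbasisP {:L})); elim: (tval _) => [|v X IH].
    move=> w wV cw; exists 0; first exact: mem0v.
    move=> r; exists 0%N => k _; move: (wV k); rewrite span_nil memv0 => /eqP->.
    by rewrite subr0 oge0.
  by rewrite span_cons; apply: complete_add.
by move=> h cu; have [|x _ ux] := h u _ cu; [move=> k; rewrite memvf|exists x].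
Qed.

End Completeness.


(** * Values on Q_p and reduction to the residue field *)

Section ValuesOnQp.
Variables (p : nat) (Q : fieldType) (ord : Q -> rat).
Hypothesis p_pr : prime p.
Hypothesis QpP : is_Qp p ord.
Let val := Qp_valuation QpP.
Local Notation oge := (ord_ge ord).

(** Write k u = p v + 1. *)
Lemma ord_coprime k : coprime k p -> k%:R != 0 :> Q /\ ord k%:R = 0.
Proof.
move=> kp; have k0 : (0 < k)%N.
  by case: k kp => //; rewrite /coprime gcd0n => /eqP p1; move: p_pr; rewrite p1.
have [u /eqP uE] : exists u, (k * u == 1 %[mod p])%N.
  case: (egcdnP p k0) => u v e _; exists u.
  by rewrite mulnC e (eqP kp) modnMDl.
have oge1p j : oge 1 (j * p)%:R.
  by rewrite natrM -[1]add0r ogeM ?oge_nat // oge_ord // (Qp_ord_p QpP).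
have ku : (k * u)%:R = (k * u %/ p * p)%:R + 1 :> Q.
  by rewrite {1}(divn_eq (k * u) p) uE modn_small ?prime_gt1 // natrD.
have e1 : 1 = (k * u)%:R - (k * u %/ p * p)%:R :> Q by rewrite ku addrC addKr.
have n1 : ~~ oge 1 1.
  by rewrite oge_neq0 ?oner_neq0 // (ord1 val) ler10.
have n1' : ~~ oge 1 (k * u)%:R.
  by apply: contra n1 => h; have := ogeB val h (oge1p (k * u %/ p)%N); rewrite -e1.
have kz : k%:R != 0 :> Q.
  by apply: contra n1' => /eqP kz; rewrite natrM kz mul0r oge0.
have uz : u%:R != 0 :> Q.
  by apply: contra n1' => /eqP uz; rewrite natrM uz mulr0 oge0.
have kn := oge_nat val k; have un := oge_nat val u.
rewrite oge_neq0 // in kn; rewrite oge_neq0 // in un.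
have e : ord (k * u)%:R = 0.
  have kup : (k * u)%:R != 0 :> Q by rewrite natrM mulf_neq0.
  apply: le_anti; rewrite -(oge_neq0 _ _ kup) oge_nat // andbT leNgt.
  apply/negP => pos.
  have pz : (k * u %/ p * p)%:R + 1 != 0 :> Q by rewrite -ku.
  have : ord 1 != 0.
    have [z|z] := eqVneq ((k * u %/ p * p)%:R : Q) 0.
      by move: pos; rewrite ku z add0r => /gt_eqF ->.
    have o1 : Num.min (ord (k * u)%:R) 1 <= ord 1.
      rewrite -(oge_neq0 _ _ (oner_neq0 Q)) [X in oge _ X]e1.
      apply: (ogeB val) => //; last by apply: oge_le (oge1p _); rewrite ge_min lexx orbT.
      by rewrite oge_neq0 // ge_min lexx.
    rewrite gt_eqF //; apply: lt_le_trans o1.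
    by rewrite lt_min pos.
  by rewrite (ord1 val) eqxx.
split=> //; move: e; rewrite natrM (ordM val) //; lra.
Qed.

Lemma ord_natE k : (0 < k)%N -> k%:R != 0 :> Q /\ exists j : nat, ord k%:R = j%:R.
Proof.
move=> k0; have [m mp ->] := pfactor_coprime p_pr k0.
have [mz m0] := ord_coprime (k := m) ltac:(by rewrite coprime_sym).
have pz := Qp_p_neq0 QpP.
rewrite natrM natrX; split; first by rewrite mulf_neq0 ?expf_neq0.
exists (logn p k); rewrite (ordM val) ?expf_neq0 // m0 add0r (ordX val) //.
by rewrite (Qp_ord_p QpP) mulr1.
Qed.

Lemma ord_intE (z : int) : z != 0 -> z%:~R != 0 :> Q /\ exists j : nat, ord z%:~R = j%:R.
Proof.
case: z => k z0.
  have : (0 < k)%N by rewrite lt0n.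
  exact: ord_natE.
rewrite NegzE mulrNz oppr_eq0 (ordN val); exact: (@ord_natE k.+1).
Qed.

(** By density, the values on Q_p are those on the rational numbers. *)
Lemma ord_Qp_int (x : Q) : x != 0 -> ord x \is a Num.int.
Proof.
move=> x0; have [z] := Qp_dense QpP x (ord x + 1).
have [->|z0] := eqVneq z 0.
  have -> : ratr 0 = 0 :> Q by rewrite /ratr mul0r.
  by rewrite subr0 oge_neq0 // gerDl ler10.
have [nz [j nj]] : (numq z)%:~R != 0 :> Q /\ exists j : nat, ord (numq z)%:~R = j%:R.
  by apply: ord_intE; rewrite numq_eq0.
have [dz [i di]] : (denq z)%:~R != 0 :> Q /\ exists j : nat, ord (denq z)%:~R = j%:R.
  by apply: ord_intE; rewrite denq_eq0.
have rz : ratr z != 0 :> Q by rewrite /ratr mulf_neq0 // invr_eq0.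
have rE : ord (ratr z) = j%:R - i%:R.
  by rewrite /ratr (ordM val) ?invr_eq0 // (ordV val) // nj di.
move=> h; suff -> : ord x = ord (ratr z) by rewrite rE rpredB // natr_int.
apply: le_anti; rewrite -!(oge_neq0 ord) //; apply/andP; split.
  have -> : ratr z = x - (x - ratr z) :> Q by rewrite subKr.
  apply: (ogeB val); first by rewrite oge_neq0.
  by apply: oge_le h; lra.
rewrite oge_neq0 // leNgt; apply/negP => lt.
have : oge (Num.min (ord x + 1) (ord (ratr z))) x.
  rewrite -[X in oge _ X](subrK (ratr z)); apply: (ogeD val).
    by apply: oge_le h; rewrite ge_min lexx.
  by rewrite oge_neq0 // ge_min lexx orbT.
by rewrite oge_neq0 // ge_min => /orP[h'|]; lra.
Qed.

End ValuesOnQp.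

Lemma ord_p (p : nat) (Qp : fieldType) (L : fieldExtType Qp) (ord : L -> rat) :
  is_Qp p (fun x : Qp => ord x%:A) -> p%:R != 0 :> L /\ ord p%:R = 1.
Proof.
move=> QpP; have e : p%:R = (p%:R : Qp)%:A :> L by rewrite scaler_nat.
by rewrite e (Qp_ord_p QpP) scaler_eq0 oner_eq0 orbF (Qp_p_neq0 QpP).
Qed.

Section Residues.
Variables (p a : nat) (Fq : finFieldType) (Qp : fieldType) (L : fieldExtType Qp).
Variables (ord : L -> rat) (K : {subfield L}) (red : L -> Fq).
Hypothesis p_pr : prime p.
Hypothesis val : is_valuation ord.
Hypothesis QpP : is_Qp p (fun x : Qp => ord x%:A).
Hypothesis KP : is_unramified a ord K red.
Local Notation oge := (ord_ge ord).

Definition lifts (x : L) (c : Fq) := [/\ x \in K, oge 0 x & red x = c].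

Lemma liftsD x y c d : lifts x c -> lifts y d -> lifts (x + y) (c + d).
Proof.
move=> [xK x0 <-] [yK y0 <-]; split; first exact: memvD.
  exact: (ogeD val).
exact: (unr_redD KP).
Qed.

Lemma liftsM x y c d : lifts x c -> lifts y d -> lifts (x * y) (c * d).
Proof.
move=> [xK x0 <-] [yK y0 <-]; split; first exact: rpredM.
  by rewrite -[0]addr0 (ogeM val).
exact: (unr_redM KP).
Qed.

Lemma lifts0 : lifts 0 0.
Proof.
split; [exact: mem0v|exact: oge0|].
by apply/eqP; rewrite (unr_red_eq0 KP) ?mem0v ?oge0 // eqxx.
Qed.

Lemma lifts1 : lifts 1 1.
Proof.
split; [exact: rpred1| |exact: (unr_red1 KP)].
by apply: oge_ord; rewrite (ord1 val).
Qed.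

Lemma liftsN x c : lifts x c -> lifts (- x) (- c).
Proof.
move=> h; have [xK x0 xc] := h.
have h' : lifts (- x) (red (- x)) by split=> //; [rewrite memvN|rewrite (ogeN val)].
suff <- : red (- x) = - c by [].
apply/eqP; rewrite -addr_eq0; apply/eqP.
by have [_ _ <-] := liftsD h' h; rewrite addNr; case: lifts0.
Qed.

Lemma liftsB x y c d : lifts x c -> lifts y d -> lifts (x - y) (c - d).
Proof. by move=> h /liftsN; apply: liftsD. Qed.

Lemma lifts_sum (I : Type) (s : seq I) (P : pred I) (g : I -> L) (h : I -> Fq) :
  (forall i, P i -> lifts (g i) (h i)) ->
  lifts (\sum_(i <- s | P i) g i) (\sum_(i <- s | P i) h i).
Proof.
move=> gh; apply: (big_ind2 lifts) => //; first exact: lifts0.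
by move=> x c y d; apply: liftsD.
Qed.

Lemma lifts_nat k : lifts k%:R k%:R.
Proof.
elim: k => [|k IH]; first exact: lifts0.
by rewrite -addn1 !natrD; apply: liftsD => //; apply: lifts1.
Qed.

Lemma lifts_sign k : lifts ((-1) ^+ k) ((-1) ^+ k).
Proof.
elim: k => [|k IH]; first by rewrite !expr0; apply: lifts1.
by rewrite !exprS; apply: liftsM => //; apply: liftsN; apply: lifts1.
Qed.

(** As K is unramified, its values are integers, so that an element of positive
    order has order at least 1. *)
Lemma lifts0_oge1 x : lifts x 0 -> oge 1 x.
Proof.
case=> xK x0 /eqP; rewrite (unr_red_eq0 KP) // /ord_ge.
have [//|nz /= pos] := eqVneq x 0.
have [y [y0 xy]] := unr_value_group KP xK nz.
have := ord_Qp_int p_pr QpP y0; rewrite -xy => /intrP[k kE].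
move: pos; rewrite kE ltr0z => pos; rewrite -[1]/(1%:~R) ler_int; lia.
Qed.

Lemma exists_lift : exists T : Fq -> L, [/\ T 0 = 0, T 1 = 1 & forall c, lifts (T c) c].
Proof.
have /choice[T TP] (c : Fq) : exists x, lifts x c.
  by have [x [xK x0 xc]] := unr_red_surj KP c; exists x.
exists (fun c => if c == 0 then 0 else if c == 1 then 1 else T c).
split; rewrite ?eqxx ?oner_eq0 // => c.
case: eqP => [->|_]; first exact: lifts0.
by case: eqP => [->|_]; [exact: lifts1|exact: TP].
Qed.

Lemma lifts_kos n (c : 'I_n -> pseries n L) (d : 'I_n -> pseries n Fq) y z :
  (forall i u, lifts (c i u) (d i u)) -> lifts (kos c y z) (kos d y z).
Proof.
move=> cd; apply: lifts_sum => i _; apply: liftsM; first exact: lifts_sign.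
by case: ifP => _; [exact: cd|exact: lifts0].
Qed.

End Residues.


(** * The operators D_i commute *)

Lemma mpoly_ind_lin (R : nzRingType) n (P : {mpoly R[n]} -> Prop) :
  P 0 -> (forall g h, P g -> P h -> P (g + h)) ->
  (forall c u, P (c *: 'X_[u])) -> forall g, P g.
Proof.
by move=> P0 PD PX g; rewrite [g]mpolyE; apply: big_ind => // u _; apply: PX.
Qed.

Section Substitution.
Variables (R : comNzRingType) (n q : nat).
Local Notation powers := [tuple ('X_j : {mpoly R[n]}) ^+ q | j < n].

Lemma compX_powers u : 'X_[u] \mPo powers = 'X_[(u *+ q)%MM] :> {mpoly R[n]}.
Proof.
rewrite comp_mpolyX [RHS]mpolyXE_id; apply: eq_bigr => i _.
by rewrite tnth_mktuple mulmnE mulnC exprM.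
Qed.

Lemma comp_powers (g : {mpoly R[n]}) :
  g \mPo powers = \sum_(u <- msupp g) g@_u *: 'X_[(u *+ q)%MM].
Proof. by rewrite comp_mpolyEX; under eq_bigr do rewrite compX_powers. Qed.

(** Chain rule for the substitution of x_j^q for x_j. *)
Lemma deriv_powers i (g : {mpoly R[n]}) : (0 < q)%N ->
  (g \mPo powers)^`M(i) = q%:R *: ('X_i ^+ q.-1 * (g^`M(i) \mPo powers)).
Proof.
move=> q0; elim/mpoly_ind_lin: g => [|g h IHg IHh|c u].
- by rewrite !(raddf0, mderiv0) mulr0 scaler0.
- by rewrite !(raddfD, mderivD) /= IHg IHh mulrDr scalerDr.
rewrite !(mderivZ, comp_mpolyZ) -scalerAr scalerA mulrC -scalerA; congr (_ *: _).
rewrite compX_powers !mderivX comp_mpolyZ compX_powers -scalerAr scalerA -natrM.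
rewrite mulmnE mulnC; have [->|ui] := posnP (u i); first by rewrite muln0 !scale0r.
congr (_ *: _); rewrite mpolyXn -mpolyXD; congr ('X_[_]).
apply/mnmP => j; rewrite !(mnmBE, mnmDE, mulmnE, mnm1E).
case: eqVneq => [<-|_]; rewrite ?mul0n ?subn0 ?add0n //.
rewrite mul1n mulnBl mul1n -[nat_of_bool true]/1%N.
have : (q <= u i * q)%N by rewrite leq_pmull.
by move: (u i * q)%N q0; clear; lia.
Qed.

End Substitution.

Section Potential.
Variables (n p delta : nat) (Qp : fieldType) (L : fieldExtType Qp).
Variables (tau : 'End(L)) (gamma : L) (fhat : {mpoly L[n]}).
Hypothesis p_gt1 : (1 < p)%N.

Let tl (l : nat) : 'End(L) := iter l (comp_lfun tau) \1%VF.

Lemma iter_tauE l : iter l tau = tl l :> (L -> L).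
Proof.
apply/funext => x; elim: l => [|l IH]; first by rewrite /tl /= id_lfunE.
by rewrite /tl !iterS IH comp_lfunE.
Qed.

(** The terms of H_i are the partial derivatives of gamma_l Hpot_l. *)
Definition Hpot l : {mpoly L[n]} :=
  map_mpoly (iter l tau) fhat \mPo [tuple 'X_j ^+ (p ^ l) | j < n].

Lemma H_termE i l : H_term p tau gamma fhat i l = gamma_ p gamma l *: (Hpot l)^`M(i).
Proof.
rewrite /Hpot deriv_powers ?expn_gt0 ?(ltnW p_gt1) // scalerA natrX /H_term iter_tauE.
congr (_ *: (_ * (_ \mPo _))); apply/mpolyP => u.
by rewrite mcoeff_map_mpoly !mcoeff_deriv mcoeff_map_mpoly raddfMn.
Qed.

Lemma Hpot_neq0 l w : (Hpot l)@_w != 0 ->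
  exists v, [/\ w = (v *+ p ^ l)%MM, v \in msupp fhat & (Hpot l)@_w = iter l tau fhat@_v].
Proof.
rewrite /Hpot comp_powers raddf_sum /=.
under eq_bigr do rewrite mcoeffZ mcoeffX.
have inj v v' : (v *+ p ^ l)%MM = (v' *+ p ^ l)%MM -> v = v' :> 'X_{1..n}.
  move=> /mnmP h; apply/mnmP => j; have /eqP := h j.
  by rewrite !mulmnE eqn_pmul2r ?expn_gt0 ?(ltnW p_gt1) // => /eqP.
move=> /sum_neq0[v vF]; case: (eqVneq (v *+ p ^ l)%MM w) => [vw|_]; last by rewrite mulr0 eqxx.
move=> nz; exists v; split=> //.
  move: vF; rewrite !mcoeff_msupp iter_tauE mcoeff_map_mpoly; apply: contra_neq => ->.
  exact: raddf0.
rewrite (bigD1_seq v) ?msupp_uniq //= vw eqxx mulr1 big1 ?addr0 => [|v' v'v].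
  by rewrite iter_tauE mcoeff_map_mpoly.
case: eqP => [v'w|]; last by rewrite mulr0.
by case/eqP: v'v; apply: inj; rewrite vw v'w.
Qed.

Lemma H_term_neq0 i l w : (H_term p tau gamma fhat i l)@_w != 0 ->
  exists v, [/\ (w + U_(i) = v *+ p ^ l)%MM, v \in msupp fhat, (p ^ l <= (mdeg w).+1)%N &
    (H_term p tau gamma fhat i l)@_w =
      gamma_ p gamma l * p%:R ^+ l * (v i)%:R * iter l tau fhat@_v].
Proof.
rewrite H_termE mcoeffZ mcoeff_deriv mulf_eq0 negb_or => /andP[_ nz].
have nz' : (Hpot l)@_(w + U_(i)) != 0.
  by apply: contra_neq nz => ->; rewrite mul0rn.
have [v [wv vf ->]] := Hpot_neq0 nz'; exists v.
have wi : (w i).+1 = (v i * p ^ l)%N.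
  by have /mnmP/(_ i) := wv; rewrite mnmDE mnm1E eqxx addn1 mulmnE.
split=> //.
  have -> : (mdeg w).+1 = (mdeg v * p ^ l)%N.
    by rewrite -mdegMn -wv mdegD mdeg1 addn1.
  rewrite leq_pmull // (leq_trans _ (mnm_le_mdeg v i)) //.
  by rewrite lt0n; apply/eqP => v0; move: wi; rewrite v0.
by rewrite wi -[_ *+ (v i * _)]mulr_natl natrM natrX [_ * p%:R ^+ l]mulrC !mulrA.
Qed.

(** Only finitely many terms contribute to a coefficient, whence the polynomial
    potential [Vpot] for the coefficients of degree less than N. *)
Lemma H_term_small i l w : (mdeg w < l)%N -> (H_term p tau gamma fhat i l)@_w = 0.
Proof.
move=> wl; apply/eqP; apply: contraT => /H_term_neq0[v [_ _ h _]].
by have := ltn_expl l p_gt1; lia.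
Qed.

Definition Vpot N : {mpoly L[n]} := \sum_(l < N) gamma_ p gamma l *: Hpot l.

Lemma H_Vpot N i u : (mdeg u < N)%N -> H_ p tau gamma fhat i u = (Vpot N)^`M(i)@_u.
Proof.
move=> uN; rewrite /H_ /Vpot (raddf_sum (mderiv i)) raddf_sum /=.
under [RHS]eq_bigr do rewrite mderivZ -H_termE.
rewrite -!(big_mkord xpredT (fun l => (H_term p tau gamma fhat i l)@_u)).
rewrite [RHS](big_cat_nat (n := (mdeg u).+1)) //= [X in _ + X]big_nat [X in _ + X]big1 ?addr0 //.
by move=> l /andP[ul _]; apply: H_term_small.
Qed.

Definition theta i (xi : pseries n L) : pseries n L :=
  ps_deriv i xi + ps_mul (H_ p tau gamma fhat i) xi.

Lemma ps_derivE (i : 'I_n) (xi : pseries n L) u :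
  ps_deriv i xi u = (u i).+1%:R * xi (u + U_(i))%MM :> L.
Proof. by []. Qed.

Lemma theta_trunc N i xi (X : {mpoly L[n]}) :
  (forall u, (mdeg u < N.+1)%N -> xi u = X@_u) ->
  forall u, (mdeg u < N)%N -> theta i xi u = (X^`M(i) + (Vpot N)^`M(i) * X)@_u.
Proof.
move=> xiX u uN; rewrite mcoeffD mcoeff_deriv mcoeffM_ps; congr (_ + _).
  rewrite ps_derivE xiX ?mulr_natl // mdegD mdeg1 addn1 //.
apply: ps_mul_agree => v vu; first by apply: H_Vpot; apply: leq_ltn_trans uN.
by apply: xiX; apply: leq_ltn_trans vu (leqW uN).
Qed.

Lemma H_wide N N' i u : (mdeg u < N)%N -> (mdeg u < N')%N ->
  (Vpot N)^`M(i)@_u = (Vpot N')^`M(i)@_u.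
Proof. by move=> h h'; rewrite -!H_Vpot. Qed.

(** On coefficients of bounded degree the H_i are the partial derivatives of a
    polynomial V, and for polynomials the claim is the symmetry of the second
    derivatives of V and of xi. *)
Lemma thetaC i j xi : theta i (theta j xi) = theta j (theta i xi).
Proof.
suff h i' j' u : theta i' (theta j' xi) u =
    let N := (mdeg u).+3 in let X := trunc N xi in let V := Vpot N in
    (X^`M(j')^`M(i') + V^`M(j')^`M(i') * X + V^`M(j') * X^`M(i') + V^`M(i') * X^`M(j')
      + V^`M(i') * V^`M(j') * X)@_u.
  apply/funext => u; rewrite !h /=; set V := Vpot _; set X := trunc _ _.
  rewrite [X^`M(j)^`M(i)]mderiv_comm [V^`M(j)^`M(i)]mderiv_comm [V^`M(i) * V^`M(j)]mulrC.
  by congr mcoeff; rewrite -!addrA; do 2![congr (_ + _)]; rewrite addrCA.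
pose N := (mdeg u).+3; pose X := trunc N xi; pose V := Vpot N => /=.
have e1 v : (mdeg v < (mdeg u).+2)%N -> theta j' xi v = (X^`M(j') + V^`M(j') * X)@_v.
  move=> vN; rewrite (@theta_trunc (mdeg u).+2 j' xi X) //; last first.
    by move=> w wN; rewrite mcoeff_trunc.
  rewrite !mcoeffD !mcoeffM_ps; congr (_ + _); apply: ps_mul_agree => // w wv.
  by apply: H_wide; lia.
rewrite (@theta_trunc (mdeg u).+1 i' _ (X^`M(j') + V^`M(j') * X)) //.
rewrite -/X -/V [LHS](_ : _ = ((X^`M(j') + V^`M(j') * X)^`M(i') +
    V^`M(i') * (X^`M(j') + V^`M(j') * X))@_u); last first.
  rewrite !mcoeffD [in LHS]mcoeffM_ps [in RHS]mcoeffM_ps; congr (_ + _).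
  apply: ps_mul_agree => // w wu; apply: H_wide; lia.
by congr mcoeff; rewrite mderivD mderivM mulrDr !mulrA !addrA.
Qed.

End Potential.


(** * Size of the perturbation *)

Section Bounds.
Variables (p a n delta e : nat) (Fq : finFieldType) (f : {mpoly Fq[n]}) (b : rat).
Variables (Qp : fieldType) (L : fieldExtType Qp) (ord : L -> rat) (K : {subfield L}).
Variables (red : L -> Fq) (zeta : L) (tau : 'End(L)) (gamma : L) (M : nat) (pi : L).
Variable fhat : {mpoly L[n]}.
Hypothesis p_pr : prime p.
Hypothesis delta_gt0 : (0 < delta)%N.
Hypothesis f_delta : msize f = delta.+1.
Hypothesis e_gt0 : (0 < e)%N.
Hypothesis e_le : (e <= delta)%N.
Hypothesis b_gt : delta%:R / ((p%:R - 1) * (delta%:R - e%:R + 1)) < b.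
Hypothesis b_lt : b < p%:R * delta%:R / ((p%:R - 1) * delta%:R + e%:R - 1).
Hypothesis ds : dwork_setting p a delta b ord K red zeta tau gamma M pi.
Hypothesis fl : is_teichmuller_lift K red f fhat.
Local Notation oge := (ord_ge ord).
Let val := ds_valuation ds.
Let p_gt1 := prime_gt1 p_pr.
Local Notation lifts := (lifts ord K red).

Lemma rat_p_gt1 : 1 < p%:R :> rat. Proof. by rewrite ltr1n. Qed.
Lemma rat_delta_gt0 : 0 < delta%:R :> rat. Proof. by rewrite ltr0n. Qed.
Lemma rat_e_bounds : (1 <= e%:R :> rat) && (e%:R <= delta%:R :> rat).
Proof. by rewrite ler1n ler_nat e_gt0 e_le. Qed.

(** The two competing gains: that of the derivations d/dx_i, and that of the
    term l = 1 of H_i. *)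
Definition gain : rat := Num.min (b - 1 / (p%:R - 1)) (p%:R - (p%:R - 1) * b).
Definition slope : rat := b / delta%:R.
(** The terms l >= 1 of H_i raise weights by up to delta (p^l - 1), but they
    gain at least [growth] per unit of weight, over [slope]. *)
Definition growth : rat := (p%:R / (p%:R - 1) - b) / delta%:R.

Lemma slope_gt0 : 0 < slope.
Proof.
have P := rat_p_gt1; have D := rat_delta_gt0; have /andP[E1 E2] := rat_e_bounds.
rewrite /slope divr_gt0 //; apply: le_lt_trans b_gt.
by rewrite divr_ge0 ?mulr_ge0; lra.
Qed.

Lemma b_slopeE : b = slope * delta%:R.
Proof. by rewrite /slope mulfVK // gt_eqF // rat_delta_gt0. Qed.

(** Each of the two bounds on b is one of the two inequalities. *)
Lemma loss_lt_gain : slope * (e%:R - 1) < gain.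
Proof.
have P := rat_p_gt1; have D := rat_delta_gt0; have /andP[E1 E2] := rat_e_bounds.
rewrite /gain lt_min; apply/andP; split.
  have h : delta%:R < (slope * delta%:R) * ((p%:R - 1) * (delta%:R - e%:R + 1)).
    by rewrite -b_slopeE -ltr_pdivrMr // mulr_gt0 //; lra.
  have h' : 1 / (p%:R - 1) < slope * (delta%:R - e%:R + 1).
    by rewrite ltr_pdivrMr; [rewrite -(ltr_pM2l D); lra|lra].
  have := b_slopeE; lra.
have den : 0 < (p%:R - 1) * delta%:R + e%:R - 1 :> rat.
  have : 0 < (p%:R - 1) * delta%:R :> rat by rewrite mulr_gt0 //; lra.
  by lra.
have := b_lt; rewrite ltr_pdivlMr //.
rewrite b_slopeE => h.
have : slope * ((p%:R - 1) * delta%:R + e%:R - 1) < p%:R.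
  by rewrite -(ltr_pM2r D); lra.
by lra.
Qed.

(** A linear combination of the two inequalities in [loss_lt_gain] gives
    p * loss < p - 1. *)
Lemma loss_lt1 : slope * (e%:R - 1) < 1.
Proof.
have P := rat_p_gt1; have := loss_lt_gain; rewrite /gain lt_min => /andP[h1 h2].
have h3 : (p%:R - 1) * (slope * (e%:R - 1)) < (p%:R - 1) * b - 1.
  have -> : (p%:R - 1) * b - 1 = (p%:R - 1) * (b - 1 / (p%:R - 1)).
    by rewrite mulrBr [(p%:R - 1) * (1 / _)]mulrC divfK // gt_eqF //; lra.
  by rewrite ltr_pM2l //; lra.
set k := slope * _ in h2 h3 *.
have : p%:R * k < p%:R * 1 by lra.
by rewrite ltr_pM2l //; lra.
Qed.

Lemma growth_gt0 : 0 < growth.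
Proof.
have P := rat_p_gt1; have D := rat_delta_gt0; have /andP[E1 E2] := rat_e_bounds.
rewrite /growth divr_gt0 // subr_gt0 ltr_pdivlMr; last lra.
have := loss_lt_gain; rewrite /gain lt_min => /andP[_ h].
have : 0 <= slope * (e%:R - 1) by rewrite mulr_ge0 ?(ltW slope_gt0) //; lra.
by lra.
Qed.

Lemma q_gt1 : (1 < #|Fq|)%N.
Proof. exact: finNzRing_gt1. Qed.

Lemma fhat_oge0 u : oge 0 fhat@_u.
Proof. by have [_ h _] := fl u; apply: (oge_unit val q_gt1 h). Qed.

Lemma fhat_lifts u : lifts fhat@_u f@_u.
Proof. by have [h1 _ h3] := fl u; split=> //; apply: fhat_oge0. Qed.

(** A nonzero coefficient of the Teichmueller lifting is a root of unity, and
    reduces to a nonzero coefficient. *)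
Lemma fhat_supp u : fhat@_u != 0 -> (mdeg u <= delta)%N.
Proof.
move=> nz; have [h1 h2 h3] := fl u.
have fu : f@_u != 0.
  rewrite -h3 (unr_red_eq0 (ds_K ds)) ?fhat_oge0 // negb_or nz -leNgt.
  have o : ord fhat@_u * (#|Fq|%:R - 1) = 0.
    by have := ordX val #|Fq| nz; rewrite h2 => e1; lra.
  move/eqP: o; rewrite mulf_eq0 => /orP[/eqP->//|].
  by have : 1 < #|Fq|%:R :> rat; [rewrite ltr1n q_gt1|lra].
by move: fu; rewrite -mcoeff_msupp => /msize_mdeg_lt; rewrite f_delta.
Qed.

Definition chat (i : 'I_n) : pseries n L := fun u => fhat^`M(i)@_u.

Lemma chat_lifts i u : lifts (chat i u) (pcoef f i u).
Proof.
rewrite /chat /pcoef !mcoeff_deriv -mulr_natl -[in X in lifts _ X]mulr_natl.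
by apply: (liftsM val (ds_K ds)); [apply: (lifts_nat val (ds_K ds))|apply: fhat_lifts].
Qed.

Lemma chat_deg i u : chat i u != 0 -> (mdeg u <= delta.-1)%N.
Proof.
rewrite /chat mcoeff_deriv => nz.
have /fhat_supp : fhat@_(u + U_(i)) != 0.
  by apply: contra_neq nz => ->; rewrite mul0rn.
by rewrite mdegD mdeg1; lia.
Qed.

(** The automorphism tau permutes the roots of x^q = x. *)
Lemma iter_tau_oge u l : oge 0 (iter l tau fhat@_u).
Proof.
have [uK uq _] := fl u.
have /andP[/kHomP_tmp[hid hM] _] := ds_tau_aut ds.
have im : (tau @: <<K; zeta>> = <<K; zeta>>)%VS.
  by case/andP: (ds_tau_aut ds) => _ /eqP.
suff [xE xq] : iter l tau fhat@_u \in <<K; zeta>>%VS /\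
    iter l tau fhat@_u ^+ #|Fq| = iter l tau fhat@_u.
  exact: (oge_unit val q_gt1 xq).
elim: l => [|l [xE xq]] /=; first by split=> //; apply: subvP_adjoin.
split; first by rewrite -im memv_img.
rewrite -[in RHS]xq.
have tauX k x : x \in <<K; zeta>>%VS -> tau (x ^+ k) = tau x ^+ k.
  move=> xK; elim: k => [|k IH]; first by rewrite !expr0 hid ?mem1v.
  by rewrite !exprS hM ?rpredX // IH.
by rewrite tauX.
Qed.

(** As the complete series is zero, gamma_l is the opposite of its tail, whose
    terms have nondecreasing orders. *)
Lemma gamma_oge l : oge ((p ^ l.+1)%:R / (p%:R - 1) - l.+1%:R) (gamma_ p gamma l).
Proof.
have P := rat_p_gt1; pose h i : rat := (p ^ i)%:R / (p%:R - 1) - i%:R.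
have [pL0 ordp] := ord_p (ds_Qp ds).
(* The orders of the terms of the series increase by p^i - 1. *)
have hS i : h i <= h i.+1.
  have -> : h i.+1 = h i + ((p ^ i)%:R - 1).
    rewrite /h expnS natrM -[i.+1%:R]/((1 + i)%:R) natrD.
    have -> : p%:R * (p ^ i)%:R / (p%:R - 1) = (p ^ i)%:R / (p%:R - 1) + (p ^ i)%:R :> rat.
      by field; lra.
    by lra.
  by rewrite lerDl subr_ge0 ler1n expn_gt0 ltnW.
have hle i : h l.+1 <= h (l.+1 + i)%N.
  by elim: i => [|i IH]; rewrite ?addn0 // addnS (le_trans IH).
have term i : oge (h l.+1) (gamma ^+ (p ^ (l.+1 + i)) / p%:R ^+ (l.+1 + i)).
  apply: oge_le (hle i) _; apply: oge_ord.
  rewrite (ordM val) ?expf_neq0 ?invr_eq0 ?(ds_gamma_neq0 ds) // ?expf_neq0 //.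
  rewrite (ordV val) ?expf_neq0 // !(ordX val) ?(ds_gamma_neq0 ds) //.
  by rewrite (ds_gamma_ord ds) ordp mulr1 /h div1r.
have tail i : oge (h l.+1) (gamma_ p gamma (l + i) - gamma_ p gamma l).
  elim: i => [|i IH]; first by rewrite addn0 subrr oge0.
  by rewrite addnS /gamma_ big_ord_recr /= -addrA addrCA (ogeD val) // -addSn.
have [N hN] := ds_gamma_root ds (h l.+1).
have := hN (l + N)%N (leq_addl _ _); rewrite subr0 => gN.
by have := ogeB val gN (tail N); rewrite opprB addrC subrK.
Qed.

(** The substitution x -> x^(p^l) contributes the exponent p^l as a factor of the
    derivative; with the factor gamma_l this gives the bound. *)
Lemma H_term_oge i l u : oge ((p ^ l.+1)%:R / (p%:R - 1) - 1) (H_term p tau gamma fhat i l)@_u.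
Proof.
have [->|/(H_term_neq0 p_gt1)[v [_ _ _ ->]]] := eqVneq (H_term p tau gamma fhat i l)@_u 0.
  exact: oge0.
rewrite -[X in oge X _]addr0; apply: (ogeM val) (iter_tau_oge _ _).
rewrite -[X in oge X _]addr0; apply: (ogeM val) (oge_nat val _).
have -> : (p ^ l.+1)%:R / (p%:R - 1) - 1 = ((p ^ l.+1)%:R / (p%:R - 1) - l.+1%:R) + l%:R :> rat.
  by rewrite -[l.+1]add1n natrD; ring.
apply: (ogeM val); first exact: gamma_oge.
have pL : oge 1 p%:R by apply: oge_ord; rewrite (ord_p (ds_Qp ds)).2.
elim: l => [|l IH]; first by rewrite expr0 oge_ord // (ord1 val).
by rewrite exprS -[l.+1]add1n natrD; apply: (ogeM val).
Qed.

(** The terms l >= 1 of H_i, after division by gamma. *)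
Definition err_coef (i : 'I_n) : pseries n L :=
  fun u => gamma^-1 * H_ p tau gamma fhat i u - chat i u.

Lemma err_coefE i u : err_coef i u =
  \sum_(1 <= l < (mdeg u).+1) gamma^-1 * (H_term p tau gamma fhat i l)@_u.
Proof.
have e0 : gamma^-1 * (H_term p tau gamma fhat i 0)@_u = chat i u.
  rewrite (H_termE _ _ _ p_gt1) mcoeffZ /gamma_ big_ord_recl big_ord0 addr0 expn0 expr1 expr0 divr1.
  rewrite mulrA mulVf ?(ds_gamma_neq0 ds) // mul1r /chat; congr (mcoeff u); congr (_^`M(i)).
  apply/mpolyP => v; rewrite /Hpot expn0 comp_powers.
  under eq_bigr do rewrite mulm1n.
  by rewrite -mpolyE iter_tauE mcoeff_map_mpoly /= id_lfunE.
rewrite /err_coef /H_ -(big_mkord xpredT (fun l => (H_term p tau gamma fhat i l)@_u)).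
have key (h : nat -> L) (c g : L) N : g * h 0%N = c ->
    g * (\sum_(0 <= l < N.+1) h l) - c = \sum_(1 <= l < N.+1) g * h l.
  by move=> <-; rewrite big_ltn // mulrDr mulr_sumr addrC addKr.
exact: (key (fun l => (H_term p tau gamma fhat i l)@_u)).
Qed.

Lemma err_coef_oge i u (D := (mdeg u).+1%:R - delta%:R : rat) :
  oge (slope * D + Num.max gain (growth * D)) (err_coef i u).
Proof.
have P := rat_p_gt1; have P0 := delta_gt0; have D0 := rat_delta_gt0.
rewrite err_coefE big_nat; apply: (oge_sum val) => l /andP[l1 lu].
have [->|nz] := eqVneq (H_term p tau gamma fhat i l)@_u 0; first by rewrite mulr0 oge0.
have [v [uv vf _ _]] := H_term_neq0 p_gt1 nz.
have deg : (mdeg u).+1%:R <= (p ^ l)%:R * delta%:R :> rat.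
  rewrite -natrM ler_nat -[(mdeg u).+1]addn1 -(mdeg1 i) -mdegD uv mdegMn mulnC leq_mul2l.
  by rewrite fhat_supp ?orbT // -mcoeff_msupp.
have ql : p%:R <= (p ^ l)%:R :> rat by rewrite ler_nat -{1}(expn1 p) leq_exp2l.
apply: (@oge_le _ _ (- (1 / (p%:R - 1)) + ((p ^ l.+1)%:R / (p%:R - 1) - 1))); last first.
  apply: (ogeM val); last exact: H_term_oge.
  by apply: oge_ord; rewrite (ordV val) ?(ds_gamma_neq0 ds) // (ds_gamma_ord ds).
set q : rat := (p ^ l)%:R in deg ql *.
have -> : - (1 / (p%:R - 1)) + ((p ^ l.+1)%:R / (p%:R - 1) - 1) = p%:R / (p%:R - 1) * (q - 1).
  by rewrite expnS natrM -/q; field; lra.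
have Dq : D <= (q - 1) * delta%:R by rewrite /D; lra.
have bD : slope * D <= b * (q - 1).
  apply: le_trans (ler_wpM2l (ltW slope_gt0) Dq) _.
  by rewrite mulrCA mulrC -b_slopeE.
have gE : growth * delta%:R = p%:R / (p%:R - 1) - b by rewrite /growth mulfVK // gt_eqF.
have gD : growth * D <= (p%:R / (p%:R - 1) - b) * (q - 1).
  apply: le_trans (ler_wpM2l (ltW growth_gt0) Dq) _.
  by rewrite mulrCA mulrC gE.
have kap : gain <= (p%:R / (p%:R - 1) - b) * (q - 1).
  have k1 : gain <= p%:R - (p%:R - 1) * b by rewrite ge_min lexx orbT.
  apply: le_trans k1 _; have g0 : 0 < p%:R / (p%:R - 1) - b by rewrite -gE mulr_gt0 ?growth_gt0.
  have -> : p%:R - (p%:R - 1) * b = (p%:R / (p%:R - 1) - b) * (p%:R - 1).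
    by field; lra.
  by rewrite ler_pM2l //; lra.
have m : Num.max gain (growth * D) <= (p%:R / (p%:R - 1) - b) * (q - 1).
  by rewrite ge_max kap gD.
by apply: le_trans (lerD bD m) _; rewrite -mulrDl addrC subrK.
Qed.

Local Notation wtr x := ((weight delta.-1 x)%:R : rat).

(** D divided by pi^epsilon gamma, which makes its leading term phi. *)
Definition normD (w : forms n (pseries n L)) : forms n (pseries n L) :=
  koszul (fun i xi => gamma^-1 *: theta p tau gamma fhat i xi) w.

Definition Err w := normD w - phic chat w.

Definition Ebound (t : rat) := slope * t + Num.max gain (growth * t).

Lemma wt_setD1 d (J : {set 'I_n}) i u : i \in J ->
  weight d ((J :\ i)%SET, u) = (mdeg u + (n - #|J|) * d + d)%N.
Proof.
move=> iJ; rewrite /weight /= -addnA -mulSnr; congr (_ + _ * _)%N.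
have := max_card (mem J); rewrite card_ord.
by rewrite (cardsD1 i J) iJ add1n => /subnSK.
Qed.

(** A coefficient of err w at z receives contributions of the coefficients of w
    at y; the one at y gains [gain] over the slope, and also [growth] times
    the increase of the weight, so that only finitely many y matter for a
    given precision. *)
Lemma Err_oge (w : forms n (pseries n L)) (z : idx n) r :
  (forall y : idx n, oge (r - Ebound (wtr z - wtr y)) (w y.1 y.2)) ->
  oge r (Err w z.1 z.2).
Proof.
have P := rat_p_gt1; have P0 := delta_gt0; have D0 := rat_delta_gt0.
case: z => J v /= h.
have -> : Err w J v = \sum_(i in J) ksign L i J *
    (gamma^-1 * ps_deriv i (w (J :\ i)%SET) v + ps_mul (err_coef i) (w (J :\ i)%SET) v).
  rewrite /Err /normD /phic !ffunE fctE /= !fct_sumE -sumrB; apply: eq_bigr => i _.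
  rewrite -[LHS]mulrBr; congr (_ * _).
  rewrite -[X in X - _]/(gamma^-1 * (ps_deriv i _ v + ps_mul _ _ v)) mulrDr -addrA.
  congr (_ + _); rewrite /ps_mul mulr_sumr -sumrB; apply: eq_bigr => u _.
  by rewrite /err_coef mulrBl mulrA.
apply: (oge_sum val) => i iJ; apply: (oge_signM val); apply: (ogeD val).
  have := h ((J :\ i)%SET, (v + U_(i))%MM).
  have -> : wtr (J, v) - wtr ((J :\ i)%SET, (v + U_(i))%MM) = - delta%:R.
    rewrite wt_setD1 // mdegD mdeg1 -[delta in RHS]prednK // /weight /= -!natr1 !natrD; ring.
  move=> hy; have e1 : Ebound (- delta%:R) <= - (1 / (p%:R - 1)).
    rewrite /Ebound !mulrN -b_slopeE /growth mulfVK ?gt_eqF //.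
    have k1 : gain <= b - 1 / (p%:R - 1) by rewrite ge_min lexx.
    have m : Num.max gain (- (p%:R / (p%:R - 1) - b)) <= b - 1 / (p%:R - 1).
      rewrite ge_max k1 opprB lerD2l lerN2 ler_pM2r ?invr_gt0 //; lra.
    by lra.
  apply: (@oge_le _ _ (- (1 / (p%:R - 1)) + (r - Ebound (- delta%:R)))); first by lra.
  apply: (ogeM val); last exact: (oge_natM val).
  by apply: oge_ord; rewrite (ordV val) ?(ds_gamma_neq0 ds) // (ds_gamma_ord ds).
apply: (oge_sum val) => u uv.
have := h ((J :\ i)%SET, (v - u)%MM).
have -> : wtr (J, v) - wtr ((J :\ i)%SET, (v - u)%MM) = (mdeg u).+1%:R - delta%:R.
  rewrite wt_setD1 // /weight /= -{1}(submK uv) mdegD.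
  rewrite -[delta in RHS]prednK // -!natr1 !natrD; ring.
move=> hy; have -> : r = Ebound ((mdeg u).+1%:R - delta%:R) +
    (r - Ebound ((mdeg u).+1%:R - delta%:R)).
  by rewrite addrC subrK.
by apply: (ogeM val) => //; apply: err_coef_oge.
Qed.

End Bounds.


(** * Perturbed Koszul complexes *)

Definition loss (e : nat) (beta : rat) : rat := beta * (e%:R - 1).

(** The properties of the normalized operator of Dwork that the homotopy argument
    relies on. The last one makes D - phi an operator that gains kappa over the
    slope beta, and grow per unit of weight. *)
Record perturbed_koszul (n d e : nat) (L : fieldType) (ord : L -> rat)
    (beta kappa grow : rat) (c : 'I_n -> pseries n L)
    (D : forms n (pseries n L) -> forms n (pseries n L)) : Prop := {
  pk_val : is_valuation ord;
  pk_complete : forall u : nat -> L, is_cauchy ord u -> exists x, tends_to ord u x;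
  pk_e_gt0 : (0 < e)%N;
  pk_beta_gt0 : 0 < beta;
  pk_grow_gt0 : 0 < grow;
  pk_loss_kappa : loss e beta < kappa;
  pk_loss1 : loss e beta < 1;
  pk_c_deg : forall i u, c i u != 0 -> (mdeg u <= d)%N;
  pk_c_int : forall i u, ord_ge ord 0 (c i u);
  pk_linear : linear D;
  pk_sq0 : forall w, D (D w) = 0;
  pk_supp : forall (w : forms n (pseries n L)) (J : {set 'I_n}),
    (forall i : 'I_n, i \in J -> w (J :\ i)%SET = 0) -> D w J = 0;
  pk_err : forall (w : forms n (pseries n L)) (z : idx n) r,
    (forall y : idx n, let t := (weight d z)%:R - (weight d y)%:R in
      ord_ge ord (r - (beta * t + Num.max kappa (grow * t))) (ev w y)) ->
    ord_ge ord r (ev (D w - phic c w) z)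
}.

Section Homotopy.
Variables (n d e : nat) (L : fieldType) (ord : L -> rat).
Variables (beta kappa grow : rat) (c : 'I_n -> pseries n L).
Local Notation idx := (idx n).
Local Notation Omega := (forms n (pseries n L)).
Variable D : Omega -> Omega.
Local Notation oge := (ord_ge ord).
Local Notation wt := (weight d).
Local Notation wtr x := ((wt x)%:R : rat).
Local Notation kc := (kos c).
Local Notation phic := (phic c).
Local Notation loss := (loss e beta).

Hypothesis X : perturbed_koszul d e ord beta kappa grow c D.
Let val := pk_val X.
Let complete := pk_complete X.
Let e_gt0 := pk_e_gt0 X.
Let beta_gt0 := pk_beta_gt0 X.
Let grow_gt0 := pk_grow_gt0 X.
Let loss_kappa := pk_loss_kappa X.
Let loss1 := pk_loss1 X.
Let c_deg := pk_c_deg X.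
Let c_int := pk_c_int X.
Let D_linear := pk_linear X.
Let D_sq0 := pk_sq0 X.
Let D_supp := pk_supp X.
Definition err (w : Omega) : Omega := D w - phic w.
Let err_oge := pk_err X.

Lemma evB (u w : Omega) x : ev (u - w) x = ev u x - ev w x.
Proof. by rewrite /ev !ffunE. Qed.

Lemma ev_ext (u w : Omega) : (forall x, ev u x = ev w x) -> u = w.
Proof. by move=> h; apply/ffunP => I; apply/funext => v; apply: (h (I, v)). Qed.

Lemma DB u w : D (u - w) = D u - D w.
Proof. by rewrite -[u - w]addrC -[- w]scaleN1r D_linear scaleN1r addrC. Qed.

(** The gain of one step of the iteration: 1 - loss for multiples of p, beta for a
    drop of the weight by one, kappa - loss for the perturbation. *)
Definition eta : rat := Num.min (1 - loss) (Num.min beta (kappa - loss)).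

Lemma eta_gt0 : 0 < eta.
Proof. by rewrite /eta !lt_min beta_gt0 !subr_gt0 loss1. Qed.
Lemma eta_le1 : eta <= 1 - loss. Proof. by rewrite /eta ge_min lexx. Qed.
Lemma eta_le_beta : eta <= beta. Proof. by rewrite /eta !ge_min lexx orbT. Qed.
Lemma eta_le_kappa : eta <= kappa - loss. Proof. by rewrite /eta !ge_min lexx !orbT. Qed.

Lemma loss_ge0 : 0 <= loss.
Proof. by rewrite /loss mulr_ge0 ?(ltW beta_gt0) // subr_ge0 ler1n. Qed.

Lemma kappa_gt0 : 0 < kappa. Proof. exact: le_lt_trans loss_ge0 loss_kappa. Qed.

(** The form w has size at least r. *)
Definition nge (r : rat) (w : Omega) := forall x : idx, oge (r + beta * wtr x) (ev w x).

Lemma nge_le r s w : s <= r -> nge r w -> nge s w.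
Proof. by move=> sr h x; apply: oge_le (h x); rewrite lerD2r. Qed.

Lemma ngeB r u w : nge r u -> nge r w -> nge r (u - w).
Proof. by move=> h k x; rewrite evB; apply: (ogeB val). Qed.

Lemma ngeBC r u w : nge r (u - w) -> nge r w -> nge r u.
Proof. by move=> h k x; rewrite -(subrK (ev w x) (ev u x)) -evB; apply: (ogeD val). Qed.

Lemma nge0 r : nge r 0.
Proof. by move=> x; rewrite /ev ffunE oge0. Qed.

Lemma phic_kos w z N : (mdeg z.2 < N)%N ->
  ev (phic w) z = \sum_(y <- box n N) ev w y * kc y z.
Proof. by case: z => J v vN; apply: koszul_kos. Qed.

Lemma kc_wt y z : kc y z != 0 -> (wt z <= wt y)%N.
Proof. by apply: kos_wt. Qed.

Lemma kc_int y z : oge 0 (kc y z).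
Proof.
apply: (oge_sum val) => i _; apply: (oge_signM val).
by case: ifP => _; rewrite ?c_int ?oge0.
Qed.

Lemma ler_wt (m k : nat) : (m <= k)%N -> beta * m%:R <= beta * k%:R.
Proof. by move=> h; rewrite ler_pM2l // ler_nat. Qed.

Lemma nge_phic r w : nge r w -> nge r (phic w).
Proof.
move=> h z; rewrite (phic_kos _ (ltnSn _)); apply: (oge_sum val) => y _.
have [->|/kc_wt yz] := eqVneq (kc y z) 0; first by rewrite mulr0 oge0.
rewrite -[X in oge X _]addr0; apply: (ogeM val) (kc_int _ _).
by apply: oge_le (h y); rewrite lerD2l ler_wt.
Qed.

Lemma nge_err r w : nge r w -> nge (r + kappa) (err w).
Proof.
move=> h z; apply: err_oge => y; apply: oge_le (h y).
have : kappa <= Num.max kappa (grow * (wtr z - wtr y)) by rewrite le_max lexx.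
by lra.
Qed.

Lemma D_err w : D w = phic w + err w.
Proof. by rewrite /err addrC subrK. Qed.

Lemma nge_D r w : nge r w -> nge r (D w).
Proof.
move=> h; apply: (@ngeBC _ _ (phic w)); last exact: nge_phic.
by apply: nge_le (nge_err h); rewrite lerDl ltW ?kappa_gt0.
Qed.

(** The operator with matrix k; the sum is large enough for the matrices that
    change weights by at most e. *)
Definition apply_kernel (k : idx -> idx -> L) (w : Omega) : Omega :=
  [ffun J => fun v => \sum_(x <- box n (wt (J, v) + e).+1) ev w x * k x (J, v)].

Definition band (k : idx -> idx -> L) := forall x z, k x z != 0 -> (wt x <= wt z + e)%N.

Lemma apply_kernelE k w z N : band k -> (wt z + e < N)%N ->
  ev (apply_kernel k w) z = \sum_(x <- box n N) ev w x * k x z.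
Proof.
move=> kb zN; case: z zN => J v zN; rewrite {1}/ev ffunE.
rewrite (sum_box_widen zN) // => x xN.
have [->|/kb h] := eqVneq (k x (J, v)) 0; first by rewrite mulr0.
by have := leq_wt d x; lia.
Qed.

Lemma apply_kernelB k u w : band k -> apply_kernel k (u - w) = apply_kernel k u - apply_kernel k w.
Proof.
move=> kb; apply: ev_ext => z; rewrite evB !(apply_kernelE _ kb (ltnSn _)) -sumrB.
by apply: eq_bigr => x _; rewrite evB mulrBl.
Qed.

Lemma nge_op k r s w : (forall x z, oge 0 (k x z)) ->
  (forall x z, k x z != 0 -> beta * wtr z - s <= beta * wtr x) ->
  nge r w -> nge (r - s) (apply_kernel k w).
Proof.
move=> kint kb h [J v]; rewrite /ev ffunE; apply: (oge_sum val) => x _.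
have [->|/kb xz] := eqVneq (k x (J, v)) 0; first by rewrite mulr0 oge0.
rewrite -[X in oge X _]addr0; apply: (ogeM val) => //.
by apply: oge_le (h x); lra.
Qed.

(** Integral matrices that satisfy the identities of [kernels] modulo p. The
    proposition E stands for the vanishing that gives G. *)
Record homotopy (m : nat) (E : Prop) (U : pred idx) (S P Q G : idx -> idx -> L) : Prop := {
  hS : forall x y, S x y != 0 ->
    #|x.1| = m /\ #|y.1|.+1 = m /\ (wt x <= wt y < wt x + e)%N;
  hP : forall x z, P x z != 0 -> #|x.1| = m /\ #|z.1| = m /\ wt x = wt z /\ U z;
  hQ : forall x z, Q x z != 0 ->
    #|x.1| = m /\ #|z.1| = m /\ (wt z < wt x < wt z + e)%N;
  hG : forall y z, G y z != 0 ->
    #|y.1| = m.+1 /\ #|z.1| = m /\ (wt y <= wt z < wt y + e)%N;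
  hint : forall x y, [/\ oge 0 (S x y), oge 0 (P x y), oge 0 (Q x y) & oge 0 (G x y)];
  hI1 : forall N (x z : idx), (wt x + e < N)%N -> #|x.1| = m -> #|z.1| = m ->
    (wt x <= wt z)%N ->
    oge 1 ((x == z)%:R - \sum_(y <- box n N) S x y * kc y z - P x z);
  hI2 : forall N (y z : idx), (wt z + e < N)%N -> #|y.1|.+1 = m -> #|z.1| = m ->
    (wt z <= wt y < wt z + e)%N ->
    oge 1 (\sum_(x <- box n N) kc y x * P x z - \sum_(x <- box n N) kc y x * Q x z);
  hI3 : E -> forall N (x z : idx), (wt z + e < N)%N ->
    #|x.1| = m -> #|z.1| = m -> (wt x <= wt z < wt x + e)%N ->
    oge 1 (P x z - \sum_(y <- box n N) kc x y * G y z);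
  hU : forall x : idx, U x -> #|x.1| = m;
  hI4 : forall x z : idx, U x -> #|z.1| = m -> P x z = (x == z)%:R
}.

Section Kernels.
Variables (m : nat) (E : Prop) (U : pred idx) (S P Q G : idx -> idx -> L).
Hypothesis H : homotopy m E U S P Q G.

Lemma S_int x y : oge 0 (S x y). Proof. by have [] := hint H x y. Qed.
Lemma P_int x y : oge 0 (P x y). Proof. by have [] := hint H x y. Qed.
Lemma Q_int x y : oge 0 (Q x y). Proof. by have [] := hint H x y. Qed.
Lemma G_int x y : oge 0 (G x y). Proof. by have [] := hint H x y. Qed.

Lemma bandS : band S. Proof. by move=> x y /(hS H)[_ [_ h]]; lia. Qed.
Lemma bandP : band P. Proof. by move=> x y /(hP H)[_ [_ [h _]]]; lia. Qed.
Lemma bandQ : band Q. Proof. by move=> x y /(hQ H)[_ [_ h]]; lia. Qed.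
Lemma bandG : band G. Proof. by move=> x y /(hG H)[_ [_ h]]; lia. Qed.

Lemma loss_wt (x z : idx) : (wt z < wt x + e)%N -> beta * wtr z - loss <= beta * wtr x.
Proof.
move=> h; have : wtr z + 1 <= wtr x + e%:R by rewrite natr1 -natrD ler_nat.
by rewrite -(ler_pM2l beta_gt0) /loss; lra.
Qed.

Lemma nge_S r w : nge r w -> nge (r - loss) (apply_kernel S w).
Proof. by apply: nge_op S_int _ => x z /(hS H)[_ [_ h]]; apply: loss_wt; lia. Qed.

Lemma nge_G r w : nge r w -> nge (r - loss) (apply_kernel G w).
Proof. by apply: nge_op G_int _ => x z /(hG H)[_ [_ h]]; apply: loss_wt; lia. Qed.

Lemma nge_P r w : nge r w -> nge r (apply_kernel P w).
Proof.
rewrite -[X in _ -> nge X _]subr0; apply: nge_op P_int _ => x z /(hP H)[_ [_ [h _]]].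
by rewrite h subr0.
Qed.

Lemma nge_Q r w : nge r w -> nge r (apply_kernel Q w).
Proof.
rewrite -[X in _ -> nge X _]subr0; apply: nge_op Q_int _ => x z /(hQ H)[_ [_ h]].
by rewrite subr0 ler_wt //; lia.
Qed.

Definition is_deg (k : nat) (w : Omega) : Prop := forall x : idx, #|x.1| != k -> ev w x = 0.

Lemma is_deg_eq k w x : is_deg k w -> ev w x != 0 -> #|x.1| = k.
Proof. by move=> h nz; apply/eqP; apply: contraNT nz => /h ->. Qed.

Lemma is_degB k u w : is_deg k u -> is_deg k w -> is_deg k (u - w).
Proof. by move=> h h' x xk; rewrite evB h ?h' ?subrr. Qed.

Lemma is_deg_opP w : is_deg m (apply_kernel P w).
Proof.
move=> [J v] zm; rewrite /ev ffunE big1 // => x _.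
have [->|/(hP H)[_ [h _]]] := eqVneq (P x (J, v)) 0; first by rewrite mulr0.
by rewrite h eqxx in zm.
Qed.

Lemma is_deg_opS w (x : idx) : #|x.1|.+1 != m -> ev (apply_kernel S w) x = 0.
Proof.
case: x => J v zm; rewrite /ev ffunE big1 // => x _.
have [->|/(hS H)[_ [h _]]] := eqVneq (S x (J, v)) 0; first by rewrite mulr0.
by rewrite h eqxx in zm.
Qed.

Lemma is_deg_DS w : is_deg m (D (apply_kernel S w)).
Proof.
move=> [J v] Jm; rewrite /ev D_supp // => i iJ; apply/funext => u.
apply: (@is_deg_opS w ((J :\ i)%SET, u)).
by move: Jm; rewrite /= (cardsD1 i J) iJ add1n.
Qed.

Lemma phic_op k w z N : band k -> (mdeg z.2 + n * d + e < N)%N ->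
  ev (phic (apply_kernel k w)) z =
  \sum_(x <- box n N) ev w x * \sum_(y <- box n N) k x y * kc y z.
Proof.
move=> kb zN.
have zN' : (mdeg z.2 < N)%N by apply: leq_ltn_trans zN; rewrite -addnA leq_addr.
rewrite (phic_kos _ zN').
under [RHS]eq_bigr do rewrite mulr_sumr.
rewrite exchange_big; apply: eq_bigr => y _ /=.
have [->|nz] := eqVneq (kc y z) 0.
  by rewrite mulr0 big1 // => x _; rewrite mulr0 mulr0.
have yN : (wt y + e < N)%N.
  apply: leq_ltn_trans zN; rewrite leq_add2r /weight leq_add //; first exact: kos_mdeg nz.
  by rewrite leq_mul2r leq_subr orbT.
rewrite (apply_kernelE _ kb yN) mulr_suml; apply: eq_bigr => x _.
by rewrite mulrA.
Qed.

Lemma op_phic k w z N : band k -> (wt z + e < N)%N ->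
  ev (apply_kernel k (phic w)) z =
  \sum_(x <- box n N) ev w x * \sum_(y <- box n N) kc x y * k y z.
Proof.
move=> kb zN; rewrite (apply_kernelE _ kb zN) !big_seq.
under [RHS]eq_bigr do rewrite mulr_sumr big_seq.
rewrite exchange_big; apply: eq_bigr => y; rewrite mem_box => yN.
rewrite (phic_kos _ yN) mulr_suml big_seq; apply: eq_bigr => x _.
by rewrite mulrA.
Qed.

(** At z, the coefficient of w at x contributes a multiple of p if x has weight
    at most that of z, by the first identity; there the multiple of p pays
    for the weight lost, which is less than e. If x has larger weight, the
    slope gives at least beta. *)
Lemma nge_step r w : is_deg m w -> nge r w ->
  nge (r + eta) (w - phic (apply_kernel S w) - apply_kernel P w).
Proof.
move=> wm h z.
have [zm|zm] := eqVneq #|z.1| m; last first.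
  rewrite !evB wm // is_deg_opP // sub0r subr0 (ogeN val).
  rewrite (phic_kos _ (ltnSn _)) big1 ?oge0 // => y _.
  have [->|nz] := eqVneq (kc y z) 0; first by rewrite mulr0.
  by rewrite is_deg_opS ?mul0r // -(kos_card nz).
pose N := (mdeg z.2 + n * d + e + wt z + e).+1.
have zN : (mdeg z.2 < N)%N by rewrite /N; lia.
have zN2 : (mdeg z.2 + n * d + e < N)%N by rewrite /N; lia.
have zN3 : (wt z + e < N)%N by rewrite /N; lia.
rewrite !evB (phic_op _ bandS zN2) (apply_kernelE _ bandP zN3).
have -> : ev w z = \sum_(x <- box n N) ev w x * (x == z)%:R.
  rewrite (sum_box1 (x := z)) ?eqxx ?mulr1 // => x /negbTE ->.
  by rewrite mulr0.
rewrite -!sumrB; apply: (oge_sum_seq val) => x; rewrite mem_box => xN.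
rewrite -!mulrBr.
have [->|nz] := eqVneq (ev w x) 0; first by rewrite mul0r oge0.
have xm := is_deg_eq wm nz.
have [xz|zx] := leqP (wt x) (wt z); last first.
  apply: (@oge_le _ _ (r + beta * wtr x + 0)).
    have : beta * (wtr z + 1) <= beta * wtr x by rewrite ler_pM2l // natr1 ler_nat.
    by have := eta_le_beta; lra.
  apply: (ogeM val) => //; apply: (ogeB val); last exact: P_int.
  apply: (ogeB val); first exact: (oge_nat val).
  apply: (oge_sum val) => y _; rewrite -[0]addr0.
  by apply: (ogeM val); [exact: S_int|exact: kc_int].
have [zxe|xez] := ltnP (wt z) (wt x + e).
  apply: (@oge_le _ _ (r + beta * wtr x + 1)).
    by have := eta_le1; have := loss_wt zxe; lra.
  by apply: (ogeM val) => //; apply: (hI1 H) => //; rewrite /N; lia.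
rewrite [_ - P x z](_ : _ = 0) ?mulr0 ?oge0 //.
have -> : (x == z) = false by apply/eqP => xz'; move: xez; rewrite xz'; lia.
have [->|/(hP H)[_ [_ [h' _]]]] := eqVneq (P x z) 0; last by lia.
rewrite big1 ?subr0 // => y _.
have [->|/(hS H)[_ [_ h1]]] := eqVneq (S x y) 0; first by rewrite mul0r.
have [->|/kc_wt h2] := eqVneq (kc y z) 0; first by rewrite mulr0.
by lia.
Qed.

(** As in [nge_step], with the third identity. *)
Lemma nge_exact r w : E -> is_deg m w -> nge r w ->
  nge (r + eta) (apply_kernel P w - apply_kernel G (phic w)).
Proof.
move=> HE wm h z; pose N := (wt z + e).+1.
have zN : (wt z + e < N)%N by [].
rewrite evB (apply_kernelE _ bandP zN) (op_phic _ bandG zN) -sumrB.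
apply: (oge_sum_seq val) => x; rewrite mem_box => xN; rewrite -mulrBr.
have [->|nz] := eqVneq (ev w x) 0; first by rewrite mul0r oge0.
have xm := is_deg_eq wm nz.
have [zm|zm] := eqVneq #|z.1| m; last first.
  rewrite [P x z - _](_ : _ = 0) ?mulr0 ?oge0 //.
  have [->|/(hP H)[_ [h' _]]] := eqVneq (P x z) 0; last by rewrite h' eqxx in zm.
  rewrite big1 ?subrr // => y _.
  have [->|/(hG H)[_ [h' _]]] := eqVneq (G y z) 0; first by rewrite mulr0.
  by rewrite h' eqxx in zm.
have [xz|zx] := leqP (wt x) (wt z); last first.
  apply: (@oge_le _ _ (r + beta * wtr x + 0)).
    have : beta * (wtr z + 1) <= beta * wtr x by rewrite ler_pM2l // natr1 ler_nat.
    by have := eta_le_beta; lra.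
  apply: (ogeM val) => //; apply: (ogeB val); first exact: P_int.
  apply: (oge_sum val) => y _; rewrite -[0]addr0.
  by apply: (ogeM val); [exact: kc_int|exact: G_int].
have [zxe|xez] := ltnP (wt z) (wt x + e).
  apply: (@oge_le _ _ (r + beta * wtr x + 1)).
    by have := eta_le1; have := loss_wt zxe; lra.
  by apply: (ogeM val) => //; apply: (hI3 H) => //; rewrite xz.
rewrite [P x z - _](_ : _ = 0) ?mulr0 ?oge0 //.
have [->|/(hP H)[_ [_ [h' _]]]] := eqVneq (P x z) 0; last by lia.
rewrite big1 ?subrr // => y _.
have [->|/(hG H)[_ [_ h1]]] := eqVneq (G y z) 0; first by rewrite mulr0.
have [->|/kc_wt h2] := eqVneq (kc x y) 0; first by rewrite mul0r.
by lia.
Qed.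

Lemma nge_homotopy r w : is_deg m w -> nge r w ->
  nge (r + eta) (w - D (apply_kernel S w) - apply_kernel P w).
Proof.
move=> wm h; have -> : w - D (apply_kernel S w) - apply_kernel P w =
    (w - phic (apply_kernel S w) - apply_kernel P w) - err (apply_kernel S w).
  by rewrite D_err opprD addrA [LHS]addrAC.
apply: ngeB; first exact: nge_step.
apply: nge_le (nge_err (nge_S h)).
by have := eta_le_kappa; lra.
Qed.

(** P w is G D w up to larger terms, and G D w loses at most [loss]. *)
Lemma nge_homotopy_exact r r' w : E -> is_deg m w -> nge r w -> nge r' (D w) ->
  nge (Num.min (r + eta) (r' - loss)) (w - D (apply_kernel S w)).
Proof.
move=> HE wm h h'.
have e1 : nge (r + eta) (apply_kernel P w - apply_kernel G (D w)).
  apply: (@ngeBC _ _ (apply_kernel P w - apply_kernel G (phic w))); last exact: nge_exact.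
  have -> : apply_kernel P w - apply_kernel G (D w) -
      (apply_kernel P w - apply_kernel G (phic w)) = 0 - apply_kernel G (err w).
    by rewrite [RHS]sub0r /err (apply_kernelB _ _ bandG) !opprB addrC addrA subrK.
  apply: ngeB; first exact: nge0.
  by apply: nge_le (nge_G (nge_err h)); have := eta_le_kappa; lra.
apply: (@ngeBC _ _ (apply_kernel P w)).
  by apply: nge_le (nge_homotopy wm h); rewrite ge_min lexx.
apply: (@ngeBC _ _ (apply_kernel G (D w))); first by apply: nge_le e1; rewrite ge_min lexx.
by apply: nge_le (nge_G h'); rewrite ge_min lexx orbT.
Qed.

(** By the second identity P phi xi and Q phi xi agree up to larger terms, even
    though xi may be as small as r - loss: multiples of p and weights at
    least e higher make up for it. Q raises the size of D xi, because it only
    uses coefficients of strictly larger weight. *)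
Lemma nge_boundary r xi : (forall x : idx, #|x.1|.+1 != m -> ev xi x = 0) ->
  nge (r - loss) xi -> nge r (D xi) -> nge (r + eta) (apply_kernel P (D xi)).
Proof.
move=> xim h h'.
have e1 : nge (r + eta) (apply_kernel P (phic xi) - apply_kernel Q (phic xi)).
  move=> z; pose N := (wt z + e).+1.
  have zN : (wt z + e < N)%N by [].
  rewrite evB (op_phic _ bandP zN) (op_phic _ bandQ zN) -sumrB.
  apply: (oge_sum_seq val) => y; rewrite mem_box => yN; rewrite -mulrBr.
  have [->|nz] := eqVneq (ev xi y) 0; first by rewrite mul0r oge0.
  have ym : #|y.1|.+1 = m by apply/eqP; apply: contraNT nz => /xim ->.
  have [zm|zm] := eqVneq #|z.1| m; last first.
    rewrite !big1 ?subrr ?mulr0 ?oge0 // => x _.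
      have [->|/(hQ H)[_ [h1 _]]] := eqVneq (Q x z) 0; first by rewrite mulr0.
      by rewrite h1 eqxx in zm.
    have [->|/(hP H)[_ [h1 _]]] := eqVneq (P x z) 0; first by rewrite mulr0.
    by rewrite h1 eqxx in zm.
  have [zy|yz] := leqP (wt z) (wt y); last first.
    rewrite !big1 ?subrr ?mulr0 ?oge0 // => x _.
      have [->|/kc_wt h2] := eqVneq (kc y x) 0; first by rewrite mul0r.
      have [->|/(hQ H)[_ [_ h1]]] := eqVneq (Q x z) 0; first by rewrite mulr0.
      by lia.
    have [->|/kc_wt h2] := eqVneq (kc y x) 0; first by rewrite mul0r.
    have [->|/(hP H)[_ [_ [h1 _]]]] := eqVneq (P x z) 0; first by rewrite mulr0.
    by lia.
  have [yze|zey] := ltnP (wt y) (wt z + e).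
    apply: (@oge_le _ _ (r - loss + beta * wtr y + 1)).
      by have := eta_le1; have := ler_wt zy; lra.
    by apply: (ogeM val) => //; apply: (hI2 H) => //; rewrite zy.
  apply: (@oge_le _ _ (r - loss + beta * wtr y + 0)).
    have : beta * (wtr z + e%:R) <= beta * wtr y by rewrite ler_pM2l // -natrD ler_nat.
    by have := eta_le_beta; rewrite /loss; lra.
  apply: (ogeM val) => //; apply: (ogeB val); apply: (oge_sum val) => x _; rewrite -[0]addr0.
    by apply: (ogeM val); [exact: kc_int|exact: P_int].
  by apply: (ogeM val); [exact: kc_int|exact: Q_int].
have e2 : nge (r + eta) (apply_kernel Q (D xi)).
  move=> z; rewrite (apply_kernelE _ bandQ (ltnSn _)); apply: (oge_sum val) => x _.
  have [->|/(hQ H)[_ [_ h1]]] := eqVneq (Q x z) 0; first by rewrite mulr0 oge0.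
  rewrite -[X in oge X _]addr0; apply: (ogeM val); last exact: Q_int.
  apply: oge_le (h' x).
  have : beta * (wtr z + 1) <= beta * wtr x by rewrite ler_pM2l // natr1 ler_nat; lia.
  by have := eta_le_beta; lra.
have op_err k : band k ->
    apply_kernel k (phic xi) = apply_kernel k (D xi) - apply_kernel k (err xi).
  by move=> kb; rewrite -apply_kernelB // D_err addrK.
have err1 : nge (r + eta) (err xi).
  by apply: nge_le (nge_err h); have := eta_le_kappa; lra.
apply: (@ngeBC _ _ (apply_kernel P (err xi))); last exact: nge_P.
rewrite -op_err; last exact: bandP.
apply: ngeBC e1 _; rewrite op_err; last exact: bandQ.
by apply: ngeB => //; apply: nge_Q.
Qed.

End Kernels.

Lemma ngeD r u w : nge r u -> nge r w -> nge r (u + w).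
Proof. by move=> h k x; rewrite /ev !ffunE; apply: (ogeD val); [apply: h|apply: k]. Qed.

(** Membership in C(b): the normalized coefficients tend to zero. *)
Definition Cbn (w : Omega) := forall r, exists N, forall x : idx,
  (N <= wt x)%N -> oge (r + beta * wtr x) (ev w x).

Lemma rat_archi (x y : rat) : 0 < y -> exists N : nat, x <= N%:R * y.
Proof.
move=> y0; exists (Num.bound `|x / y|).
rewrite -ler_pdivrMr //; apply: le_trans (ler_norm _) _.
by rewrite ltW // archi_boundP.
Qed.

Lemma Cbn_nge w : Cbn w -> exists r, nge r w.
Proof.
move=> /(_ 0)[N hN].
have [r hr] : exists r, forall x, x \in box n N -> oge (r + beta * wtr x) (ev w x).
  elim: (box n N) => [|x s [r IH]]; first by exists 0.
  exists (Num.min r (ord (ev w x) - beta * wtr x)) => y; rewrite inE => /orP[/eqP ->|ys].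
    by apply: oge_ord; rewrite -lerBrDr ge_min lexx orbT.
  by apply: oge_le (IH y ys); rewrite lerD2r ge_min lexx.
exists (Num.min r 0) => x; have [xN|xN] := leqP N (wt x).
  by apply: oge_le (hN x xN); rewrite lerD2r ge_min lexx orbT.
apply: oge_le (hr x _); first by rewrite lerD2r ge_min lexx.
by rewrite mem_box (leq_ltn_trans (leq_wt d x)).
Qed.

Lemma CbnB u w : Cbn u -> Cbn w -> Cbn (u - w).
Proof.
move=> h k r; have [N hN] := h r; have [N' hN'] := k r.
exists (maxn N N') => x; rewrite geq_max => /andP[xN xN'].
by rewrite evB; apply: (ogeB val); [apply: hN|apply: hN'].
Qed.

Lemma Cbn0 : Cbn 0.
Proof. by move=> r; exists 0%N => x _; rewrite /ev ffunE oge0. Qed.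

Lemma Cbn_near u : (forall r, exists2 v, Cbn v & nge r (u - v)) -> Cbn u.
Proof.
move=> h r; have [v vC uv] := h r; have [N hN] := vC r.
by exists N => x /hN vx; rewrite -(subrK (ev v x) (ev u x)) -evB; apply: (ogeD val).
Qed.

Lemma CbnD u w : Cbn u -> Cbn w -> Cbn (u + w).
Proof.
move=> h k; rewrite -[w]opprK -[- w]sub0r; apply: CbnB => //.
by apply: CbnB => //; apply: Cbn0.
Qed.

Lemma Cbn_op k w : (forall x z, oge 0 (k x z)) ->
  (forall x z, k x z != 0 -> (wt z <= wt x + e)%N) -> Cbn w -> Cbn (apply_kernel k w).
Proof.
move=> kint kb h r; have [N hN] := h (r + beta * e%:R).
exists (N + e)%N => -[J v] zN; rewrite /ev ffunE; apply: (oge_sum val) => x _.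
have [->|/kb xz] := eqVneq (k x (J, v)) 0; first by rewrite mulr0 oge0.
rewrite -[X in oge X _]addr0; apply: (ogeM val) => //.
apply: oge_le (hN x _); last by lia.
by have := ler_wt xz; rewrite natrD; lra.
Qed.

Lemma Cbn_phic w : Cbn w -> Cbn (phic w).
Proof.
move=> h r; have [N hN] := h r; exists N => z zN.
rewrite (phic_kos _ (ltnSn _)); apply: (oge_sum val) => y _.
have [->|/kc_wt yz] := eqVneq (kc y z) 0; first by rewrite mulr0 oge0.
rewrite -[X in oge X _]addr0; apply: (ogeM val) (kc_int _ _).
by apply: oge_le (hN y _); [rewrite lerD2l ler_wt|lia].
Qed.

(** Coefficients of small weight cannot spoil the convergence, thanks to the gain
    per unit of weight. *)
Lemma Cbn_err w : Cbn w -> Cbn (err w).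
Proof.
move=> h r; have [N hN] := h r; have [s hs] := Cbn_nge h.
have [k kE] := rat_archi (r - s) grow_gt0.
exists (N + k)%N => z zN; apply: err_oge => y /=.
have m1 := le_max kappa kappa (grow * (wtr z - wtr y)).
have m2 := le_max (grow * (wtr z - wtr y)) kappa (grow * (wtr z - wtr y)).
rewrite lexx /= in m1; rewrite lexx orbT in m2.
set m := Num.max _ _ in m1 m2 *.
have [yN|yN] := leqP N (wt y).
  by apply: oge_le (hN y yN); have := kappa_gt0; lra.
apply: oge_le (hs y).
have : (k%:R : rat) <= wtr z - wtr y.
  by rewrite lerBrDr -natrD ler_nat; lia.
by rewrite -(ler_pM2l grow_gt0); lra.
Qed.

Lemma Cbn_D w : Cbn w -> Cbn (D w).
Proof. by move=> h; rewrite D_err; apply: CbnD; [exact: Cbn_phic|exact: Cbn_err]. Qed.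

Lemma nge_eq0 r w : (forall j : nat, nge (r + j%:R * eta) w) -> w = 0.
Proof.
move=> h; apply: ev_ext => x; rewrite {2}/ev ffunE; apply: (oge_eq0 (ord := ord)) => s.
have [j jE] := rat_archi (s - r - beta * wtr x) eta_gt0.
by apply: oge_le (h j x); lra.
Qed.

Lemma ev_sum (I : Type) (s : seq I) (w : I -> Omega) x :
  ev (\sum_(i <- s) w i) x = \sum_(i <- s) ev (w i) x.
Proof. by rewrite /ev sum_ffunE fct_sumE. Qed.

(** A series whose terms gain eta at each step converges coefficient by
    coefficient, and its sum is in C(b) because it is arbitrarily close to
    finite sums. *)
Lemma series_sum (s : nat -> Omega) r :
  (forall j, nge (r + j%:R * eta) (s j)) -> (forall j, Cbn (s j)) ->
  exists xi, [/\ Cbn xi, forall j : nat, nge (r + j%:R * eta) (xi - \sum_(i < j) s i)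
    & forall x, (forall j, ev (s j) x = 0) -> ev xi x = 0].
Proof.
move=> sr sC; pose t j := \sum_(i < j) s i.
have tail j i : nge (r + j%:R * eta) (t (j + i)%N - t j).
  elim: i => [|i IH]; first by rewrite addn0 subrr; apply: nge0.
  rewrite addnS {1}/t big_ord_recr /= -/(t _) addrAC; apply: ngeD; first exact: IH.
  apply: nge_le (sr _); rewrite lerD2l natrD mulrDl lerDl.
  by rewrite mulr_ge0 // ltW ?eta_gt0.
have cauchy x : is_cauchy ord (fun j => ev (t j) x).
  move=> R; have [N NE] := rat_archi (R - r - beta * wtr x) eta_gt0.
  exists N => l k Nl Nk.
  have -> : ev (t l) x - ev (t k) x = ev (t l - t N) x - ev (t k - t N) x.
    by rewrite !evB opprB addrA subrK.
  apply: (@oge_le _ _ (r + N%:R * eta + beta * wtr x)); first by lra.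
  by rewrite -(subnKC Nl) -(subnKC Nk); apply: (ogeB val); apply: tail.
have /choice[g gE] x := complete (cauchy x).
pose xi : Omega := [ffun J => fun v => g (J, v)].
have xiE x : ev xi x = g x by rewrite /ev ffunE; case: x.
have near j : nge (r + j%:R * eta) (xi - t j).
  move=> x; have [N hN] := gE x (r + j%:R * eta + beta * wtr x).
  have -> : ev (xi - t j) x = ev (t (j + N)%N - t j) x - (ev (t (j + N)%N) x - g x).
    by rewrite !evB xiE opprB [RHS]addrC addrA subrK.
  by apply: (ogeB val); [apply: tail|apply: hN; rewrite leq_addl].
have tC j : Cbn (t j).
  rewrite /t; elim/big_ind: _ => [|u w|i _]; [exact: Cbn0|exact: CbnD|exact: sC].
exists xi; split=> //.
  apply: Cbn_near => R; have [j jE] := rat_archi (R - r) eta_gt0.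
  by exists (t j) => //; apply: nge_le (near j); lra.
move=> x sx; apply: (oge_eq0 (ord := ord)) => R.
have [j jE] := rat_archi (R - r - beta * wtr x) eta_gt0.
have tx : ev (t j) x = 0.
  by rewrite /t -(big_mkord xpredT s) ev_sum big1 // => i _.
have := near j x; rewrite evB tx subr0; apply: oge_le; lra.
Qed.

Lemma zmod_telescope (V : zmodType) (x y v u P : V) :
  x - y - v + (u + y) + (P + v) = x + u + P.
Proof. by rewrite [P + v]addrC addrA [_ - v + _ + v]addrAC subrK [u + y]addrC addrA subrK. Qed.

Lemma DD u w : D (u + w) = D u + D w.
Proof. by rewrite -[u]scale1r D_linear !scale1r. Qed.

(** Summing the steps w_j - D S w_j - Pop w_j of a sequence whose sizes tend to
    infinity. *)
Lemma perturbation_series m E U S P Q G (H : homotopy m E U S P Q G) (Pop : Omega -> Omega)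
  (w : nat -> Omega) r :
  (forall s v, nge s v -> nge s (Pop v)) -> (forall v, Cbn v -> Cbn (Pop v)) ->
  (forall j, w j.+1 = w j - D (apply_kernel S (w j)) - Pop (w j)) ->
  Cbn (w 0%N) -> (forall j : nat, nge (r + j%:R * eta) (w j)) ->
  exists xi q, [/\ Cbn xi, Cbn q, w 0%N = D xi + q,
    forall x : idx, #|x.1|.+1 != m -> ev xi x = 0
    & forall x, (forall j, ev (Pop (w j)) x = 0) -> ev q x = 0].
Proof.
move=> Pn PC wS w0 wn.
have SC v : Cbn v -> Cbn (apply_kernel S v).
  apply: Cbn_op => [x z|x z /(hS H)[_ [_ h]]]; first exact: (S_int H).
  by lia.
have wC j : Cbn (w j).
  elim: j => // j IH; rewrite wS; apply: CbnB; last exact: PC.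
  by apply: CbnB => //; apply: Cbn_D; apply: SC.
have [|j|xi [xiC xin xi0]] := @series_sum (fun j => apply_kernel S (w j)) (r - loss).
- by move=> j; apply: nge_le (nge_S H (wn j)); lra.
- exact: SC.
have [|j|q [qC qn q0]] := @series_sum (fun j => Pop (w j)) r.
- by move=> j; apply: Pn.
- exact: PC.
exists xi, q; split=> //; last first.
  by move=> x xm; apply: xi0 => j; apply: (is_deg_opS H).
have wE j : w 0%N = w j + D (\sum_(i < j) apply_kernel S (w i)) + \sum_(i < j) Pop (w i).
  elim: j => [|j IH].
    by rewrite !big_ord0 addr0 -[0](subrr 0) DB !subrr addr0.
  by rewrite {1}IH wS !big_ord_recr /= DD zmod_telescope.
apply/eqP; rewrite -subr_eq0; apply/eqP; apply: (@nge_eq0 (r - loss)) => j.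
have -> : w 0%N - (D xi + q) =
    w j - D (xi - \sum_(i < j) apply_kernel S (w i)) - (q - \sum_(i < j) Pop (w i)).
  by rewrite {1}(wE j) DB !opprB opprD addrACA [w j + (_ - _)]addrA.
apply: ngeB; last by apply: nge_le (qn j); have := loss_ge0; lra.
apply: ngeB; first by apply: nge_le (wn j); have := loss_ge0; lra.
exact: nge_D.
Qed.

(** The sequence of [perturbation_series] with Pop = 0 consists of cocycles, as D
    is of square zero, and gains eta at each step by [nge_homotopy_exact]. *)
Lemma vanishing m E U S P Q G (H : homotopy m E U S P Q G) w :
  E -> Cbn w -> is_deg m w -> D w = 0 ->
  exists xi, [/\ Cbn xi, forall x : idx, #|x.1|.+1 != m -> ev xi x = 0 & D xi = w].
Proof.
move=> HE wC wm Dw; have [r wr] := Cbn_nge wC.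
pose W j := iter j (fun v => v - D (apply_kernel S v)) w.
have Wm j : is_deg m (W j) /\ D (W j) = 0.
  elim: j => // j [IH1 IH2]; rewrite /W iterS -/(W j); split.
    by apply: is_degB => //; apply: (is_deg_DS H).
  by rewrite DB IH2 D_sq0 subrr.
have Wn j : nge (r + j%:R * eta) (W j).
  elim: j => [|j IH]; first by rewrite mul0r addr0.
  rewrite /W iterS -/(W j).
  have := @nge_homotopy_exact _ _ _ _ _ _ _ H _ (r + j.+1%:R * eta + loss) _ HE (Wm j).1 IH.
  rewrite (Wm j).2 => /(_ (nge0 _)); apply: nge_le.
  by rewrite addrK le_min lexx andbT -[j.+1]addn1 natrD mulrDl mul1r addrA.
have [||||xi [q [xiC qC wE xim q0]]] :=
  perturbation_series H (Pop := fun=> 0) (w := W) (r := r) _ _ _ _ Wn.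
- by move=> s v _; apply: nge0.
- by move=> v _; apply: Cbn0.
- by move=> j; rewrite subr0.
- exact: wC.
exists xi; split=> //; rewrite -[RHS]/(W 0%N) wE.
rewrite [X in _ + X](_ : q = 0) ?addr0 //; apply: ev_ext => x; rewrite q0 ?/ev ?ffunE //.
Qed.

Lemma spanning m E U S P Q G (H : homotopy m E U S P Q G) w :
  Cbn w -> is_deg m w ->
  exists xi q, [/\ Cbn xi, forall x : idx, #|x.1|.+1 != m -> ev xi x = 0,
    w = D xi + q & forall x, ~~ U x -> ev q x = 0].
Proof.
move=> wC wm; have [r wr] := Cbn_nge wC.
pose W j := iter j (fun v => v - D (apply_kernel S v) - apply_kernel P v) w.
have Wm j : is_deg m (W j).
  elim: j => // j IH; rewrite /W iterS -/(W j).
  by apply: is_degB; [apply: is_degB => //; apply: (is_deg_DS H)|apply: (is_deg_opP H)].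
have Wn j : nge (r + j%:R * eta) (W j).
  elim: j => [|j IH]; first by rewrite mul0r addr0.
  rewrite /W iterS -/(W j); have := nge_homotopy H (Wm j) IH.
  by apply: nge_le; rewrite -[j.+1]addn1 natrD mulrDl mul1r addrA.
have [||||xi [q [xiC qC wE xim q0]]] :=
  perturbation_series H (Pop := apply_kernel P) (w := W) (r := r) _ _ _ _ Wn.
- by move=> s v; apply: (nge_P H).
- move=> v; apply: Cbn_op => [x z|x z /(hP H)[_ [_ [h _]]]]; first exact: (P_int H).
  by rewrite h leq_addr.
- by [].
- exact: wC.
exists xi, q; split=> // -[J u] nU; apply: q0 => j.
rewrite /ev ffunE big1 // => x _.
have [->|/(hP H)[_ [_ [_ Ux]]]] := eqVneq (P x (J, u)) 0; first by rewrite mulr0.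
by rewrite Ux in nU.
Qed.

(** If w = D xi is nonzero, let r be its size, attained at x0. Exactness in
    degree m improves xi step by step until its size is at least r - loss;
    then P w has size at least r + eta by [nge_boundary], which contradicts
    the fact that P w and w agree at x0, an element of U. *)
Lemma independence m E U S P Q G (H : homotopy m.+1 E U S P Q G)
    E' U' S' P' Q' G' (H' : homotopy m E' U' S' P' Q' G') (s : seq idx) w xi :
  E' -> (forall x, x \in s -> U x) -> (forall x, x \notin s -> ev w x = 0) ->
  Cbn xi -> is_deg m xi -> w = D xi -> w = 0.
Proof.
move=> HE sU w0 xiC xim wE; apply: contrapT => wn0.
pose size_at x := ord (ev w x) - beta * wtr x.
have [x0 [x0s wx0 x0min]] : exists x0, [/\ x0 \in s, ev w x0 != 0 &
    forall x, ev w x != 0 -> size_at x0 <= size_at x].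
  have minimal (t : seq idx) : (exists2 x, x \in t & ev w x != 0) ->
      exists x0, [/\ x0 \in t, ev w x0 != 0 &
        forall x, x \in t -> ev w x != 0 -> size_at x0 <= size_at x].
    elim: t => [|y t IH]; first by case.
    have [[z zt wz] _|nt] := pselect (exists2 x, x \in t & ev w x != 0).
      have [x0 [x0t wx0 hx0]] := IH (ex_intro2 _ _ z zt wz).
      have [wy|wy] := eqVneq (ev w y) 0.
        exists x0; rewrite inE x0t orbT; split=> // x; rewrite inE => /orP[/eqP->|].
          by rewrite wy eqxx.
        exact: hx0.
      have [h|h] := lerP (size_at x0) (size_at y).
        exists x0; rewrite inE x0t orbT; split=> // x; rewrite inE => /orP[/eqP->//|].
        exact: hx0.
      exists y; rewrite mem_head; split=> // x; rewrite inE => /orP[/eqP->//|xt wx].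
      exact: le_trans (ltW h) (hx0 x xt wx).
    move=> [z]; rewrite inE => /orP[/eqP->|zt wz]; last by case: nt; exists z.
    move=> wy; exists y; rewrite mem_head; split=> // x; rewrite inE => /orP[/eqP->//|xt wx].
    by case: nt; exists x.
  have [x0 [x0s wx0 hx0]] : exists x0, [/\ x0 \in s, ev w x0 != 0 &
        forall x, x \in s -> ev w x != 0 -> size_at x0 <= size_at x].
    apply: minimal; apply: contrapT => hn; apply: wn0; apply: ev_ext => x.
    rewrite [RHS](_ : _ = 0); last by rewrite /ev ffunE.
    apply/eqP; apply: contrapT => /negP wx; apply: hn; exists x => //.
    by apply: contraNT wx => /w0 ->.
  exists x0; split=> // x wx; apply: hx0 => //.
  by apply: contraNT wx => /w0 ->.
pose r := size_at x0.
have wr : nge r w.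
  move=> x; have [->|wx] := eqVneq (ev w x) 0; first exact: oge0.
  by apply: oge_ord; rewrite -lerBrDr; apply: x0min.
have [t xit] := Cbn_nge xiC.
have reduce j : exists xi', [/\ is_deg m xi', D xi' = w &
    nge (Num.min (t + j%:R * eta) (r - loss)) xi'].
  elim: j => [|j [v [vm vD vn]]].
    exists xi; split=> //; apply: nge_le xit.
    by rewrite mul0r addr0 ge_min lexx.
  exists (v - D (apply_kernel S' v)); split.
  - by apply: is_degB => //; apply: (is_deg_DS H').
  - by rewrite DB D_sq0 subr0.
  rewrite -vD in wr.
  apply: nge_le (nge_homotopy_exact H' HE vm vn wr).
  have e0 := eta_gt0; rewrite -[j.+1]addn1 natrD mulrDl mul1r.
  rewrite le_min; apply/andP; split; last by rewrite ge_min lexx orbT.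
  have [h|h] := lerP (t + j%:R * eta) (r - loss).
    by rewrite ge_min addrA lexx.
  by rewrite ge_min; apply/orP; right; lra.
have [j jE] := rat_archi (r - loss - t) eta_gt0.
have [v [vm vD vn]] := reduce j.
have vn' : nge (r - loss) v.
  by apply: nge_le vn; rewrite le_min lexx andbT; lra.
have wr' : nge r (D v) by rewrite vD.
have vm' (x : idx) : #|x.1|.+1 != m.+1 -> ev v x = 0 by rewrite eqSS; apply: vm.
have := nge_boundary H vm' vn' wr' x0.
have x0m : #|x0.1| = m.+1.
  exact: (hU H (sU _ x0s)).
have -> : ev (apply_kernel P (D v)) x0 = ev w x0.
  rewrite vD (apply_kernelE _ (bandP H) (ltnSn _)) (sum_box1 (x := x0)) => [||x xx0].
  - by rewrite (hI4 H) ?sU // eqxx mulr1.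
  - by rewrite ltnS (leq_trans (leq_wt d x0)) ?leq_addr.
  have [/sU Ux|/w0 ->] := boolP (x \in s); last by rewrite mul0r.
  by rewrite (hI4 H) // (negbTE xx0) mulr0.
rewrite oge_neq0 // /r /size_at; have := eta_gt0; lra.
Qed.

End Homotopy.


(** * The Dwork complex *)

(** Lifting the entries one by one turns identities over F_q into congruences
    modulo the maximal ideal of K, which p generates. *)
Lemma lift_kernels (p a n e m : nat) (Fq : finFieldType) (f : {mpoly Fq[n]})
    (Qp : fieldType) (L : fieldExtType Qp) (ord : L -> rat) (K : {subfield L})
    (red : L -> Fq) (c : 'I_n -> pseries n L) U S P Q G :
  prime p -> is_valuation ord -> is_Qp p (fun x : Qp => ord x%:A) ->
  is_unramified a ord K red ->
  (forall i u, lifts ord K red (c i u) (pcoef f i u)) ->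
  kernels f e m U S P Q G ->
  exists S' P' Q' G',
    homotopy (msize f).-1.-1 e ord c m (exact_at f e m) U S' P' Q' G'.
Proof.
move=> p_pr val QpP KP cl kern.
have [T [T0 T1 TL]] := exists_lift val KP.
have Tn0 x : T x != 0 -> x != 0 by apply: contra_neq => ->.
have kl y z : lifts ord K red (kos c y z) (kos (pcoef f) y z).
  exact: (lifts_kos val KP).
have T_int x : ord_ge ord 0 (T x) by have [] := TL x.
have small x : lifts ord K red x 0 -> ord_ge ord 1 x by apply: (lifts0_oge1 p_pr QpP KP).
have sumL N (g h : idx n -> L) (g' h' : idx n -> Fq) :
    (forall x, lifts ord K red (g x) (g' x)) -> (forall x, lifts ord K red (h x) (h' x)) ->
    lifts ord K red (\sum_(x <- box n N) g x * h x) (\sum_(x <- box n N) g' x * h' x).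
  by move=> gg hh; apply: (lifts_sum val KP) => x _; apply: (liftsM val KP).
exists (fun x y => T (S x y)), (fun x y => T (P x y)), (fun x y => T (Q x y)),
  (fun x y => T (G x y)); split.
- by move=> x y /Tn0 /(kS kern).
- by move=> x y /Tn0 /(kP kern).
- by move=> x y /Tn0 /(kQ kern).
- by move=> x y /Tn0 /(kG kern).
- by [].
- move=> N x z xN xm zm xz; apply: small.
  rewrite -[X in lifts _ _ _ _ X](subrr (P x z)).
  apply: (liftsB val KP); last exact: TL.
  have -> : P x z = (x == z)%:R - \sum_(y <- box n N) S x y * kos (pcoef f) y z.
    by rewrite (kI1 kern) // subKr.
  by apply: (liftsB val KP); [exact: (lifts_nat val KP)|exact: sumL].
- move=> N y z zN ym zm yz; apply: small.
  rewrite -[X in lifts _ _ _ _ X](subrr (\sum_(x <- box n N) kos (pcoef f) y x * P x z)).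
  apply: (liftsB val KP); first exact: sumL.
  by rewrite (kI2 kern) //; apply: sumL.
- move=> E N x z zN xm zm xz; apply: small.
  rewrite -[X in lifts _ _ _ _ X](subrr (P x z)).
  apply: (liftsB val KP); first exact: TL.
  by rewrite (kI3 kern E zN) //; apply: sumL.
- exact: (kU kern).
- by move=> x z Ux zm; rewrite (kI4 kern) //; case: eqP.
Qed.

Section Comparison.
Variables (p a n delta e : nat) (Fq : finFieldType) (f : {mpoly Fq[n]}) (b : rat).
Variables (Qp : fieldType) (L : fieldExtType Qp) (ord : L -> rat) (K : {subfield L}).
Variables (red : L -> Fq) (zeta : L) (tau : 'End(L)) (gamma : L) (M : nat) (pi : L).
Variable fhat : {mpoly L[n]}.
Hypothesis p_pr : prime p.
Hypothesis n_gt0 : (0 < n)%N.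
Hypothesis delta_gt0 : (0 < delta)%N.
Hypothesis f_delta : msize f = delta.+1.
Hypothesis e_gt0 : (0 < e)%N.
Hypothesis e_le : (e <= delta)%N.
Hypothesis b_gt : delta%:R / ((p%:R - 1) * (delta%:R - e%:R + 1)) < b.
Hypothesis b_lt : b < p%:R * delta%:R / ((p%:R - 1) * delta%:R + e%:R - 1).
Hypothesis ds : dwork_setting p a delta b ord K red zeta tau gamma M pi.
Hypothesis fl : is_teichmuller_lift K red f fhat.
Local Notation oge := (ord_ge ord).
Local Notation Omega := (forms n (pseries n L)).
Local Notation beta := (slope delta b).
Local Notation Dn := (normD p tau gamma fhat).
Local Notation Cbn := (Cbn delta.-1 ord beta).
Local Notation Cb := (Cb b ord M pi : set (pseries n L)).
Local Notation Dd := (Dd p delta b tau gamma M pi fhat).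
Let val := ds_valuation ds.

Lemma theta_linear i : linear (theta p tau gamma fhat i).
Proof.
move=> k x y; apply/funext => u.
rewrite /theta -[RHS]/(k * (ps_deriv i x u + ps_mul _ x u) + (ps_deriv i y u + ps_mul _ y u)).
rewrite -[LHS]/(ps_deriv i (k *: x + y) u + ps_mul _ (k *: x + y) u) mulrDr addrACA.
congr (_ + _); first by rewrite !ps_derivE -[(k *: x + y) _]/(k * x _ + y _) mulrDr mulrCA.
rewrite /ps_mul mulr_sumr -big_split /=; apply: eq_bigr => v _.
by rewrite -[(k *: x + y) _]/(k * x _ + y _) mulrDr mulrCA.
Qed.

Let psi := pi ^ epsilon p delta b M * gamma.

Lemma Dd_Dn (w : Omega) : Dd w = psi *: Dn w.
Proof.
apply/ffunP => J; rewrite /Dd /normD /koszul !ffunE scaler_sumr; apply: eq_bigr => i _.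
rewrite /D_ -/(theta p tau gamma fhat i _) !scalerA; congr (_ *: _).
by rewrite [RHS]mulrAC -[psi]/(_ * gamma) mulfK ?(ds_gamma_neq0 ds) // mulrC.
Qed.

Lemma dwork_perturbed :
  perturbed_koszul delta.-1 e ord beta (gain p b) (growth p delta b) (chat fhat) Dn.
Proof.
have lin i : linear (fun xi : pseries n L => gamma^-1 *: theta p tau gamma fhat i xi).
  move=> k x y; rewrite theta_linear scalerDr !scalerA; congr (_ *: _ + _).
  by rewrite mulrC.
split.
- exact: val.
- exact: (complete_L val (Qp_complete (ds_Qp ds))).
- exact: e_gt0.
- exact: (slope_gt0 p_pr delta_gt0 e_gt0 e_le b_gt).
- exact: (growth_gt0 p_pr delta_gt0 e_gt0 e_le b_gt b_lt).
- exact: (loss_lt_gain p_pr delta_gt0 e_gt0 e_le b_gt b_lt).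
- exact: (loss_lt1 p_pr delta_gt0 e_gt0 e_le b_gt b_lt).
- move=> i u; exact: (chat_deg p_pr delta_gt0 f_delta e_gt0 e_le b_gt b_lt ds fl).
- move=> i u; by have [] := chat_lifts ds fl i u.
- exact: (koszul_linear lin).
- apply: (koszul_sq0 lin) => i j x.
  have thetaZ' k l y : theta p tau gamma fhat l (k *: y) = k *: theta p tau gamma fhat l y.
    exact: (thetaZ theta_linear).
  by rewrite !thetaZ' (thetaC _ _ _ (prime_gt1 p_pr)).
- by move=> w J; apply: (koszul_supp lin).
- move=> w z r h; exact: (Err_oge p_pr delta_gt0 f_delta e_gt0 e_le b_gt b_lt ds fl h).
Qed.

Lemma pi_neq0 : pi != 0.
Proof.
have := (ord_p (ds_Qp ds)).1; rewrite -(ds_pi ds); apply: contraNneq => ->.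
by rewrite expr0n eqn0Ngt muln_gt0 (ds_M_gt0 ds) delta_gt0.
Qed.

Lemma psi_neq0 : psi != 0.
Proof. by rewrite /psi mulf_neq0 ?(ds_gamma_neq0 ds) // expfz_neq0 // pi_neq0. Qed.

(** The factor pi^(M b |u|) of the definition of C(b) has order
    (b / delta) |u|. *)
Lemma ord_pi_floor k : ord (pi ^ Num.floor (M%:R * b * k%:R)) = beta * k%:R.
Proof.
have Mb : M%:R * b * k%:R \is a @Num.int rat.
  have -> : M%:R * b * k%:R = (M%:R * b / p%:R) * p%:R * k%:R.
    by rewrite divfK // pnatr_eq0 -lt0n prime_gt0.
  by apply: rpredM (natr_int _ _); apply: rpredM (natr_int _ _); apply: (ds_M_b ds).
have b0 : 0 <= M%:R * b * k%:R.
  have := slope_gt0 p_pr delta_gt0 e_gt0 e_le b_gt.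
  rewrite /slope pmulr_lgt0 ?invr_gt0 ?ltr0n // => b0.
  by apply: mulr_ge0 (ler0n _ _); apply: mulr_ge0 (ler0n _ _) (ltW _).
have fE := floorK Mb; have : 0 <= Num.floor (M%:R * b * k%:R) by rewrite floor_ge0.
case: (Num.floor _) fE => // j jE _; rewrite -[pi ^ _]/(pi ^+ j) (ordX val) ?pi_neq0 //.
have op : (M * delta)%:R * ord pi = 1.
  by rewrite -(ordX val) ?pi_neq0 // (ds_pi ds) (ord_p (ds_Qp ds)).2.
have M0 : M%:R != 0 :> rat by rewrite pnatr_eq0 -lt0n (ds_M_gt0 ds).
have D0 : delta%:R != 0 :> rat by rewrite pnatr_eq0 -lt0n.
have -> : j%:R = M%:R * b * k%:R by rewrite -jE.
have -> : ord pi = ((M * delta)%:R)^-1.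
  by apply: (mulfI (x := (M * delta)%:R)); rewrite ?op ?mulfV // natrM mulf_neq0.
by rewrite /slope natrM; field; rewrite M0 D0.
Qed.

Lemma Cb_oge (g : pseries n L) : Cb g <->
  forall r, exists N, forall u, (N <= mdeg u)%N -> oge (r + beta * (mdeg u)%:R) (g u).
Proof.
pose q u := pi ^ Num.floor (M%:R * b * (mdeg (u : 'X_{1..n}))%:R).
have q0 u : q u != 0 by rewrite expfz_neq0 // pi_neq0.
have qE u : ord (q u) = beta * (mdeg u)%:R by apply: ord_pi_floor.
split=> [[A [A0 gE]] r|h].
  have [N hN] := A0 r; exists N => u /hN Au; rewrite gE.
  by apply: (ogeM val) => //; apply: oge_ord; rewrite -/(q u) qE.
exists (fun u => g u / q u); split=> [r|u]; last by rewrite divfK.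
have [N hN] := h r; exists N => u /hN gu.
rewrite -[r](addrK (beta * (mdeg u)%:R)) (ogeM val) //.
by apply: oge_ord; rewrite (ordV val) // qE.
Qed.

Lemma is_form_Cbn (k : int) (w : Omega) : is_form Cb k w <->
  Cbn w /\ forall x : idx n, #|x.1|%:Z != k -> ev w x = 0.
Proof.
have b0 := slope_gt0 p_pr delta_gt0 e_gt0 e_le b_gt.
split=> [h|[wC w0] I]; last first.
  split=> [|Ik]; last by apply/funext => u; apply: (w0 (I, u)).
  apply/Cb_oge => r; have [N hN] := wC r; exists N => u uN.
  have xN : (N <= weight delta.-1 (I, u))%N by apply: leq_trans uN (leq_wt _ (I, u)).
  apply: oge_le (hN _ xN); rewrite lerD2l ler_pM2l // ler_nat.
  exact: (leq_wt _ (I, u)).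
split=> [r|[I u] Ik]; last by rewrite /ev (h I).2.
pose r' := r + beta * (n * delta.-1)%:R.
have /choice[N hN] (I : {set 'I_n}) : exists N, forall u, (N <= mdeg u)%N ->
    oge (r' + beta * (mdeg u)%:R) (w I u).
  by have /Cb_oge/(_ r') := (h I).1.
exists (\max_I N I + n * delta.-1)%N => -[I u] xN.
have c : ((n - #|I|) * delta.-1 <= n * delta.-1)%N by rewrite leq_mul2r leq_subr orbT.
have NI : (N I <= \max_I N I)%N by apply: leq_bigmax.
apply: oge_le (hN I u _); last first.
  apply: leq_trans NI _; rewrite -(leq_add2r (n * delta.-1)); apply: leq_trans xN _.
  by rewrite /weight /= leq_add2l.
rewrite /r' -addrA lerD2l -mulrDr -natrD ler_pM2l // ler_nat /weight /= addnC leq_add2r //.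
Qed.

Lemma DnZ k w : Dn (k *: w) = k *: Dn w.
Proof.
exact: (thetaZ (theta := fun _ : 'I_n => Dn) (fun=> pk_linear dwork_perturbed) (Ordinal n_gt0)).
Qed.

Lemma CbnZ k (w : Omega) : Cbn w -> Cbn (k *: w).
Proof.
move=> h r; have [N hN] := h (r - ord k); exists N => x /hN wx.
have -> : ev (k *: w) x = k * ev w x by rewrite /ev ffunE.
have -> : r + beta * (weight delta.-1 x)%:R =
    ord k + (r - ord k + beta * (weight delta.-1 x)%:R) by ring.
by apply: (ogeM val) => //; apply: oge_ord.
Qed.

Let f_delta1 : (msize f).-1 = delta. Proof. by rewrite f_delta. Qed.
Let f_gt0 : (0 < (msize f).-1)%N. Proof. by rewrite f_delta1. Qed.

Lemma dwork_homotopy m U S P Q G : kernels f e m U S P Q G ->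
  exists S' P' Q' G',
    homotopy delta.-1 e ord (chat fhat) m (exact_at f e m) U S' P' Q' G'.
Proof.
move=> kern; rewrite -f_delta1.
apply: (lift_kernels p_pr val (ds_Qp ds) (ds_K ds) _ kern) => i u.
exact: (chat_lifts ds fl).
Qed.

Lemma Dd_eq0 (w : Omega) : Dd w = 0 -> Dn w = 0.
Proof.
by rewrite Dd_Dn => /eqP; rewrite scaler_eq0 (negbTE psi_neq0) => /eqP.
Qed.

Lemma form_pred (k : nat) (w : Omega) : is_form Cb (k%:Z - 1) w <->
  Cbn w /\ forall x : idx n, #|x.1|.+1 != k -> ev w x = 0.
Proof.
have kE (x : idx n) : (#|x.1|%:Z != k%:Z - 1) = (#|x.1|.+1 != k).
  by congr (~~ _); apply/eqP/eqP; move: #|_| => j; clear; lia.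
rewrite is_form_Cbn; split=> -[wC w0]; split=> // x xk; apply: w0.
  by rewrite kE.
by rewrite -kE.
Qed.

Lemma form_nat (k : nat) (w : Omega) : is_form Cb k%:Z w <-> Cbn w /\ is_deg k w.
Proof. by rewrite is_form_Cbn. Qed.

Lemma coboundaryP (k : nat) (w : Omega) :
  HD_coboundaries p delta b ord tau gamma M pi fhat k%:Z w <->
  exists xi, [/\ Cbn xi, forall x : idx n, #|x.1|.+1 != k -> ev xi x = 0 & w = Dn xi].
Proof.
split=> [[xi /form_pred[xiC xik] <-]|[xi [xiC xik ->]]].
  exists (psi *: xi); split; first exact: CbnZ.
    by move=> x /xik; rewrite /ev ffunE => xi0; rewrite -[LHS]/(psi * xi x.1 x.2) xi0 mulr0.
  by rewrite Dd_Dn DnZ.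
exists (psi^-1 *: xi); last by rewrite Dd_Dn DnZ scalerA mulfV ?psi_neq0 // scale1r.
apply/form_pred; split=> [|x /xik]; first exact: CbnZ.
by rewrite /ev ffunE => xi0; rewrite -[LHS]/(psi^-1 * xi x.1 x.2) xi0 mulr0.
Qed.

Lemma HD_eq0_of_exact m : exact_at f e m ->
  HD_eq0 p delta b ord tau gamma M pi fhat m%:Z.
Proof.
move=> E w [/form_nat[wC wm] /Dd_eq0 Dw].
have [U [S [P [Q [G kern]]]]] := exists_kernels f_gt0 m e_gt0.
have [S' [P' [Q' [G' H]]]] := dwork_homotopy kern.
have [xi [xiC xim xiE]] := vanishing dwork_perturbed H E wC wm Dw.
by apply/coboundaryP; exists xi.
Qed.

Lemma milnor_and_HD_dim : exact_at f e n.-1 ->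
  exists d : nat, Mf_is f d /\ HD_dim p delta b ord tau gamma M pi fhat n%:Z d.
Proof.
move=> E; pose dflt : idx n := (finset.set0, 0%MM).
have [U [S [P [Q [G kern]]]]] := exists_kernels f_gt0 n e_gt0.
have [S' [P' [Q' [G' H]]]] := dwork_homotopy kern.
have [s [us sU]] := exists_milnor_basis f_gt0 e_gt0 kern n_gt0 E.
have sU' x : x \in s -> U x by rewrite sU.
have sU'' x : U x -> x \in s by rewrite sU.
pose nths (i : 'I_(size s)) := nth dflt s i.
have nths_s i : nths i \in s by rewrite mem_nth.
have nths_inj (i j : 'I_(size s)) : (nths i == nths j) = (i == j) by rewrite nth_uniq.
have ofs (V : Type) (v0 : V) (c : 'I_(size s) -> V) :
    exists c' : idx n -> V, forall i, c' (nths i) = c i.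
  exists (fun x => if [pick i | nths i == x] is Some i then c i else v0) => i.
  by case: pickP => [j|/(_ i)]; rewrite ?eqxx // nths_inj => /eqP ->.
exists (size s); split.
  have combE (c : idx n -> Fq) : comb s c = \sum_i c (nths i) *: 'X_[(nths i).2].
    by rewrite /comb (big_nth dflt) big_mkord.
  exists (fun i => 'X_[(nths i).2]); split=> // [g _|c Jc i].
    have [c Jc] := standard_span f_gt0 e_gt0 kern us sU'' g.
    by exists (fun i => c (nths i)); rewrite -combE.
  have [c' c'E] := ofs _ 0 c; rewrite -c'E.
  apply: (standard_free f_gt0 e_gt0 kern E n_gt0 us sU') => //.
  by rewrite combE; under eq_bigr do rewrite c'E.
pose z (i : 'I_(size s)) : Omega :=
  [ffun J => fun u => ((J, u) == nths i)%:R].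
have evz i x : ev (z i) x = (x == nths i)%:R by rewrite /ev ffunE; case: x.
have ev_comb (c : 'I_(size s) -> L) x :
    ev (\sum_i c i *: z i) x = \sum_i c i * (x == nths i)%:R.
  rewrite ev_sum; apply: eq_bigr => i _.
  by rewrite -evz /ev ffunE.
have comb0 c x : x \notin s -> ev (\sum_i c i *: z i) x = 0.
  move=> xs; rewrite ev_comb big1 // => i _; case: eqP => [xi|]; rewrite ?mulr0 //.
  by rewrite xi nths_s in xs.
have comb_nth c i : ev (\sum_i c i *: z i) (nths i) = c i.
  rewrite ev_comb (bigD1 i) //= eqxx mulr1 big1 ?addr0 // => j ji.
  by rewrite nths_inj eq_sym (negbTE ji) mulr0.
have z_top i : is_deg n (z i).
  move=> x xn; rewrite evz; case: eqP => // xi.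
  by move: xn; rewrite xi (kU kern (sU' _ (nths_s i))) eqxx.
have DnT w : is_deg n w -> Dn w = 0.
  move=> wn; apply/ffunP => J; rewrite (pk_supp dwork_perturbed) ?ffunE // => i iJ.
  apply/funext => u; apply: (wn ((J :\ i)%SET, u)).
  have := max_card (mem J); rewrite card_ord (cardsD1 i J) iJ /=.
  by rewrite add1n neq_ltn => ->.
exists z; split=> [i|w [/form_nat[wC wn] _]|c].
- split; last by rewrite /= Dd_Dn DnT ?scaler0.
  apply/form_nat; split=> // r; exists (weight delta.-1 (nths i)).+1 => x xi.
  rewrite evz; case: eqP => [xE|_]; last exact: oge0.
  by rewrite xE ltnn in xi.
- have [xi [q [xiC xin wE q0]]] := spanning dwork_perturbed H wC wn.
  exists (fun i => ev q (nths i)); apply/coboundaryP; exists xi; split=> //.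
  rewrite {1}wE [X in _ - X](_ : _ = q) ?addrK //; apply: ev_ext => x.
  have [xs|xs] := boolP (x \in s); last by rewrite comb0 // q0 // sU.
  have xi_lt : (index x s < size s)%N by rewrite index_mem.
  have -> : x = nths (Ordinal xi_lt) by rewrite /nths /= nth_index.
  by rewrite comb_nth.
move=> /coboundaryP[xi [xiC xin wE]] i.
have nE : n = n.-1.+1 by rewrite prednK.
have [U1 [S1 [P1 [Q1 [G1 kern1]]]]] := exists_kernels f_gt0 n.-1 e_gt0.
have [S1' [P1' [Q1' [G1' H1]]]] := dwork_homotopy kern1.
have H2 : homotopy delta.-1 e ord (chat fhat) n.-1.+1 (exact_at f e n) U S' P' Q' G'.
  by rewrite prednK.
have xin1 : is_deg n.-1 xi.
  by move=> x xn; apply: xin; apply: contra xn => /eqP h; rewrite -eqSS prednK // h.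
rewrite -(comb_nth c i).
have -> := independence dwork_perturbed H2 H1 E sU' (comb0 c) xiC xin1 wE.
by rewrite /ev ffunE.
Qed.

End Comparison.

Theorem theorem1p13 (p a n delta e : nat) (Fq : finFieldType)
    (f : {mpoly Fq[n]}) (b : rat)
    (Qp : fieldType) (L : fieldExtType Qp) (ord : L -> rat) (K : {subfield L})
    (red : L -> Fq) (zeta : L) (tau : 'End(L)) (gamma : L) (M : nat) (pi : L)
    (fhat : {mpoly L[n]}) :
  prime p -> #|Fq| = (p ^ a)%N -> (0 < n)%N ->
  (0 < delta)%N -> msize f = delta.+1 ->
  (0 < e)%N -> (e <= delta)%N ->
  delta%:R / ((p%:R - 1) * (delta%:R - e%:R + 1)) < b ->
  b < p%:R * delta%:R / ((p%:R - 1) * delta%:R + e%:R - 1) ->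
  dwork_setting p a delta b ord K red zeta tau gamma M pi ->
  is_teichmuller_lift K red f fhat ->
  (forall m : nat, (m <= n)%N ->
     (forall r s : int, r + s = m%:Z -> Ess_eq0 f e%:Z r s) ->
     HD_eq0 p delta b ord tau gamma M pi fhat m%:Z)
  /\
  ((forall r s : int, r + s <> n%:Z -> Ess_eq0 f e%:Z r s) ->
     exists d : nat,
       Mf_is f d /\ HD_dim p delta b ord tau gamma M pi fhat n%:Z d).
Proof.
move=> p_pr _ n_gt0 delta_gt0 f_delta e_gt0 e_le b_gt b_lt ds fl.
have f_gt0 : (0 < (msize f).-1)%N by rewrite f_delta.
split=> [m mn E|E].
  apply: (HD_eq0_of_exact p_pr n_gt0 delta_gt0 f_delta e_gt0 e_le b_gt b_lt ds fl).
  exact: Ess_exact E.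
apply: (milnor_and_HD_dim p_pr n_gt0 delta_gt0 f_delta e_gt0 e_le b_gt b_lt ds fl).
by apply: (Ess_exact f_gt0 e_gt0) => r s rs; apply: E; rewrite rs; lia.
Qed.
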